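(* Let $0<\alpha<1$. For $s\ge0$, the bilinear estimates $$\|\partial_x(v_1v_2)\|_{X^{s,b-1}(\mathbb{R}^2)}\lesssim\|v_1\|_{X^{s,b}_\alpha(\mathbb{R}^2)}\|v_2\|_{X^{s,b}_\alpha(\mathbb{R}^2)}$$ and $$\|\partial_x(uv)\|_{X^{s,b-1}_\alpha(\mathbb{R}^2)}\lesssim\|u\|_{X^{s,b}(\mathbb{R}^2)}\|v\|_{X^{s,b}_\alpha(\mathbb{R}^2)}$$ hold with some $b>\frac12$.
   Context: $\langle\cdot\rangle=1+|\cdot|$, and for functions of $(x,t)\in\mathbb{R}\times\mathbb{R}$ with space-time Fourier transform $\widehat u(\xi,\tau)$: $\|u\|_{X^{s,b}}=\|\langle\xi\rangle^s\langle\tau-\xi^3\rangle^b\widehat u\|_{L^2_{\xi,\tau}}$ and $\|v\|_{X^{s,b}_\alpha}=\|\langle\xi\rangle^s\langle\tau-\alpha\xi^3\rangle^b\widehat v\|_{L^2_{\xi,\tau}}$. $\lesssim$ means up to a constant depending only on $s,b,\alpha$. *)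

(* Defs.v *)
From HB Require Import structures.
From mathcomp Require Import all_boot all_order all_algebra.
From mathcomp Require Import complex.
From mathcomp Require Import all_classical all_reals all_analysis.

Set Implicit Arguments.
Unset Strict Implicit.
Unset Printing Implicit Defensive.

Import Order.TTheory GRing.Theory Num.Theory.
Import numFieldNormedType.Exports.

Local Open Scope classical_set_scope.
Local Open Scope complex_scope.
Local Open Scope ring_scope.

Section FourierRestriction.
Context {R : realType}.
Implicit Types (z : R * R) (f : R * R -> R) (u g phi : R * R -> R[i]).

Local Notation leb2 := (@lebesgue_measure R \x @lebesgue_measure R)%E.
Local Notation plane := (measurableTypeR R * measurableTypeR R)%type.

Definition repart u z : R := complex.Re (u z).
Definition impart u z : R := complex.Im (u z).
Definition modulus u z : R := ComplexField.Normc.normc (u z).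

Definition cmeasurable u :=
  measurable_fun [set: plane] (repart u) /\ measurable_fun [set: plane] (impart u).

Definition cintegrable u :=
  leb2.-integrable setT (EFin \o repart u) /\
  leb2.-integrable setT (EFin \o impart u).

Definition cintegral u : R[i] :=
  Rintegral leb2 setT (repart u) +i* Rintegral leb2 setT (impart u).

Definition L2norm f : \bar R := 'N[leb2]_2%:E [EFin \o f]%E.

(* Partial derivatives: [false] is the space variable x, [true] is time t. *)
Definition axis (i : bool) : R * R := if i then (0, 1) else (1, 0).

Definition iter_partial (w : seq bool) f : R * R -> R :=
  foldr (fun i h => 'D_(axis i) h) f w.

(* The decay bounds are imposed on all iterated partials, so each of them is
   Lipschitz, hence continuous, and f is of class C^oo. *)
Definition real_schwartz f :=
  forall w : seq bool,
    (forall i z, derivable (iter_partial w f) z (axis i)) /\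
    (forall j k : nat, exists M : R, forall z,
       `|z.1| ^+ j * `|z.2| ^+ k * `|iter_partial w f z| <= M).

Definition schwartz phi := real_schwartz (repart phi) /\ real_schwartz (impart phi).

Definition cpartial_x phi : R * R -> R[i] := fun z =>
  'D_(axis false) (repart phi) z +i* 'D_(axis false) (impart phi) z.

(* phi^(xi, tau) = int phi(x, t) e^{-i(x xi + t tau)} dx dt *)
Definition fourier_schwartz phi : R * R -> R[i] := fun zeta =>
  cintegral (fun z => phi z * (cos (z.1 * zeta.1 + z.2 * zeta.2)
                               -i* sin (z.1 * zeta.1 + z.2 * zeta.2))).

(* Tempered distributions are given by their values on Schwartz functions;
   the values elsewhere are never used. *)
Definition distribution := (R * R -> R[i]) -> R[i].

Definition distr_of u : distribution := fun phi => cintegral (fun z => u z * phi z).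

Definition distr_partial_x (T : distribution) : distribution :=
  fun phi => - T (cpartial_x phi).

Definition distr_fourier (T : distribution) : distribution :=
  fun phi => T (fourier_schwartz phi).

Definition represents g (T : distribution) :=
  cmeasurable g /\
  forall phi, schwartz phi ->
    cintegrable (fun z => g z * phi z) /\ T phi = distr_of g phi.

Definition bracket (r : R) : R := 1 + `|r|.

Definition Xweight (alpha s b : R) (zeta : R * R) : R :=
  bracket zeta.1 `^ s * bracket (zeta.2 - alpha * zeta.1 ^+ 3) `^ b.

(* The Fourier transform g of T is unique almost everywhere when it is a
   function, so the infimum runs over a single value; it is +oo when the
   Fourier transform of T is not a function. X^{s,b} is the case alpha = 1. *)
Definition Xnorm (alpha s b : R) (T : distribution) : \bar R :=
  ereal_inf [set L2norm (fun zeta => Xweight alpha s b zeta * modulus g zeta) |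
             g in [set g | represents g (distr_fourier T)]].

(* For s, b >= 0 the elements of X_alpha^{s,b} are L^2 functions, by Plancherel. *)
Definition Xspace (alpha s b : R) u :=
  [/\ cmeasurable u, (L2norm (modulus u) < +oo)%E
    & (Xnorm alpha s b (distr_of u) < +oo)%E].

End FourierRestriction.

(* Main.v *)
Require Import Defs.
From HB Require Import structures.
From mathcomp Require Import all_boot all_order all_algebra.
From mathcomp Require Import complex.
From mathcomp Require Import all_classical all_reals all_analysis.
From mathcomp Require Import measurable_realfun.
From mathcomp Require Import ring lra.

(** The exponent is b = 3/4, so that the inputs carry the modulation weight
    <tau - a xi^3>^(3/4) and the output carries <tau - a xi^3>^(-1/4).

    Fourier side.  If g1, g2 in L^2 are the transforms of v1, v2 in L^2, then
    the transform of d/dx (v1 v2) is i xi / (2 pi)^2 times the convolution of g1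
    and g2 ([represents_product_transform]).  A transform is known here only
    through its pairing with Schwartz functions.  Pairing with a Gaussian times
    a character, whose transform is explicit ([fourier_gabor]), shows that
    convolving g with a narrow Gaussian amounts to multiplying v by a wide one
    ([gabor_pairing]).  Doing this to both factors and applying Fubini gives a
    Parseval identity in which each side is cut off and mollified
    ([Phi_parseval]); the regularization disappears in the limit because
    translations are continuous in L^2 ([translation_L2], [mollify_cvg]),
    whence [parseval].  Differentiating the transform of a test function under
    the integral ([cpartial_fourier]) and one more use of Fubini give the
    formula.

    Estimate.  By Cauchy-Schwarz and Tonelli ([weighted_convolution]) the
    weighted L^2 norm of xi (g1 * g2) is controlled by the weighted norms of g1
    and g2 as soon as

      xi^2 <tau - a0 xi^3>^(-1/2) int int <tau1 - a1 xi1^3>^(-3/2)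
        <(tau - tau1) - a2 (xi - xi1)^3>^(-3/2) dxi1 dtau1

    is bounded in (xi, tau); the factors <xi>^s cancel because
    <xi> <= <xi1> <xi - xi1> and s >= 0 ([Xweight_kernel]).  The integral in
    tau1 leaves the same kernel ([integral_ker_conv]) evaluated at
    tau - xi^3 p(xi1 / xi), where p(x) = a1 x^3 + a2 (1 - x)^3.  Away from the
    critical points of p the phase separates points linearly, and the integral
    in xi1 gains 1 / xi^2.  Near a critical point it separates them only
    quadratically and gains just |xi|^(-1/2) ([quadratic_piece_bound]).  But
    there p stays at a positive distance from a0, so that |xi|^3 is at most a
    constant times <tau - a0 xi^3> <tau - xi^3 p(xi1 / xi)>; the output weight
    <tau - a0 xi^3>^(-1/2) then pays for the missing |xi|^(3/2).  The condition
    0 < alpha < 1 enters through this absence of resonance, which is checked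
    for (a1, a2, a0) = (alpha, alpha, 1) in [resonant_vv] and for
    (1, alpha, alpha) in [resonant_uv]. *)

Set Implicit Arguments.
Unset Strict Implicit.
Unset Printing Implicit Defensive.

Import Order.TTheory GRing.Theory Num.Theory.
Import numFieldNormedType.Exports.

Local Open Scope classical_set_scope.
Local Open Scope ring_scope.

(** * Lebesgue measure on the plane under affine maps *)

Section LebesgueAffine.
Context {R : realType}.
Local Open Scope ereal_scope.
Local Notation leb := (@lebesgue_measure R).
Implicit Types (a b : R).

Definition affine1 a b : measurableTypeR R -> measurableTypeR R := fun x => (a * x + b)%R.

Lemma measurable_affine1 a b : measurable_fun [set: measurableTypeR R] (affine1 a b).
Proof. by apply: measurable_funD => //; apply: measurable_funM. Qed.

(** Half-open intervals suffice to identify the scaled measure; a negative slope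
    turns them into intervals closed on the other side. *)
Lemma affine1_preimage a b (u v : R) : a != 0%R ->
  leb (affine1 a b @^-1` `]u, v]%classic) = (`|a|^-1%:E * leb `]u, v]%classic).
Proof.
move=> a0.
rewrite lebesgue_measure_itv/= lte_fin.
have [a_lt0|a_gt0|/eqP] := ltgtP a 0%R; last by rewrite (negbTE a0).
- have -> : affine1 a b @^-1` `]u, v]%classic = `[((v - b) / a)%R, ((u - b) / a)%R[%classic.
    apply/seteqP; split => x /=; rewrite !in_itv/= /affine1 ler_ndivrMr// ltr_ndivlMr// => /andP[h1 h2];
      apply/andP; split; lra.
  rewrite lebesgue_measure_itv/= lte_fin ltr_nM2r ?invr_lt0// ltrD2r.
  case: ifP => _; rewrite ?mule0// -EFinB -EFinM ltr0_norm//; congr _%:E.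
  by field.
- have -> : affine1 a b @^-1` `]u, v]%classic = `]((u - b) / a)%R, ((v - b) / a)%R]%classic.
    apply/seteqP; split => x /=; rewrite !in_itv/= /affine1 ltr_pdivrMr// ler_pdivlMr// => /andP[h1 h2];
      apply/andP; split; lra.
  rewrite lebesgue_measure_itv/= lte_fin ltr_pM2r ?invr_gt0// ltrD2r.
  case: ifP => _; rewrite ?mule0// -EFinB -EFinM gtr0_norm//; congr _%:E.
  by field.
Qed.

Lemma lebesgue_affine1 a b (A : set (measurableTypeR R)) : a != 0%R -> measurable A ->
  leb (affine1 a b @^-1` A) = (`|a|^-1%:E * leb A).
Proof.
move=> a0 mA.
have ha : (0 <= `|a|)%R by [].
pose p : {measure set (measurableTypeR R) -> \bar R} :=
  measure_function_pushforward__canonical__measure_function_Measure leb (measurable_affine1 a b).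
rewrite (@lebesgue_measure_unique R (mscale (NngNum ha) p) _ A mA).
  by rewrite /mscale/= muleA -EFinM mulVf ?normr_eq0// mul1e.
move=> X [[u v] _ <-].
rewrite /= /mscale /p /= /pushforward affine1_preimage// muleA -EFinM.
by rewrite divff ?normr_eq0// mul1e.
Qed.

End LebesgueAffine.

Section PlaneAffine.
Context {R : realType}.
Local Open Scope ereal_scope.
Local Notation leb := (@lebesgue_measure R).
Local Notation leb2 := (leb \x leb).
Local Notation plane := (measurableTypeR R * measurableTypeR R)%type.
Implicit Types (a : R) (c : R * R).

Definition affine2 a c : plane -> plane := fun z => ((a * z.1 + c.1)%R, (a * z.2 + c.2)%R).

Lemma measurable_affine2 a c : measurable_fun [set: plane] (affine2 a c).
Proof.
apply/measurable_fun_pair.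
  exact: (measurableT_comp (measurable_affine1 a c.1) measurable_fst).
exact: (measurableT_comp (measurable_affine1 a c.2) measurable_snd).
Qed.

Lemma lebesgue_affine2 a c (A : set plane) : a != 0%R -> measurable A ->
  leb2 (affine2 a c @^-1` A) = ((`|a| ^- 2)%:E * leb2 A).
Proof.
move=> a0 mA.
have ha : (0 <= `|a| ^+ 2)%R by [].
pose p : {measure set plane -> \bar R} :=
  measure_function_pushforward__canonical__measure_function_Measure leb2 (measurable_affine2 a c).
rewrite (@product_measure_unique _ _ _ _ R leb leb (mscale (NngNum ha) p) _ A mA).
  by rewrite /mscale/= muleA -EFinM mulVf ?expf_neq0 ?normr_eq0// mul1e.
move=> X Y mX mY; rewrite /= /mscale /p /= /pushforward.
have -> : affine2 a c @^-1` (X `*` Y) =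
  (affine1 a c.1 @^-1` X) `*` (affine1 a c.2 @^-1` Y) by [].
rewrite product_measure1E//; last 2 first.
- by rewrite -[X in measurable X]setTI; apply: measurable_affine1.
- by rewrite -[X in measurable X]setTI; apply: measurable_affine1.
have hX := lebesgue_affine1 c.1 a0 mX; have hY := lebesgue_affine1 c.2 a0 mY.
rewrite -[leb X * leb Y]mul1e.
have -> : 1 = ((`|a| ^+ 2)%:E * ((`|a|^-1)%:E * (`|a|^-1)%:E)) :> \bar R.
  by rewrite -!EFinM -invfM -expr2 divff// expf_neq0 ?normr_eq0.
rewrite -!muleA; congr (_ * _).
etransitivity; first exact: (congr2 mule hX hY).
by rewrite muleACA !muleA.
Qed.

Lemma ge0_integral_affine2 a c (f : plane -> \bar R) : a != 0%R ->
  measurable_fun setT f -> (forall z, 0 <= f z) ->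
  \int[leb2]_z f (affine2 a c z) = ((`|a| ^- 2)%:E * \int[leb2]_z f z).
Proof.
move=> a0 mf f0.
pose p : {measure set plane -> \bar R} :=
  measure_function_pushforward__canonical__measure_function_Measure leb2 (measurable_affine2 a c).
transitivity (\int[p]_z f z).
  by rewrite (ge0_integral_pushforward (measurable_affine2 a c) leb2)//= preimage_setT.
have ha : (0 <= `|a| ^- 2)%R by rewrite invr_ge0.
rewrite (eq_measure_integral (mscale (NngNum ha) leb2)).
  by rewrite ge0_integral_mscale.
by move=> A mA _; rewrite /= /mscale /p /= /pushforward; exact: lebesgue_affine2.
Qed.

Lemma ge0_integral_affine1 a b (f : measurableTypeR R -> \bar R) : a != 0%R ->
  measurable_fun setT f -> (forall z, 0 <= f z) ->
  \int[leb]_z f (affine1 a b z) = ((`|a|^-1)%:E * \int[leb]_z f z).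
Proof.
move=> a0 mf f0.
pose p : {measure set (measurableTypeR R) -> \bar R} :=
  measure_function_pushforward__canonical__measure_function_Measure leb (measurable_affine1 a b).
transitivity (\int[p]_z f z).
  by rewrite (ge0_integral_pushforward (measurable_affine1 a b) leb)//= preimage_setT.
have ha : (0 <= `|a|^-1)%R by rewrite invr_ge0.
rewrite (eq_measure_integral (mscale (NngNum ha) leb)).
  by rewrite ge0_integral_mscale.
by move=> A mA _; rewrite /= /mscale /p /= /pushforward; exact: lebesgue_affine1.
Qed.

Lemma integrable_affine2 a c (f : plane -> \bar R) : a != 0%R ->
  leb2.-integrable setT f -> leb2.-integrable setT (f \o affine2 a c).
Proof.
move=> a0 /integrableP[mf intf]; apply/integrableP; split.
  exact: measurableT_comp mf (measurable_affine2 a c).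
have mabs : measurable_fun setT (abse \o f) by apply: measurableT_comp.
rewrite (ge0_integral_affine2 c a0 mabs (fun z => abse_ge0 (f z))).
by rewrite lte_mul_pinfty// lee_fin invr_ge0.
Qed.

Lemma integral_affine2 a c (f : plane -> \bar R) : a != 0%R ->
  leb2.-integrable setT f ->
  \int[leb2]_z f (affine2 a c z) = ((`|a| ^- 2)%:E * \int[leb2]_z f z).
Proof.
move=> a0 intf; have /integrableP[mf _] := intf.
rewrite [in LHS]integralE [in RHS]integralE.
rewrite muleBr//; last first.
  rewrite fin_num_adde_defl// fin_numN.
  exact/integrable_fin_num/integrable_funeneg.
rewrite -(ge0_integral_affine2 c a0 (measurable_funepos mf) (funepos_ge0 f)).
rewrite -(ge0_integral_affine2 c a0 (measurable_funeneg mf) (funeneg_ge0 f)).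
by congr (_ - _); apply: eq_integral => z _; rewrite ?funeposE ?funenegE.
Qed.

End PlaneAffine.

Section PlaneSigmaFinite.
Context {R : realType}.
Local Open Scope ereal_scope.
Local Notation leb := (@lebesgue_measure R).
Local Notation plane := (measurableTypeR R * measurableTypeR R)%type.

Lemma plane_sigma_finite : sigma_finite [set: plane] (leb \x leb).
Proof.
have /sigma_finiteP[F [TF ndF Foo]] := sigma_finiteT leb.
exists (fun n => F n `*` F n).
 rewrite -setXTT TF predeqE => -[x y]; split.
    move=> [/= [n _ Fnx] [k _ Gky]]; exists (maxn n k) => //; split.
    - by move: x Fnx; exact/subsetPset/ndF/leq_maxl.
    - by move: y Gky; exact/subsetPset/ndF/leq_maxr.
  by move=> [n _ []/= ? ?]; split; exists n.
move=> k; have [? ?] := Foo k.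
split; first exact: measurableX.
by rewrite product_measure1E// lte_mul_pinfty// ge0_fin_numE.
Qed.

(** The product measure packed with its sigma-finiteness, which Tonelli and
    Fubini on pairs of points of the plane ask for. *)
Definition plane_measure : {sigma_finite_measure set plane -> \bar R}%R :=
  HB.pack (leb \x leb) (Measure_isSigmaFinite.Build _ plane R (leb \x leb) plane_sigma_finite).

Lemma plane_tonelli (f : plane -> plane -> \bar R) :
  measurable_fun setT (fun p => f p.1 p.2) -> (forall x y, 0 <= f x y) ->
  \int[leb \x leb]_x \int[leb \x leb]_y f x y =
  \int[leb \x leb]_y \int[leb \x leb]_x f x y.
Proof.
move=> mf f0.
exact: (@fubini_tonelli _ _ _ _ R plane_measure plane_measure (fun p => f p.1 p.2)).
Qed.

Lemma plane_measurable_integral (f : plane -> plane -> \bar R) :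
  measurable_fun setT (fun p => f p.1 p.2) -> (forall x y, 0 <= f x y) ->
  measurable_fun setT (fun x => \int[leb \x leb]_y f x y).
Proof.
move=> mf f0.
exact: (@measurable_fun_fubini_tonelli_F _ _ _ _ R plane_measure (fun p => f p.1 p.2)).
Qed.

Lemma plane_integral12 (f : R -> R -> \bar R) :
  measurable_fun [set: plane] (fun p => f p.1 p.2) -> (forall x y, 0 <= f x y) ->
  \int[leb \x leb]_z f z.1 z.2 = \int[leb]_x \int[leb]_y f x y.
Proof. by move=> mf f0; exact: (fubini_tonelli1 (m1 := leb) (m2 := leb) (fun p => f p.1 p.2)). Qed.

End PlaneSigmaFinite.

(** * Complex-valued integrals on the plane *)

Section FineIntegral.
Context d (T : measurableType d) (R : realType) (m : {measure set T -> \bar R}).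
Local Open Scope ereal_scope.

Lemma measurable_fine_comp (g : T -> \bar R) : measurable_fun setT g ->
  measurable_fun setT (fun x => (fine (g x))%:E).
Proof.
move=> mg; apply/measurable_EFinP.
by apply: (@measurableT_comp _ _ _ _ _ _ fine _ g) => //; exact: fine_measurable.
Qed.

Lemma integrable_fine_comp (g : T -> \bar R) : m.-integrable setT g ->
  m.-integrable setT (fun x => (fine (g x))%:E).
Proof.
move=> /integrableP[mg ig]; apply/integrableP; split.
  exact: measurable_fine_comp.
apply: le_lt_trans ig; apply: ge0_le_integral => //=.
- apply: (@measurableT_comp _ _ _ _ _ _ abse _ (fun x => (fine (g x))%:E)) => //.
  exact: measurable_fine_comp.
- exact: measurableT_comp.
- by move=> x _; case: (g x) => [r||]//=; rewrite normr0 ?leey.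
Qed.

(** An integrable function is finite almost everywhere, so replacing its infinite
    values by 0 does not change the integral.  This turns the extended-real
    Fubini theorem into one for real integrals. *)
Lemma integral_fine_comp (g : T -> \bar R) : m.-integrable setT g ->
  \int[m]_x (fine (g x))%:E = \int[m]_x g x.
Proof.
move=> ig; have /integrableP[mg _] := ig.
have /integrableP[mg' _] := integrable_fine_comp ig.
apply: ae_eq_integral => //.
have := integrable_ae measurableT ig; apply: filterS => x /= h _.
by rewrite fineK// h.
Qed.
End FineIntegral.

Section RFubini.
Context d1 d2 (T1 : measurableType d1) (T2 : measurableType d2) (R : realType).
Variable m1 : {sigma_finite_measure set T1 -> \bar R}.
Variable m2 : {sigma_finite_measure set T2 -> \bar R}.
Variable f : T1 -> T2 -> R.
Hypothesis intf : (m1 \x m2)%E.-integrable setT (fun p => (f p.1 p.2)%:E).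

Lemma integrable_prod_swap :
  (m2 \x m1)%E.-integrable setT (fun p => (f p.2 p.1)%:E).
Proof.
have /integrableP[mf _] := intf.
have msw : measurable_fun setT (fun p : T2 * T1 => (f p.2 p.1)%:E).
  have := measurableT_comp mf (@measurable_swap _ _ T2 T1); exact.
apply/(integrable21ltyP _ _ msw).
by have /(integrable12ltyP _ _ mf) := intf.
Qed.

Lemma Rintegral_fubini :
  Rintegral m1 setT (fun x => Rintegral m2 setT (f x)) =
  Rintegral m2 setT (fun y => Rintegral m1 setT (f ^~ y)).
Proof.
rewrite /Rintegral (integral_fine_comp (integrable_fubini_F intf)).
rewrite (integral_fine_comp (integrable_fubini_F integrable_prod_swap)).
by rewrite (Fubini intf).
Qed.
End RFubini.

Section ComplexFunctions.
Context {R : realType}.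
Local Open Scope complex_scope.
Local Notation normc := (@ComplexField.Normc.normc R).

Lemma Re_mul (x y : R[i]) :
  complex.Re (x * y) = complex.Re x * complex.Re y - complex.Im x * complex.Im y.
Proof. by case: x => ? ?; case: y. Qed.
Lemma Im_mul (x y : R[i]) :
  complex.Im (x * y) = complex.Re x * complex.Im y + complex.Im x * complex.Re y.
Proof. by case: x => ? ?; case: y. Qed.
Lemma Re_add (x y : R[i]) : complex.Re (x + y) = complex.Re x + complex.Re y.
Proof. by case: x => ? ?; case: y. Qed.
Lemma Im_add (x y : R[i]) : complex.Im (x + y) = complex.Im x + complex.Im y.
Proof. by case: x => ? ?; case: y. Qed.
Lemma Re_opp (x : R[i]) : complex.Re (- x) = - complex.Re x.
Proof. by case: x. Qed.
Lemma Im_opp (x : R[i]) : complex.Im (- x) = - complex.Im x.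
Proof. by case: x. Qed.
Lemma complex_eq (x y : R[i]) : complex.Re x = complex.Re y -> complex.Im x = complex.Im y -> x = y.
Proof. by case: x => a b; case: y => c e /= -> ->. Qed.

Lemma normcE (x : R[i]) : normc x = Num.sqrt (complex.Re x ^+ 2 + complex.Im x ^+ 2).
Proof. by case: x. Qed.
Lemma normc_ge0 (x : R[i]) : 0 <= normc x.
Proof. by rewrite normcE sqrtr_ge0. Qed.
Lemma sqr_normcE (x : R[i]) : normc x ^+ 2 = complex.Re x ^+ 2 + complex.Im x ^+ 2.
Proof. by rewrite normcE sqr_sqrtr// addr_ge0// sqr_ge0. Qed.
Lemma ler_Re_normc (x : R[i]) : `|complex.Re x| <= normc x.
Proof.
by rewrite normcE -sqrtr_sqr; apply: ler_wsqrtr; rewrite lerDl sqr_ge0.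
Qed.
Lemma ler_Im_normc (x : R[i]) : `|complex.Im x| <= normc x.
Proof.
by rewrite normcE -sqrtr_sqr; apply: ler_wsqrtr; rewrite lerDr sqr_ge0.
Qed.
Lemma normc_le_add (x : R[i]) : normc x <= `|complex.Re x| + `|complex.Im x|.
Proof.
rewrite -(ler_pXn2r (ltn0Sn 1)) ?nnegrE ?normc_ge0 ?addr_ge0//.
rewrite sqr_normcE sqrrD !real_normK ?num_real// -addrA lerD2l lerDr.
by rewrite mulrn_wge0// mulr_ge0.
Qed.
Lemma normcD_le (x y : R[i]) : normc (x + y) <= normc x + normc y.
Proof. exact: (@le_normcD R x y). Qed.
Lemma normc_mul (x y : R[i]) : normc (x * y) = normc x * normc y.
Proof. exact: ComplexField.Normc.normcM. Qed.
Lemma normc_opp (x : R[i]) : normc (- x) = normc x.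
Proof. by rewrite !normcE Re_opp Im_opp !sqrrN. Qed.
Lemma normc_real (x : R) : normc x%:C = `|x|.
Proof. by rewrite normcE /= expr0n addr0 sqrtr_sqr. Qed.

Definition cis (t : R) : R[i] := cos t +i* sin t.
Lemma normc_cis t : normc (cis t) = 1.
Proof. by rewrite normcE /= cos2Dsin2 sqrtr1. Qed.
Lemma cisD s t : cis (s + t) = cis s * cis t.
Proof.
by apply: complex_eq; rewrite ?Re_mul ?Im_mul /= ?cosD ?sinD//; rewrite addrC mulrC [in X in _ + X]mulrC.
Qed.
Lemma cis0 : cis 0 = 1.
Proof. by apply: complex_eq; rewrite /= ?cos0 ?sin0. Qed.
Lemma cisN t : cis (- t) = cos t -i* sin t.
Proof. by rewrite /cis cosN sinN. Qed.

Context d (T : measurableType d).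
Implicit Types u v : T -> R[i].

Definition cmeas u := measurable_fun setT (fun x => complex.Re (u x)) /\
  measurable_fun setT (fun x => complex.Im (u x)).

Lemma cmeasM u v : cmeas u -> cmeas v -> cmeas (fun x => u x * v x).
Proof.
move=> [ru iu] [rv iv]; split.
  under eq_fun do rewrite Re_mul.
  by apply: measurable_funB; apply: measurable_funM.
under eq_fun do rewrite Im_mul.
by apply: measurable_funD; apply: measurable_funM.
Qed.

Lemma cmeasD u v : cmeas u -> cmeas v -> cmeas (fun x => u x + v x).
Proof.
move=> [ru iu] [rv iv]; split.
  by under eq_fun do rewrite Re_add; apply: measurable_funD.
by under eq_fun do rewrite Im_add; apply: measurable_funD.
Qed.

Lemma cmeasN u : cmeas u -> cmeas (fun x => - u x).
Proof.
move=> [ru iu]; split.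
  by under eq_fun do rewrite Re_opp; apply: measurableT_comp.
by under eq_fun do rewrite Im_opp; apply: measurableT_comp.
Qed.

Lemma cmeas_cst (c : R[i]) : cmeas (fun=> c).
Proof. by split; apply: measurable_cst. Qed.

Lemma cmeas_real (f : T -> R) : measurable_fun setT f -> cmeas (fun x => (f x)%:C).
Proof. by move=> mf; split => //; apply: measurable_cst. Qed.

Lemma cmeas_cis (f : T -> R) : measurable_fun setT f -> cmeas (fun x => cis (f x)).
Proof.
move=> mf; split => /=.
  apply: (measurableT_comp _ mf); apply: continuous_measurable_fun; exact: continuous_cos.
apply: (measurableT_comp _ mf); apply: continuous_measurable_fun; exact: continuous_sin.
Qed.

Lemma measurable_normc u : cmeas u -> measurable_fun setT (fun x => normc (u x)).
Proof.
move=> [ru iu]; under eq_fun do rewrite normcE.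
apply: (@measurableT_comp _ _ _ _ _ _ (@Num.sqrt R)).
  by apply: continuous_measurable_fun; exact: sqrt_continuous.
by apply: measurable_funD; apply: measurable_funX.
Qed.

End ComplexFunctions.

Lemma cmeas_comp {R : realType} d (T : measurableType d) d' (T' : measurableType d')
  (u : T -> R[i]) (phi : T' -> T) :
  cmeas u -> measurable_fun setT phi -> cmeas (fun x => u (phi x)).
Proof. by move=> [ru iu] mphi; split;
  [exact: (measurableT_comp ru mphi) | exact: (measurableT_comp iu mphi)]. Qed.

Section ComplexIntegral.
Context {R : realType}.
Local Open Scope complex_scope.
Local Notation normc := (@ComplexField.Normc.normc R).
Local Notation leb := (@lebesgue_measure R).
Local Notation leb2 := (leb \x leb)%E.
Local Notation plane := (measurableTypeR R * measurableTypeR R)%type.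
Implicit Types u v : plane -> R[i].

(** The modulus and the sum of the absolute values of the two parts dominate
    each other. *)
Lemma cintegrableP u : cintegrable u <->
  cmeas u /\ (\int[leb2]_z (normc (u z))%:E < +oo)%E.
Proof.
split=> [[/integrableP[mr ir] /integrableP[mi ii]]|[[mr mi] iu]].
  move/measurable_EFinP : mr => mr; move/measurable_EFinP : mi => mi.
  split; first by split.
  apply: (@le_lt_trans _ _ (\int[leb2]_z (`|(EFin \o repart u) z| + `|(EFin \o impart u) z|)))%E.
    apply: ge0_le_integral => //=.
    - by move=> z _; rewrite lee_fin normc_ge0.
    - by apply/measurable_EFinP; apply: measurable_normc; split.
    - by apply/measurable_EFinP; apply: measurable_funD; apply: measurableT_comp.
    - by move=> z _; rewrite lee_fin normc_le_add.
  rewrite ge0_integralD//.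
  - by rewrite lte_add_pinfty.
  - by apply/measurable_EFinP; apply: measurableT_comp.
  - by apply/measurable_EFinP; apply: measurableT_comp.
split; apply/integrableP; split; try exact/measurable_EFinP.
  apply: le_lt_trans iu; apply: ge0_le_integral => //=.
  - by apply/measurable_EFinP; apply: measurableT_comp.
  - by apply/measurable_EFinP; apply: measurable_normc; split.
  - by move=> z _; rewrite lee_fin; exact: ler_Re_normc.
apply: le_lt_trans iu; apply: ge0_le_integral => //=.
- by apply/measurable_EFinP; apply: measurableT_comp.
- by apply/measurable_EFinP; apply: measurable_normc; split.
- by move=> z _; rewrite lee_fin; exact: ler_Im_normc.
Qed.

Lemma cintegrable_le u v : cmeas u -> cintegrable v ->
  (forall z, normc (u z) <= normc (v z)) -> cintegrable u.
Proof.
move=> mu /cintegrableP[mv iv] uv; apply/cintegrableP; split=> //.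
apply: le_lt_trans iv; apply: ge0_le_integral => //=.
- by move=> z _; rewrite lee_fin normc_ge0.
- by apply/measurable_EFinP; apply: measurable_normc.
- by apply/measurable_EFinP; apply: measurable_normc.
- by move=> z _; rewrite lee_fin.
Qed.

Lemma cintegralD u v : cintegrable u -> cintegrable v ->
  cintegral (fun z => u z + v z) = cintegral u + cintegral v.
Proof.
move=> [ru iu] [rv iv]; rewrite /cintegral.
have -> : repart (fun z => u z + v z) = repart u \+ repart v.
  by apply/funext => z; rewrite /repart Re_add.
have -> : impart (fun z => u z + v z) = impart u \+ impart v.
  by apply/funext => z; rewrite /impart Im_add.
by rewrite !RintegralD.
Qed.

Lemma cintegrableD u v : cintegrable u -> cintegrable v ->
  cintegrable (fun z => u z + v z).
Proof.
move=> [ru iu] [rv iv]; split.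
  rewrite (_ : _ \o _ = (EFin \o repart u) \+ (EFin \o repart v))%E; first exact: integrableD.
  by apply/funext => z; rewrite /= /repart Re_add EFinD.
rewrite (_ : _ \o _ = (EFin \o impart u) \+ (EFin \o impart v))%E; first exact: integrableD.
by apply/funext => z; rewrite /= /impart Im_add EFinD.
Qed.

Lemma cintegrableZ (c : R[i]) u : cintegrable u -> cintegrable (fun z => c * u z).
Proof.
move=> /cintegrableP[mu iu]; apply/cintegrableP; split.
  exact: cmeasM (cmeas_cst _ _) mu.
under eq_integral do rewrite normc_mul EFinM.
rewrite ge0_integralZl_EFin//.
- by rewrite lte_mul_pinfty// lee_fin normc_ge0.
- by move=> z _; rewrite lee_fin normc_ge0.
- by apply/measurable_EFinP; apply: measurable_normc.
- exact: normc_ge0.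
Qed.

Lemma cintegralZ (c : R[i]) u : cintegrable u ->
  cintegral (fun z => c * u z) = c * cintegral u.
Proof.
move=> [ru iu]; apply: complex_eq; rewrite ?Re_mul ?Im_mul /=.
  rewrite -!RintegralZl// -RintegralB//.
  - by apply: eq_Rintegral => z _; rewrite /repart Re_mul.
  - have -> : EFin \o (fun z => complex.Re c * repart u z) =
      (fun z => (complex.Re c)%:E * (EFin \o repart u) z)%E by apply/funext.
    exact: integrableZl.
  - have -> : EFin \o (fun z => complex.Im c * impart u z) =
      (fun z => (complex.Im c)%:E * (EFin \o impart u) z)%E by apply/funext.
    exact: integrableZl.
rewrite -!RintegralZl// -RintegralD//.
- by apply: eq_Rintegral => z _; rewrite /impart Im_mul.
- have -> : EFin \o (fun z => complex.Re c * impart u z) =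
    (fun z => (complex.Re c)%:E * (EFin \o impart u) z)%E by apply/funext.
  exact: integrableZl.
- have -> : EFin \o (fun z => complex.Im c * repart u z) =
    (fun z => (complex.Im c)%:E * (EFin \o repart u) z)%E by apply/funext.
  exact: integrableZl.
Qed.

Lemma cintegralB u v : cintegrable u -> cintegrable v ->
  cintegral (fun z => u z - v z) = cintegral u - cintegral v.
Proof.
move=> iu iv; rewrite -[- cintegral v]mulN1r -cintegralZ// -cintegralD//.
  by congr cintegral; apply/funext => z; rewrite mulN1r.
exact: cintegrableZ.
Qed.

(** The factor 2 comes from estimating the real and imaginary parts separately;
    the sharp constant 1 would take a rotation of the integral, and constants are
    of no concern here. *)
Lemma normc_cintegral_le u : cintegrable u ->
  ((normc (cintegral u))%:E <= 2%:E * \int[leb2]_z (normc (u z))%:E)%E.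
Proof.
move=> iu; have /cintegrableP[mu fu] := iu; have [ru ii] := iu.
have fin : (\int[leb2]_z (normc (u z))%:E)%E \is a fin_num.
  by rewrite ge0_fin_numE// integral_ge0// => z _; rewrite lee_fin normc_ge0.
apply: (@le_trans _ _ (`|complex.Re (cintegral u)| + `|complex.Im (cintegral u)|)%:E).
  by rewrite lee_fin normc_le_add.
rewrite EFinD (_ : 2%:E = 1 + 1)%E// ge0_muleDl// !mul1e.
have aux (f : plane -> R) : leb2.-integrable setT (EFin \o f) ->
    (forall z, `|f z| <= normc (u z)) ->
    (`|Rintegral leb2 setT f|%:E <= \int[leb2]_z (normc (u z))%:E)%E.
  move=> intf fle; have /integrableP[mf _] := intf.
  rewrite EFin_normr_Rintegral//.
  apply: (le_trans (le_abse_integral _ _ mf)) => //.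
  apply: ge0_le_integral => //=.
  - have mf' : measurable_fun setT f by apply/measurable_EFinP.
    by apply/measurable_EFinP; apply: measurableT_comp.
  - by apply/measurable_EFinP; apply: measurable_normc.
  - by move=> z _; rewrite lee_fin.
apply: leeD => /=; apply: aux => // z; [exact: ler_Re_normc|exact: ler_Im_normc].
Qed.

Lemma cintegral_affine2 (a : R) (c : R * R) u : a != 0 -> cintegrable u ->
  cintegral (fun z => u (affine2 a c z)) = (`|a| ^- 2)%:C * cintegral u.
Proof.
move=> a0 [ru iu]; apply: complex_eq; rewrite ?Re_mul ?Im_mul /= ?mul0r ?subr0 ?addr0.
  rewrite /Rintegral (_ : (\int[leb2]_x _)%E = \int[leb2]_x ((EFin \o repart u) (affine2 a c x)))%E//.
  by rewrite integral_affine2// fineM// ?integrable_fin_num.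
rewrite /Rintegral (_ : (\int[leb2]_x _)%E = \int[leb2]_x ((EFin \o impart u) (affine2 a c x)))%E//.
by rewrite integral_affine2// fineM// ?integrable_fin_num.
Qed.

Lemma cintegrable_affine2 (a : R) (c : R * R) u : a != 0 -> cintegrable u ->
  cintegrable (fun z => u (affine2 a c z)).
Proof.
move=> a0 [ru iu]; split.
  exact: (integrable_affine2 c a0 ru).
exact: (integrable_affine2 c a0 iu).
Qed.

Definition ccvg (u_ : nat -> R[i]) (l : R[i]) :=
  (complex.Re (u_ n) @[n --> \oo] --> complex.Re l)%classic /\
  (complex.Im (u_ n) @[n --> \oo] --> complex.Im l)%classic.

Lemma ccvg_unique (u_ : nat -> R[i]) l l' : ccvg u_ l -> ccvg u_ l' -> l = l'.
Proof.
move=> [a b] [a' b']; apply: complex_eq.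
  exact: (cvg_unique _ a a').
exact: (cvg_unique _ b b').
Qed.

Lemma ccvgM (u_ v_ : nat -> R[i]) l l' : ccvg u_ l -> ccvg v_ l' -> ccvg (fun n => u_ n * v_ n) (l * l').
Proof.
move=> [a b] [a' b']; split; rewrite ?Re_mul ?Im_mul.
  under eq_fun do rewrite Re_mul.
  by apply: cvgB; apply: cvgM.
under eq_fun do rewrite Im_mul.
by apply: cvgD; apply: cvgM.
Qed.

Lemma ccvg_cst l : ccvg (fun=> l) l.
Proof. by split; apply: cvg_cst. Qed.

Lemma cintegral_dominated (u_ : nat -> plane -> R[i]) u (G : plane -> R) :
  (forall n, cmeas (u_ n)) -> cmeas u ->
  (forall z, ccvg (u_ ^~ z) (u z)) ->
  leb2.-integrable setT (EFin \o G) ->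
  (forall n z, normc (u_ n z) <= G z) ->
  ccvg (fun n => cintegral (u_ n)) (cintegral u).
Proof.
move=> mu_ [mr mi] cvu iG uG.
have aux (f_ : nat -> plane -> R) (f : plane -> R) :
    (forall n, measurable_fun setT (f_ n)) -> measurable_fun setT f ->
    (forall z, (f_ n z @[n --> \oo] --> f z)%classic) ->
    (forall n z, `|f_ n z| <= G z) ->
    (Rintegral leb2 setT (f_ n) @[n --> \oo] --> Rintegral leb2 setT f)%classic.
  move=> mf_ mf cvf fG.
  have [|||||iff _ lim] := @dominated_convergence _ _ _ leb2 setT measurableT
     (fun n z => (f_ n z)%:E) (EFin \o f) (EFin \o G).
  - by move=> n; apply/measurable_EFinP.
  - exact/measurable_EFinP.
  - by apply: aeW => z _; apply: cvg_EFin; [exact: nearW|exact: cvf].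
  - exact: iG.
  - by apply: aeW => z n _; rewrite /= lee_fin.
  apply: fine_cvg; rewrite /Rintegral fineK//.
  exact: integrable_fin_num.
split.
  apply: aux => //.
  - by move=> n; have [] := mu_ n.
  - by move=> z; have [] := cvu z.
  - by move=> n z; apply: le_trans (uG n z); exact: ler_Re_normc.
apply: aux => //.
- by move=> n; have [] := mu_ n.
- by move=> z; have [] := cvu z.
- by move=> n z; apply: le_trans (uG n z); exact: ler_Im_normc.
Qed.

Section CFubini.
Variable F : plane -> plane -> R[i].
Hypothesis mF : cmeas (fun p : plane * plane => F p.1 p.2).
Hypothesis iF : (\int[leb2]_x \int[leb2]_y (normc (F x y))%:E < +oo)%E.

Let iN : (plane_measure \x plane_measure)%E.-integrable setT (fun p => (normc (F p.1 p.2))%:E).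
Proof.
have mN : measurable_fun setT (fun p : plane * plane => (normc (F p.1 p.2))%:E).
  by apply/measurable_EFinP; exact: measurable_normc.
apply: (proj2 (integrable12ltyP plane_measure plane_measure mN)).
refine (eq_ind _ (fun t => (t < +oo)%E) iF _ _).
apply: eq_integral => x _; apply: eq_integral => y _ /=.
by rewrite ger0_norm// normc_ge0.
Qed.

Let iRe : (plane_measure \x plane_measure)%E.-integrable setT (fun p => (complex.Re (F p.1 p.2))%:E).
Proof.
apply: le_integrable iN => //; first by apply/measurable_EFinP; case: mF.
by move=> p _; rewrite /= lee_fin (ger0_norm (normc_ge0 _)) ler_Re_normc.
Qed.

Let iIm : (plane_measure \x plane_measure)%E.-integrable setT (fun p => (complex.Im (F p.1 p.2))%:E).
Proof.
apply: le_integrable iN => //; first by apply/measurable_EFinP; case: mF.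
by move=> p _; rewrite /= lee_fin (ger0_norm (normc_ge0 _)) ler_Im_normc.
Qed.

Lemma cFubini : cintegral (fun x => cintegral (F x)) = cintegral (fun y => cintegral (F ^~ y)).
Proof.
apply: complex_eq => /=.
  exact: (Rintegral_fubini (f := fun x y => complex.Re (F x y)) iRe).
exact: (Rintegral_fubini (f := fun x y => complex.Im (F x y)) iIm).
Qed.
End CFubini.

Lemma cmeas_cintegral (F : plane -> plane -> R[i]) :
  cmeas (fun p : plane * plane => F p.1 p.2) -> cmeas (fun x => cintegral (F x)).
Proof.
have aux (f : plane -> plane -> R) : measurable_fun setT (fun p : plane * plane => f p.1 p.2) ->
    measurable_fun setT (fun x => Rintegral leb2 setT (f x)).
  move=> mf; apply/measurable_EFinP; apply: measurable_fine_comp.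
  under eq_fun do rewrite integralE.
  have mf' : measurable_fun setT (fun p : plane * plane => (f p.1 p.2)%:E) by exact/measurable_EFinP.
  apply: emeasurable_funB.
    have := measurable_fun_fubini_tonelli_F (m2 := plane_measure) _ (measurable_funepos mf') (funepos_ge0 _).
    rewrite /fubini_F; congr (measurable_fun _ _); apply/funext => x.
    by apply: eq_integral => y _; rewrite !funeposE.
  have := measurable_fun_fubini_tonelli_F (m2 := plane_measure) _ (measurable_funeneg mf') (funeneg_ge0 _).
  rewrite /fubini_F; congr (measurable_fun _ _); apply/funext => x.
  by apply: eq_integral => y _; rewrite !funenegE.
move=> [mr mi]; split.
  exact: (aux (fun x y => complex.Re (F x y))).
exact: (aux (fun x y => complex.Im (F x y))).
Qed.

Lemma eq_cintegral u v : u =1 v -> cintegral u = cintegral v.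
Proof. by move=> /funext ->. Qed.

Lemma cintegral_real (f : plane -> R) :
  cintegral (fun z => (f z)%:C) = (Rintegral leb2 setT f)%:C.
Proof.
apply: complex_eq => //=; rewrite /impart /=.
by rewrite Rintegral_cst// mul0r.
Qed.
End ComplexIntegral.

(** * The Fourier transform of a Gaussian *)

Lemma is_derive_Rintegral {R : realType} d (Y : measurableType d)
    (mu : {measure set Y -> \bar R}) (f f' : R -> Y -> R) (G : Y -> R) (a : R) :
  (forall x, mu.-integrable setT (EFin \o f x)) ->
  (forall (x : R) y, is_derive x 1 (f ^~ y) (f' x y)) ->
  mu.-integrable setT (EFin \o G) ->
  (forall x y, `|f' x y| <= G y) ->
  is_derive a 1 (fun x => Rintegral mu setT (f x)) (Rintegral mu setT (f' a)).
Proof.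
move=> intf df intG fG.
have Ia : `](a - 1), (a + 1)[%classic a by rewrite /= in_itv /=; apply/andP; split; lra.
have pE x y : partial1of2 f x y = f' x y by rewrite partial1of2E; apply: derive_val.
have G0 y : 0 <= G y by apply: le_trans (fG a y).
have h1 x y : `](a - 1), (a + 1)[%classic x -> setT y -> derivable (f ^~ y) x 1 by [].
have h2 x y : `](a - 1), (a + 1)[%classic x -> setT y -> `|partial1of2 f x y| <= G y by rewrite pE.
have h0 x : `](a - 1), (a + 1)[%classic x -> mu.-integrable setT (EFin \o f x) by [].
have D := derivable_under_integral measurableT Ia h0 h1 G0 intG h2.
have E := differentiation_under_integral measurableT Ia h0 h1 G0 intG h2.
apply: DeriveDef => //.
rewrite -derive1E E; apply: eq_Rintegral => y _; exact: pE.
Qed.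

Lemma cvg0_le {R : realType} (u v : nat -> R) :
  (forall n, `|u n| <= v n) -> (v @ \oo --> 0)%classic -> (u @ \oo --> 0)%classic.
Proof.
move=> uv v0; apply/cvgrPdist_le => eps eps0.
move/cvgrPdist_le : v0 => /(_ _ eps0); apply: filterS => n /=.
rewrite !sub0r !normrN => en.
by rewrite (le_trans (uv n))// (le_trans (ler_norm _)).
Qed.

Lemma is_derive_continuous {R : realType} (f f' : R -> R) :
  (forall t : R, is_derive t 1 f (f' t)) -> continuous f.
Proof.
by move=> df t; apply/differentiable_continuous; apply/derivable1_diffP; case: (df t).
Qed.

Lemma integrable_scale {R : realType} d (Y : measurableType d)
    (mu : {measure set Y -> \bar R}) (c : R) (f : Y -> R) :
  mu.-integrable setT (EFin \o f) -> mu.-integrable setT (EFin \o (fun t => c * f t)).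
Proof.
move=> intf.
rewrite (_ : _ \o _ = fun t => (c%:E * (EFin \o f) t)%E); first exact: integrableZl.
by apply/funext.
Qed.

Section Line.
Context {R : realType}.
Local Notation leb := (@lebesgue_measure R).

(** The fundamental theorem of calculus on the intervals [-n, n], passed to the
    limit by dominated convergence. *)
Lemma integral_derive_line (f f' : R -> R) :
  (forall t : R, is_derive t 1 f (f' t)) -> continuous f' ->
  leb.-integrable setT (EFin \o f') ->
  (f n%:R @[n --> \oo] --> 0)%classic -> (f (- n%:R) @[n --> \oo] --> 0)%classic ->
  Rintegral leb setT f' = 0.
Proof.
move=> df cf intf fy fNy.
have mf : measurable_fun setT f' by exact: continuous_measurable_fun.
pose g n t : R := f' t * \1_(`[(- n%:R), n%:R]%classic : set R) t.
have mg n : measurable_fun setT (g n).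
  by apply: measurable_funM => //; exact: measurable_indic.
have cg t : ((g n t)%:E @[n --> \oo] --> (f' t)%:E)%classic.
  apply: cvg_near_cst.
  exists (Num.truncn `|t|).+1 => // n /= hn.
  rewrite /g indicE mem_set ?mulr1//= in_itv/= -ler_norml.
  apply/ltW; apply: (lt_le_trans (truncnS_gt _)); by rewrite ler_nat.
have [|||||iff _ lim] := @dominated_convergence _ _ _ leb setT measurableT
     (fun n z => (g n z)%:E) (EFin \o f') (fun z => `|(EFin \o f') z|%E).
- by move=> n; apply/measurable_EFinP; exact: mg.
- exact/measurable_EFinP.
- by apply: aeW => z _; exact: cg.
- exact: integrable_abse.
- apply: aeW => z n _ /=; rewrite lee_fin /g normrM ler_piMr//.
  by rewrite indicE; case: (_ \in _); rewrite ?normr1 ?normr0.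
have E : (fun n => \int[leb]_x (g n x)%:E)%E = (fun n => (f n%:R - f (- n%:R))%:E).
  apply/funext => n.
  have -> : (\int[leb]_x (g n x)%:E = \int[leb]_(x in `[(- n%:R)%R, n%:R%R]) (f' x)%:E)%E.
    rewrite [RHS]integral_mkcond; apply: eq_integral => x _.
    by rewrite /g patchE indicE; case: (_ \in _); rewrite ?mulr1 ?mulr0.
  case: n => [|n].
    by rewrite oppr0 subrr set_itv1 integral_set1.
  rewrite (continuous_FTC2 (F := f))//.
  - by rewrite (lt_trans (y := 0)) ?ltr0n ?oppr_lt0 ?ltr0n.
  - exact: continuous_subspaceT.
  - have cF : continuous f.
      by move=> x; apply/differentiable_continuous; apply/derivable1_diffP.
    split => //.
    + by apply: cvg_at_right_filter; exact: cF.
    + by apply: cvg_at_left_filter; exact: cF.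
  - by move=> x _; rewrite derive1E; exact: derive_val.
have : (fun n => (f n%:R - f (- n%:R))%:E) @ \oo --> (0%:E : \bar R).
  apply: cvg_EFin; first exact: nearW.
  by rewrite -[X in _ --> X](subr0 0); apply: cvgB.
rewrite -E => lim0.
have := cvg_unique (@ereal_hausdorff R) lim lim0.
by rewrite /Rintegral => ->.
Qed.

Lemma integral_gauss (c : R) : 0 < c ->
  (\int[leb]_t (expR (- (c * t ^+ 2)))%:E = (Num.sqrt (pi / c))%:E)%E.
Proof.
move=> c0.
have s0 : Num.sqrt c != 0 by rewrite sqrtr_eq0 -ltNge.
have := @ge0_integral_affine1 R (Num.sqrt c) 0 (fun t => (gauss_fun t)%:E) s0.
rewrite integralT_gauss => h.
transitivity ((`|Num.sqrt c|^-1)%:E * (Num.sqrt pi)%:E : \bar R)%E.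
  rewrite -h.
  - apply: eq_integral => t _; rewrite /affine1 /gauss_fun addr0 exprMn sqr_sqrtr//.
    exact: ltW.
  - by apply/measurable_EFinP; exact: measurable_gauss_fun.
  - by move=> z; rewrite lee_fin gauss_fun_ge0.
rewrite -EFinM; congr _%:E.
by rewrite ger0_norm ?sqrtr_ge0// sqrtrM ?pi_ge0// sqrtrV ?ltW// mulrC.
Qed.

Lemma integrable_gauss (c : R) : 0 < c ->
  leb.-integrable setT (fun t => (expR (- (c * t ^+ 2)))%:E).
Proof.
move=> c0; apply/integrableP; split.
  apply/measurable_EFinP; apply: measurableT_comp => //.
  by apply: measurableT_comp => //; apply: measurable_funM => //; exact: measurable_funX.
under eq_integral do rewrite gee0_abs ?lee_fin ?expR_ge0//.
by rewrite integral_gauss// ltry.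
Qed.

Lemma is_derive_cos_lin (x th t : R) :
  is_derive t 1 (fun t => cos (x * t + th)) (- (x * sin (x * t + th))).
Proof.
have h : is_derive t 1 (fun t => x * t + th) x.
  have := is_deriveD (is_deriveM (is_derive_cst x t 1) (is_derive_id t 1)) (is_derive_cst th t 1).
  by rewrite scaler0 !addr0 /GRing.scale/= mulr1.
have := is_derive1_comp (f := cos) (g := fun t => x * t + th) (is_derive_cos _) h.
by rewrite mulNr mulrC.
Qed.

Lemma is_derive_gauss (c t : R) :
  is_derive t 1 (fun t => expR (- (c * t ^+ 2))) (- (2 * c * t) * expR (- (c * t ^+ 2))).
Proof.
have h : is_derive t 1 (fun t => - (c * t ^+ 2)) (- (2 * c * t)).
  have := is_deriveN (is_deriveM (is_derive_cst c t 1) (is_deriveX 2 (is_derive_id t 1))).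
  rewrite scaler0 addr0 /GRing.scale/= mulr1 expr1 => E.
  by rewrite -[2 * c]mulrC -mulrA.
have := is_derive1_comp (f := expR) (g := fun t => - (c * t ^+ 2)) (is_derive_expR _) h.
by rewrite mulrC.
Qed.

Let e t : R := expR (- (1 * t ^+ 2)).

Let e_half t : `|t| * e t <= expR (- (2^-1 * t ^+ 2)).
Proof.
have -> : e t = expR (- (2^-1 * t ^+ 2)) * expR (- (2^-1 * t ^+ 2)).
  by rewrite /e -expRD; congr expR; field.
rewrite mulrA ler_piMl ?expR_ge0// expRN ler_pdivrMr ?expR_gt0// mul1r.
apply: le_trans (expR_ge1Dx _).
have : 0 <= (`|t| - 1) ^+ 2 by exact: sqr_ge0.
rewrite sqrrB expr1n mulr1 real_normK ?num_real// => h; lra.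
Qed.

Let measurable_e : measurable_fun [set: R] e.
Proof.
apply: measurableT_comp => //; apply: measurableT_comp => //.
by apply: measurable_funM => //; exact: measurable_funX.
Qed.

Let measurable_cos_lin (x th : R) : measurable_fun [set: R] (fun t => cos (x * t + th)).
Proof.
apply: (@measurableT_comp _ _ _ _ _ _ (@cos R)).
  by apply: continuous_measurable_fun; exact: continuous_cos.
by apply: measurable_funD => //; apply: measurable_funM.
Qed.

Let measurable_sin_lin (x th : R) : measurable_fun [set: R] (fun t => sin (x * t + th)).
Proof.
apply: (@measurableT_comp _ _ _ _ _ _ (@sin R)).
  by apply: continuous_measurable_fun; exact: continuous_sin.
by apply: measurable_funD => //; apply: measurable_funM.
Qed.

Let normr_cos (a : R) : `|cos a| <= 1.
Proof. by rewrite ler_norml cos_geN1 cos_le1. Qed.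
Let normr_sin (a : R) : `|sin a| <= 1.
Proof. by rewrite ler_norml sin_geN1 sin_le1. Qed.

Let int_ecos (x th : R) : leb.-integrable setT (EFin \o (fun t => e t * cos (x * t + th))).
Proof.
apply: (le_integrable _ _ _ (integrable_gauss ltr01)) => //.
  apply/measurable_EFinP; apply: measurable_funM; first exact: measurable_e.
  exact: measurable_cos_lin.
by move=> t _ /=; rewrite lee_fin normrM ler_piMr// normr_cos.
Qed.

Let int_tesin (x th : R) : leb.-integrable setT (EFin \o (fun t => t * e t * sin (x * t + th))).
Proof.
have h : 0 < 2^-1 :> R by rewrite invr_gt0.
apply: (le_integrable _ _ _ (integrable_gauss h)) => //.
  apply/measurable_EFinP; apply: measurable_funM; last exact: measurable_sin_lin.
  by apply: measurable_funM; [exact: measurable_id|exact: measurable_e].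
move=> t _ /=; rewrite lee_fin normrM (ger0_norm (expR_ge0 _)).
apply: le_trans (e_half t).
by rewrite normrM (ger0_norm (expR_ge0 _)) ler_piMr// mulr_ge0// expR_ge0.
Qed.

(** The function exp (- t^2) sin (x t + th) vanishes at infinity, so its
    derivative has integral 0. *)
Let ibp (x th : R) : 2 * Rintegral leb setT (fun t => t * e t * sin (x * t + th))
  = x * Rintegral leb setT (fun t => e t * cos (x * t + th)).
Proof.
(* The sine is written as a cosine with shifted angle, so that the derivative
   of the cosine is the only one needed. *)
pose f (t : R) : R := e t * cos (x * t + (th - pi / 2)).
have fE t : f t = e t * sin (x * t + th).
  rewrite /f addrA cosB cos_pihalf sin_pihalf; congr (_ * _); ring.
pose f' (t : R) : R := x * (e t * cos (x * t + th)) - 2 * (t * e t * sin (x * t + th)).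
have df (t : R) : is_derive t 1 f (f' t).
  have := is_deriveM (is_derive_gauss 1 t) (is_derive_cos_lin x (th - pi / 2) t).
  rewrite /GRing.scale /= => E.
  apply: (is_derive_eq E).
  rewrite addrA cosB sinB cos_pihalf sin_pihalf -/(e t) /f'; ring.
have := @integral_derive_line f f' df.
have int_x := integrable_scale x (int_ecos x th).
have int_2 := integrable_scale 2 (int_tesin x th).
have bound t : `|f t| <= e t.
  by rewrite normrM (ger0_norm (expR_ge0 _)) ler_piMr ?expR_ge0.
have en : ((fun n : nat => e n%:R) @ \oo --> 0)%classic.
  apply: cvg0_le (cvg_harmonic) => n.
  rewrite (ger0_norm (expR_ge0 _)) /e expRN /harmonic lef_pV2 ?posrE ?expR_gt0//.
  apply: le_trans (expR_ge1Dx _).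
  rewrite mul1r -natrX -nat1r lerD2l ler_nat.
  by case: n => // n; rewrite expnS expn1 leq_pmulr.
have eN t : e (- t) = e t by rewrite /e sqrrN.
have lim0 (s : nat -> R) : (forall n, e (s n) = e n%:R) -> ((f \o s) @ \oo --> 0)%classic.
  by move=> es; apply: cvg0_le en => n; rewrite /= -es.
have ce : continuous e := is_derive_continuous (is_derive_gauss 1).
have cc th' : continuous (fun t : R => cos (x * t + th')) := is_derive_continuous (is_derive_cos_lin x th').
have cs : continuous (fun t : R => sin (x * t + th)).
  rewrite (_ : (fun t => _) = (fun t : R => cos (x * t + (th - pi / 2)))); first exact: cc.
  apply/funext => t; rewrite addrA cosB cos_pihalf sin_pihalf; ring.
have cf' : continuous f'.
  move=> t; apply: cvgB; apply: cvgM; try exact: cvg_cst; apply: cvgM; last exact: cs.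
  - exact: ce.
  - exact: cc.
  - by apply: cvgM; [exact: cvg_id|exact: ce].
have intf' : leb.-integrable setT (EFin \o f').
  exact: integrableB int_x int_2.
move=> /(_ cf' intf' (lim0 _ (fun=> erefl)) (lim0 _ (fun n => eN _))).
rewrite RintegralB// !RintegralZl// => /eqP; rewrite subr_eq0 => /eqP ->.
by [].
Qed.

(** As a function of x the integral F satisfies F' = - (x / 2) F, by
    differentiation under the integral and integration by parts; hence
    F exp (x^2 / 4) is constant.  The free angle th covers sines and cosines at
    once. *)
Lemma integral_gauss_cos (x th : R) :
  Rintegral leb setT (fun t => expR (- (1 * t ^+ 2)) * cos (x * t + th)) =
  Num.sqrt pi * expR (- (4^-1 * x ^+ 2)) * cos th.
Proof.
pose F x := Rintegral leb setT (fun t => e t * cos (x * t + th)).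
have dF (y : R) : is_derive y 1 F (- (2^-1 * y) * F y).
  have -> : - (2^-1 * y) * F y = Rintegral leb setT (fun t => - 1 * (t * e t * sin (y * t + th))).
    by rewrite RintegralZl// mulNr -mulrA -ibp; field.
  have h : 0 < 2^-1 :> R by rewrite invr_gt0.
  apply: (@is_derive_Rintegral _ _ _ leb (fun z t => e t * cos (z * t + th))
     (fun y t => - 1 * (t * e t * sin (y * t + th))) (fun t => expR (- (2^-1 * t ^+ 2)))) => //.
  - move=> z t; have := is_deriveM (is_derive_cst (e t) z 1) (is_derive_cos_lin t th z).
    rewrite /GRing.scale /= => E.
    under eq_fun do rewrite [_ * t]mulrC.
    by apply: (is_derive_eq E); rewrite mulr0 addr0 [z * t]mulrC; ring.
  - exact: integrable_gauss.
  - move=> z t; rewrite mulN1r normrN; apply: le_trans (e_half t).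
    rewrite !normrM (ger0_norm (expR_ge0 _)) ler_piMr// mulr_ge0// expR_ge0.
(* The integrating factor exp (y^2 / 4). *)
pose H (y : R) := F y * expR (- (- 4^-1 * y ^+ 2)).
have dH (y : R) : is_derive y 1 H 0.
  have := is_deriveM (dF y) (is_derive_gauss (- 4^-1) y).
  rewrite /GRing.scale /= => E; apply: (is_derive_eq E).
  by field.
have := is_derive_0_is_cst x 0 dH.
rewrite /H expr0n /= mulr0 oppr0 expR0 mulr1 => HE.
have F0 : F 0 = Num.sqrt pi * cos th.
  have := integral_gauss ltr01; rewrite invr1 mulr1 => hg.
  rewrite /F (_ : Num.sqrt pi = Rintegral leb setT e); last by rewrite /Rintegral hg.
  rewrite -RintegralZr//; last exact: (integrable_gauss ltr01).
  by apply: eq_Rintegral => t _; rewrite mul0r add0r.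
have : F x = F 0 * expR (- (4^-1 * x ^+ 2)).
  by rewrite -HE -mulrA -expRD mulNr opprK subrr expR0 mulr1.
by rewrite F0 /F => ->; ring.
Qed.

End Line.

Section PlaneGauss.
Context {R : realType}.
Local Notation leb := (@lebesgue_measure R).
Local Notation leb2 := (leb \x leb)%E.
Local Notation plane := (measurableTypeR R * measurableTypeR R)%type.
Local Open Scope complex_scope.

Definition dot (w z : R * R) : R := w.1 * z.1 + w.2 * z.2.
Definition gau (c : R) (z : R * R) : R := expR (- (c * (z.1 ^+ 2 + z.2 ^+ 2))).

Lemma Rintegral_plane12 (f : R -> R -> R) :
  leb2.-integrable setT (fun z => (f z.1 z.2)%:E) ->
  Rintegral leb2 setT (fun z => f z.1 z.2) =
  Rintegral leb setT (fun x => Rintegral leb setT (f x)).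
Proof.
move=> intf; rewrite /Rintegral (integral_fine_comp (integrable_fubini_F intf)).
by rewrite (integral12_prod_meas1 intf).
Qed.

Lemma gau_ge0 c z : 0 <= gau c z. Proof. exact: expR_ge0. Qed.

Lemma gau_split c (z : R * R) : gau c z = expR (- (c * z.1 ^+ 2)) * expR (- (c * z.2 ^+ 2)).
Proof. by rewrite -expRD /gau mulrDr opprD. Qed.

Lemma measurable_gau c : measurable_fun [set: plane] (gau c).
Proof.
apply: (@measurableT_comp _ _ _ _ _ _ expR) => //.
apply: measurableT_comp => //; apply: measurable_funM => //.
by apply: measurable_funD; apply: measurable_funX.
Qed.

Lemma measurable_dot w : measurable_fun [set: plane] (dot w).
Proof. by apply: measurable_funD; apply: measurable_funM. Qed.

Lemma integral_gau c : 0 < c -> (\int[leb2]_z (gau c z)%:E = (pi / c)%:E)%E.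
Proof.
move=> c0.
have := @plane_integral12 R (fun x y => (gau c (x, y))%:E).
have E : (fun p : plane => (gau c (p.1, p.2))%:E) = (fun p => (gau c p)%:E).
  by apply/funext => -[].
rewrite E => ->; last 2 first.
- by apply/measurable_EFinP; exact: measurable_gau.
- by move=> x y; rewrite lee_fin gau_ge0.
have s0 : 0 <= pi / c by rewrite divr_ge0 ?pi_ge0// ltW.
transitivity (\int[leb]_x ((expR (- (c * x ^+ 2)))%:E * (Num.sqrt (pi / c))%:E))%E.
  apply: eq_integral => x _; under eq_integral do rewrite gau_split EFinM /=.
  rewrite ge0_integralZl_EFin ?expR_ge0//.
  - by rewrite integral_gauss.
  - by have /integrableP[] := integrable_gauss c0.
rewrite ge0_integralZr//.
- by rewrite integral_gauss// -EFinM -expr2 sqr_sqrtr.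
- by have /integrableP[] := integrable_gauss c0.
Qed.

Lemma integrable_gau c : 0 < c -> leb2.-integrable setT (fun z => (gau c z)%:E).
Proof.
move=> c0; apply/integrableP; split; first by apply/measurable_EFinP; exact: measurable_gau.
under eq_integral do rewrite gee0_abs ?lee_fin ?gau_ge0//.
by rewrite integral_gau// ltry.
Qed.

Lemma integral_gau_cos (w : R * R) th :
  Rintegral leb2 setT (fun z => gau 1 z * cos (dot w z + th)) = pi * gau 4^-1 w * cos th.
Proof.
pose f x y := expR (- (1 * y ^+ 2)) * cos (w.2 * y + (w.1 * x + th)) * expR (- (1 * x ^+ 2)) : R.
have fE (z : plane) : gau 1 z * cos (dot w z + th) = f z.1 z.2.
  rewrite gau_split /f /dot [w.1 * _ + _]addrC -addrA; ring.
have int1 : leb2.-integrable setT (fun z => (gau 1 z * cos (dot w z + th))%:E).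
  apply: (le_integrable _ _ _ (integrable_gau ltr01)) => //.
    apply/measurable_EFinP; apply: measurable_funM; first exact: measurable_gau.
    apply: (@measurableT_comp _ _ _ _ _ _ (@cos R)).
      by apply: continuous_measurable_fun; exact: continuous_cos.
    by apply: measurable_funD => //; exact: measurable_dot.
  move=> t _ /=; rewrite lee_fin normrM ler_piMr//.
  by rewrite ler_norml cos_geN1 cos_le1.
under eq_Rintegral do rewrite fE.
rewrite Rintegral_plane12; last by under eq_fun do rewrite -fE.
have int2 x th' : leb.-integrable setT (EFin \o (fun t => expR (- (1 * t ^+ 2)) * cos (x * t + th'))).
  apply: (le_integrable _ _ _ (integrable_gauss ltr01)) => //.
    apply/measurable_EFinP; apply: measurable_funM.
      by apply: continuous_measurable_fun; exact: (is_derive_continuous (is_derive_gauss 1)).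
    by apply: continuous_measurable_fun; exact: (is_derive_continuous (is_derive_cos_lin x th')).
  move=> t _ /=; rewrite lee_fin normrM ler_piMr//.
  by rewrite ler_norml cos_geN1 cos_le1.
transitivity (Rintegral leb setT (fun x => Num.sqrt pi * expR (- (4^-1 * w.2 ^+ 2)) *
    (expR (- (1 * x ^+ 2)) * cos (w.1 * x + th)))).
  apply: eq_Rintegral => x _; rewrite /f RintegralZr//.
  by rewrite integral_gauss_cos; ring.
rewrite RintegralZl//.
rewrite integral_gauss_cos gau_split.
rewrite -{3}(sqr_sqrtr (pi_ge0 R)); ring.
Qed.

Lemma cintegrable_gau_cis c (w : R * R) : 0 < c ->
  cintegrable (fun z => (gau c z)%:C * cis (dot w z)).
Proof.
move=> c0; apply/cintegrableP; split.
  apply: cmeasM; first by apply: cmeas_real; exact: measurable_gau.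
  by apply: cmeas_cis; exact: measurable_dot.
under eq_integral do rewrite normc_mul normc_cis normc_real mulr1 ger0_norm ?gau_ge0//.
by rewrite integral_gau// ltry.
Qed.

Lemma cintegral_gau1_cis (w : R * R) :
  cintegral (fun z => (gau 1 z)%:C * cis (dot w z)) = (pi * gau 4^-1 w)%:C.
Proof.
apply: complex_eq => /=.
  transitivity (Rintegral leb2 setT (fun z => gau 1 z * cos (dot w z + 0))).
    by apply: eq_Rintegral => z _; rewrite /repart Re_mul /= mul0r subr0 addr0.
  by rewrite integral_gau_cos cos0 mulr1.
transitivity (Rintegral leb2 setT (fun z => gau 1 z * cos (dot w z + - (pi / 2)))).
  apply: eq_Rintegral => z _.
  by rewrite /impart Im_mul /= mul0r addr0 cosB cos_pihalf sin_pihalf; ring.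
by rewrite integral_gau_cos cosN cos_pihalf mulr0.
Qed.

(** Rescaling by the square root of c reduces to the unit Gaussian. *)
Lemma cintegral_gau_cis c (w : R * R) : 0 < c ->
  cintegral (fun z => (gau c z)%:C * cis (dot w z)) = (pi / c * gau (4 * c)^-1 w)%:C.
Proof.
move=> c0; have s0 : Num.sqrt c != 0 by rewrite sqrtr_eq0 -ltNge.
pose w' := (w.1 / Num.sqrt c, w.2 / Num.sqrt c).
have := @cintegral_affine2 R _ (0, 0) _ s0 (cintegrable_gau_cis w' ltr01).
rewrite cintegral_gau1_cis => E.
transitivity ((`|Num.sqrt c| ^- 2)%:C * (pi * gau 4^-1 w')%:C); last first.
  rewrite real_normK ?num_real// sqr_sqrtr ?ltW// -rmorphM; congr (_%:C).
  rewrite mulrCA mulrA; congr (_ * _).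
  rewrite /gau /= !expr_div_n sqr_sqrtr ?ltW//; congr (expR (- _)).
  by field; rewrite gt_eqF.
rewrite -E; apply: eq_cintegral => z; congr ((_%:C) * cis _).
  by rewrite /gau /affine2 /= !addr0 !exprMn sqr_sqrtr ?ltW// mul1r mulrDr.
by rewrite /dot /affine2 /=; field.
Qed.

End PlaneGauss.

(** * The kernel of order -3/2 *)

Section Kernel.
Context {R : realType}.
Implicit Types (t x y z : R).
Local Notation leb := (@lebesgue_measure R).

(** This is <t>^(-3/2), the square of the reciprocal of the weight <t>^(3/4);
    the square root keeps it inside elementary algebra. *)
Definition ker t : R := (bracket t * Num.sqrt (bracket t))^-1.

Lemma bracket_ge1 t : 1 <= bracket t. Proof. by rewrite /bracket lerDl. Qed.
Lemma bracket_gt0 t : 0 < bracket t. Proof. exact: lt_le_trans (bracket_ge1 t). Qed.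
Lemma sqrt_bracket_gt0 t : 0 < Num.sqrt (bracket t).
Proof. by rewrite sqrtr_gt0 bracket_gt0. Qed.
Lemma ker_gt0 t : 0 < ker t.
Proof. by rewrite invr_gt0 mulr_gt0 ?bracket_gt0 ?sqrt_bracket_gt0. Qed.
Hint Resolve bracket_ge1 bracket_gt0 sqrt_bracket_gt0 ker_gt0 : core.

Lemma bracketD s t : bracket (s + t) <= bracket s * bracket t.
Proof.
apply: (@le_trans _ _ (1 + `|s| + `|t|)); first by rewrite /bracket -addrA lerD2l ler_normD.
rewrite /bracket mulrDl mul1r [X in _ <= X](_ : _ = 1 + `|s| + `|t| + `|s| * `|t|); last by ring.
by rewrite lerDl mulr_ge0.
Qed.

Lemma bracketN t : bracket (- t) = bracket t. Proof. by rewrite /bracket normrN. Qed.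

Lemma measurable_bracket : measurable_fun [set: R] bracket.
Proof. by apply: measurable_funD => //; exact: measurable_normr. Qed.

Lemma continuous_bracket : continuous (bracket : R -> R).
Proof. by move=> t; apply: cvgD; [exact: cvg_cst|exact: norm_continuous]. Qed.

Lemma continuous_ker : continuous ker.
Proof.
move=> t; apply: cvgV.
  by rewrite gt_eqF// mulr_gt0.
apply: cvgM; first exact: continuous_bracket.
apply: (@continuous_comp _ _ _ bracket Num.sqrt); first exact: continuous_bracket.
exact: sqrt_continuous.
Qed.

Lemma measurable_ker : measurable_fun [set: R] ker.
Proof. exact: continuous_measurable_fun continuous_ker. Qed.

Lemma kerN t : ker (- t) = ker t. Proof. by rewrite /ker bracketN. Qed.

Lemma integral_ker : (\int[leb]_t (ker t)%:E = 4%:E)%E.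
Proof.
rewrite ge0_symfun_integralT; last 3 first.
- by move=> x; exact: ltW.
- exact: continuous_ker.
- by move=> x /=; rewrite kerN.
rewrite -set_itvcy.
(* An antiderivative of the kernel on the half line. *)
pose F t : R := - 2 * (Num.sqrt (1 + t))^-1.
have dF t : 0 <= t -> is_derive t 1 F (ker t).
  move=> t0.
  have b1 : 1 + t = bracket t by rewrite /bracket ger0_norm.
  have h1 : is_derive t 1 (fun t : R => 1 + t) 1.
    by have := is_deriveD (is_derive_cst (1 : R) t 1) (is_derive_id t 1); rewrite add0r.
  have h2 : is_derive t 1 (fun t : R => Num.sqrt (1 + t)) (2 * Num.sqrt (bracket t))^-1.
    have := is_derive1_comp (f := Num.sqrt) (g := fun t : R => 1 + t) (is_derive1_sqrt _) h1.
    by rewrite mulr1 b1; apply.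
  have := is_deriveM (is_derive_cst (-2 : R) t 1) (is_deriveV _ h2).
  rewrite /GRing.scale/= mulr0 addr0 b1 => /(_ _)E.
  apply: (is_derive_eq (E _)); first by rewrite gt_eqF.
  rewrite /ker; have q2 := sqr_sqrtr (ltW (bracket_gt0 t)); have q0 := sqrt_bracket_gt0 t.
  set q := Num.sqrt (bracket t) in q2 q0 *; rewrite -q2.
  by field; rewrite gt_eqF.
rewrite (@ge0_continuous_FTC2y R ker F 0 0).
- rewrite /F addr0 sqrtr1 invr1 mulr1 sub0e -EFinN opprK -EFinM; congr _%:E; ring.
- by move=> x _; exact: ltW.
- by apply: continuous_subspaceT; exact: continuous_ker.
- rewrite -[X in _ --> X](mulr0 (-2)); apply: cvgM; first exact: cvg_cst.
  apply/cvgrPdist_le => e e0; near=> t.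
  rewrite sub0r normrN ger0_norm ?invr_ge0 ?sqrtr_ge0//.
  have t0 : 0 <= t by near: t; exact: nbhs_pinfty_ge.
  have h : e = (Num.sqrt (e^-1 ^+ 2))^-1 by rewrite sqrtr_sqr ger0_norm ?invrK// invr_ge0 ltW.
  rewrite [leRHS]h lef_pV2 ?posrE ?sqrtr_gt0 ?exprn_gt0 ?invr_gt0//; last by lra.
  apply: ler_wsqrtr.
  suff : e^-1 ^+ 2 <= t by lra.
  by near: t; apply: nbhs_pinfty_ge; exact: num_real.
- by move=> x /ltW /dF [].
- apply: cvg_at_right_filter.
  by apply/differentiable_continuous; apply/derivable1_diffP; case: (dF 0 (lexx _)).
- move=> x; rewrite in_itv/= andbT => /ltW x0.
  by have := dF x x0 => ?; rewrite derive1E derive_val.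
Unshelve. all: end_near. Qed.

Lemma integral_ker_affine (m r : R) : m != 0 ->
  (\int[leb]_t (ker (m * (t - r)))%:E = (`|m|^-1 * 4)%:E)%E.
Proof.
move=> m0; rewrite EFinM -integral_ker -(ge0_integral_affine1 (- (m * r)) m0).
- by apply: eq_integral => t _; rewrite /affine1 mulrBr.
- by apply/measurable_EFinP; exact: measurable_ker.
- by move=> t; rewrite lee_fin ltW.
Qed.

Lemma ker_le c s t : 0 < c -> bracket s <= c ^+ 2 * bracket t -> ker t <= c ^+ 3 * ker s.
Proof.
move=> c0 st; rewrite /ker -ler_pdivrMl ?exprn_gt0// -invfM lef_pV2 ?posrE ?mulr_gt0 ?exprn_gt0//.
have h : Num.sqrt (bracket s) <= c * Num.sqrt (bracket t).
  rewrite -[c in c * _]gtr0_norm// -sqrtr_sqr -sqrtrM ?sqr_ge0//.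
  exact: ler_wsqrtr.
rewrite [X in _ <= X](_ : _ = (c ^+ 2 * bracket t) * (c * Num.sqrt (bracket t))); last by ring.
by apply: ler_pM => //; rewrite ?sqrtr_ge0// ltW.
Qed.

(** The larger of |u|, |v| is at least |u + v| / 2, and doubling the argument
    decreases the kernel by a bounded factor only. *)
Lemma kerM u v : ker u * ker v <= 8 * ker (u + v) * (ker u + ker v).
Proof.
wlog uv : u v / bracket v <= bracket u.
  move=> H; have [/H//|/ltW/H] := leP (bracket v) (bracket u).
  by rewrite mulrC (addrC v u) (addrC (ker v)).
have h : ker u <= 8 * ker (u + v).
  rewrite (_ : 8 = 2 ^+ 3); last by ring.
  apply: ker_le => //; apply: (@le_trans _ _ (bracket u + bracket v)).
    by rewrite /bracket addrACA; apply: lerD; [rewrite lerDl|exact: ler_normD].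
  have := ltW (bracket_gt0 u); move: uv => a b; lra.
apply: (@le_trans _ _ (8 * ker (u + v) * ker v)).
  by rewrite ler_wpM2r// ltW.
rewrite ler_wpM2l ?lerDr ?ltW// mulr_gt0//.
Qed.

Lemma measurable_ker_sub (r : R) : measurable_fun [set: R] (fun t => (ker (t - r))%:E).
Proof.
apply/measurable_EFinP; apply: (@measurableT_comp _ _ _ _ _ _ ker); first exact: measurable_ker.
by apply: measurable_funB.
Qed.

(** By [kerM] the product of the two kernels is at most ker (b - a) times a sum of
    two translates of an integrable function of t. *)
Lemma integral_ker_conv (a b : R) :
  (\int[leb]_t (ker (t - a) * ker (b - t))%:E <= (64 * ker (b - a))%:E)%E.
Proof.
have I1 r : (\int[leb]_t (ker (t - r))%:E = 4%:E)%E.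
  by under eq_integral do rewrite -[(_ - r)]mul1r; rewrite integral_ker_affine ?oner_neq0// normr1 invr1 mul1r.
apply: (@le_trans _ _ (\int[leb]_t ((8 * ker (b - a))%:E * ((ker (t - a))%:E + (ker (t - b))%:E)))%E).
  apply: ge0_le_integral => //.
  - by move=> t _; rewrite lee_fin mulr_ge0 ?ltW.
  - apply/measurable_EFinP; apply: measurable_funM.
      by apply/measurable_EFinP; exact: measurable_ker_sub.
    under eq_fun do rewrite -kerN opprB.
    by apply/measurable_EFinP; exact: measurable_ker_sub.
  - by apply: emeasurable_funM => //; apply: emeasurable_funD; exact: measurable_ker_sub.
  - move=> t _; rewrite -EFinD -EFinM lee_fin.
    have := kerM (t - a) (b - t).
    by rewrite -[ker (t - b)]kerN opprB (_ : t - a + (b - t) = b - a)//; ring.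
rewrite ge0_integralZl//.
- rewrite ge0_integralD//.
  + by rewrite !I1 -EFinD -EFinM lee_fin; have := ltW (ker_gt0 (b - a)); lra.
  + by move=> t _; rewrite lee_fin ltW.
  + exact: measurable_ker_sub.
  + by move=> t _; rewrite lee_fin ltW.
  + exact: measurable_ker_sub.
- by apply: emeasurable_funD; exact: measurable_ker_sub.
- by move=> t _; rewrite adde_ge0// lee_fin ltW.
- by rewrite lee_fin mulr_ge0// ltW.
Qed.

(** The point r is chosen to minimize <f>, up to 1: then |f y - f r| is
    at most a multiple of <f y>, and the separation hypothesis turns this into a
    bound of d y r by <f y>.  Centering at such a point, instead of at a zero of f,
    makes the estimate uniform in additive constants and needs no solution of
    f = 0. *)
Lemma separated_center (J : set R) (f : R -> R) (d : R -> R -> R) :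
  (forall y z, J y -> J z -> d y z <= `|f y - f z|) ->
  exists r, forall y, J y -> 1 + d y r <= 4 * bracket (f y).
Proof.
move=> Jd; have [[y0 Jy0]|J0] := pselect (J !=set0); last first.
  by exists 0 => y Jy; exfalso; apply: J0; exists y.
pose S : set R := [set bracket (f y) | y in J].
have hS : has_inf S.
  split; first by exists (bracket (f y0)); exists y0.
  by exists 1 => _ [y _ <-].
have [_ [r Jr <-] hr] := inf_adherent (ltr01 : 0 < 1) hS.
exists r => y Jy.
have hy : inf S <= bracket (f y) by apply: ge_inf; [case: hS|exists y].
have := Jd _ _ Jy Jr; have := ler_normB (f y) (f r).
have := bracket_ge1 (f y); move: hr hy; rewrite /bracket => h1 h2 h3 h4 h5; lra.
Qed.

End Kernel.

(** * Integrating the kernel along a rescaled phase *)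

Section PhaseIntegral.
Context {R : realType}.
Implicit Types (t x y z : R).
Local Notation leb := (@lebesgue_measure R).

Definition linear_piece (k : R) (p : R -> R) (J : set R) :=
  forall y z, J y -> J z -> k * `|y - z| <= `|p y - p z|.
Definition quadratic_piece (k p0 : R) (p : R -> R) (J : set R) :=
  (forall y z, J y -> J z -> k * (y - z) ^+ 2 <= `|p y - p z|) /\
  (forall y, J y -> k <= `|p y - p0|).

Section Pieces.
Variables (k p0 : R) (p : R -> R).
Hypothesis k0 : 0 < k.

Lemma dist_phase (xi tau a b : R) :
  `|tau - xi ^+ 3 * a - (tau - xi ^+ 3 * b)| = `|xi| ^+ 3 * `|a - b|.
Proof. by rewrite -normrX -normrM -normrN; congr `| _ |; ring. Qed.

(** On a linear piece the phase moves at speed at least m = k xi^2, so the kernel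
    of the phase is dominated by a multiple of ker (m (y - r)); its integral, of
    size 1 / m, compensates the factor xi^2.  The output weight is simply bounded
    by 1. *)
Lemma linear_piece_bound J xi tau : xi != 0 -> linear_piece k p J ->
  exists m r, 0 < m /\ forall y, J (y / xi) ->
   xi ^+ 2 / Num.sqrt (bracket (tau - p0 * xi ^+ 3)) * ker (tau - xi ^+ 3 * p (y / xi))
   <= 8 / k * (m * ker (m * (y - r))).
Proof.
move=> xi0 Jp; pose m := k * xi ^+ 2.
have xi2 : 0 < xi ^+ 2 by rewrite exprn_even_gt0.
have m0 : 0 < m by rewrite mulr_gt0.
have [|r hr] := @separated_center R (fun y => J (y / xi))
  (fun y => tau - xi ^+ 3 * p (y / xi)) (fun y z => m * `|y - z|).
  move=> y z Jy Jz; have := Jp _ _ Jy Jz; rewrite -mulrBl normrM normfV => h.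
  rewrite dist_phase.
  rewrite [leLHS](_ : _ = `|xi| ^+ 3 * (k * (`|y - z| / `|xi|))); last first.
    by rewrite /m -(real_normK (num_real xi)); field; rewrite normr_eq0.
  by rewrite ler_wpM2l// exprn_ge0.
exists m, r; split=> // y Jy.
have h : ker (tau - xi ^+ 3 * p (y / xi)) <= 8 * ker (m * (y - r)).
  rewrite (_ : 8 = 2 ^+ 3); last by ring.
  apply: ker_le => //; rewrite (_ : 2 ^+ 2 = 4); last by ring.
  by apply: le_trans (hr _ Jy); rewrite /bracket normrM (gtr0_norm m0).
rewrite (_ : 8 / k * _ = xi ^+ 2 * (8 * ker (m * (y - r)))); last first.
  by rewrite /m; field; rewrite gt_eqF.
rewrite -mulrA ler_wpM2l ?(ltW xi2)//.
apply: le_trans h; rewrite ler_piMl ?(ltW (ker_gt0 _))//.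
rewrite invf_le1 ?sqrt_bracket_gt0//.
by rewrite -[leLHS]sqrtr1; apply: ler_wsqrtr; exact: bracket_ge1.
Qed.

(** Here <f> dominates 1 + m^2 (y - r)^2 with m^2 = k |xi| only, f being the
    phase.  The factor <f>^(-3/2) is split: <f>^(-1) is dominated by
    ker (m (y - r)), and the remaining <f>^(-1/2) is combined with the output
    weight <t'>^(-1/2).  Since f and t' differ by at least k |xi|^3, the product of
    these two is at most 1 / (m |xi|). *)
Lemma quadratic_piece_bound J xi tau : xi != 0 -> quadratic_piece k p0 p J ->
  exists m r, 0 < m /\ forall y, J (y / xi) ->
   xi ^+ 2 / Num.sqrt (bracket (tau - p0 * xi ^+ 3)) * ker (tau - xi ^+ 3 * p (y / xi))
   <= 8 / k * (m * ker (m * (y - r))).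
Proof.
move=> xi0 [Jp Jp0].
have axi : 0 < `|xi| by rewrite normr_gt0.
have kx : 0 < k * `|xi| by rewrite mulr_gt0.
pose m := Num.sqrt (k * `|xi|).
have m0 : 0 < m by rewrite sqrtr_gt0.
have m2 : m ^+ 2 = k * `|xi| by rewrite sqr_sqrtr// ltW.
have [|r hr] := @separated_center R (fun y => J (y / xi))
  (fun y => tau - xi ^+ 3 * p (y / xi)) (fun y z => m ^+ 2 * (y - z) ^+ 2).
  move=> y z Jy Jz; have := Jp _ _ Jy Jz; rewrite -mulrBl => h.
  rewrite dist_phase m2.
  rewrite [leLHS](_ : _ = `|xi| ^+ 3 * (k * ((y - z) / xi) ^+ 2)); last first.
    by rewrite expr_div_n -[in RHS](real_normK (num_real xi)); field; rewrite normr_eq0.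
  by rewrite ler_wpM2l// exprn_ge0.
exists m, r; split=> // y Jy.
set f := tau - xi ^+ 3 * p (y / xi); set t' := tau - p0 * xi ^+ 3.
have f0 := bracket_gt0 f; have sf0 := sqrt_bracket_gt0 f; have st0 := sqrt_bracket_gt0 t'.
have {}hr : 1 + (m * (y - r)) ^+ 2 <= 4 * bracket f by rewrite exprMn; exact: hr.
pose s := `|m * (y - r)|.
have s0 : 0 <= s by rewrite /s normr_ge0.
have s2 : (1 + s) ^+ 2 <= 8 * bracket f.
  have h1 := sqr_ge0 (1 - s).
  have h2 : 1 + s ^+ 2 <= 4 * bracket f by rewrite /s real_normK ?num_real.
  nra.
have h1 : m * `|xi| <= Num.sqrt (bracket t') * Num.sqrt (bracket f).
  rewrite -(sqrtrM _ (ltW (bracket_gt0 t'))).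
  rewrite -[leLHS]ger0_norm ?(mulr_ge0 (ltW m0))// -sqrtr_sqr.
  apply: ler_wsqrtr; rewrite exprMn m2.
  apply: (@le_trans _ _ (bracket (t' + - f))); last first.
    by apply: le_trans (bracketD _ _) _; rewrite bracketN.
  rewrite /bracket (_ : t' + - f = xi ^+ 3 * (p (y / xi) - p0)); last by rewrite /t' /f; ring.
  rewrite normrM normrX.
  have := Jp0 _ Jy; set q := `|p _ - p0| => kq.
  have := ler_wpM2r (ltW (exprn_gt0 3 axi)) kq.
  rewrite [X in _ -> X <= _](_ : _ = k * `|xi| ^+ 3); last by ring.
  by rewrite [`|xi| ^+ 3 * q]mulrC => h; lra.
have hk : (bracket f)^-1 <= 8 * ker (m * (y - r)).
  rewrite /ker /bracket -/s -/(bracket f) ler_pdivlMr; last first.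
    by rewrite mulr_gt0// ?sqrtr_gt0 ltr_pwDl.
  rewrite mulrC ler_pdivrMr//; apply: le_trans s2.
  rewrite expr2 ler_wpM2l ?addr_ge0//.
  rewrite -[leRHS]ger0_norm ?addr_ge0// -sqrtr_sqr; apply: ler_wsqrtr.
  by rewrite expr2 ler_peMl ?addr_ge0// lerDl.
rewrite (_ : 8 / k * _ = `|xi| / m * (8 * ker (m * (y - r)))); last first.
  have -> : k = m ^+ 2 / `|xi| by rewrite m2 mulfK ?gt_eqF.
  by field; rewrite !gt_eqF.
apply: (@le_trans _ _ (`|xi| / m * (bracket f)^-1)); last first.
  by rewrite ler_wpM2l// divr_ge0 ?ltW.
rewrite /ker -/f -/t' -[xi ^+ 2]real_normK ?num_real//.
rewrite (_ : _ * (bracket f * _)^-1 = `|xi| ^+ 2 / (Num.sqrt (bracket t') * Num.sqrt (bracket f)) * (bracket f)^-1); last first.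
  by field; rewrite !gt_eqF.
apply: ler_wpM2r; first by rewrite invr_ge0 ltW.
rewrite ler_pdivrMr ?mulr_gt0// mulrAC ler_pdivlMr// expr2 -!mulrA.
by apply: ler_wpM2l; rewrite ?normr_ge0// mulrC.
Qed.
End Pieces.

(** A pointwise bound by a sum over all the pieces avoids integrating over a
    piece. *)
Lemma pieces_bound (I : finType) (J : I -> set R) (k p0 : R) (p : R -> R) :
  0 < k -> (forall x, exists i, J i x) ->
  (forall i, linear_piece k p (J i) \/ quadratic_piece k p0 p (J i)) ->
  forall xi tau, xi != 0 ->
  exists m r : I -> R, (forall i, 0 < m i) /\ forall y,
   xi ^+ 2 / Num.sqrt (bracket (tau - p0 * xi ^+ 3)) * ker (tau - xi ^+ 3 * p (y / xi))
   <= 8 / k * \sum_i (m i * ker (m i * (y - r i))).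
Proof.
move=> k0 Jcov Jp xi tau xi0.
have /choice[mr hmr] : forall i, exists mr : R * R, 0 < mr.1 /\ forall y, J i (y / xi) ->
   xi ^+ 2 / Num.sqrt (bracket (tau - p0 * xi ^+ 3)) * ker (tau - xi ^+ 3 * p (y / xi))
   <= 8 / k * (mr.1 * ker (mr.1 * (y - mr.2))).
  move=> i; case: (Jp i) => h.
    by have [m [r mr]] := linear_piece_bound p0 k0 tau xi0 h; exists (m, r).
  by have [m [r mr]] := quadratic_piece_bound k0 tau xi0 h; exists (m, r).
exists (fun i => (mr i).1), (fun i => (mr i).2); split; first by move=> i; case: (hmr i).
move=> y; have [i Ji] := Jcov (y / xi).
apply: (le_trans ((hmr i).2 y Ji)).
apply: ler_wpM2l; first by rewrite divr_ge0// ltW.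
rewrite (bigD1 i)//= lerDl sumr_ge0// => j _.
by rewrite mulr_ge0 ?ltW ?ker_gt0//; case: (hmr j).
Qed.

(** Each term m ker (m (y - r)) has integral 4, independently of m and r. *)
Lemma integral_pieces_bound (I : finType) (J : I -> set R) (k p0 : R) (p : R -> R) (f : R -> R -> R) :
  0 < k -> (forall x, exists i, J i x) ->
  (forall i, linear_piece k p (J i) \/ quadratic_piece k p0 p (J i)) ->
  (forall xi y, xi != 0 -> f xi y = xi ^+ 3 * p (y / xi)) ->
  (forall xi, measurable_fun [set: R] (f xi)) ->
  forall xi tau,
  (\int[leb]_y (xi ^+ 2 / Num.sqrt (bracket (tau - p0 * xi ^+ 3)) * ker (tau - f xi y))%:E
   <= (8 / k * (4 *+ #|I|))%:E)%E.
Proof.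
move=> k0 Jcov Jp fE mf xi tau.
have [->|xi0] := eqVneq xi 0.
  under eq_integral do rewrite expr0n/= !mul0r.
  by rewrite integral0 lee_fin mulr_ge0// ?divr_ge0 ?ltW// mulrn_wge0.
have [m [r [m0 h]]] := pieces_bound k0 Jcov Jp tau xi0.
have mk i : measurable_fun [set: R] (fun y => (m i * ker (m i * (y - r i)))%:E).
  apply/measurable_EFinP; apply: measurable_funM => //.
  apply: (@measurableT_comp _ _ _ _ _ _ ker); first exact: measurable_ker.
  by apply: measurable_funM => //; apply: measurable_funB.
have mk0 i y : (0 <= (m i * ker (m i * (y - r i)))%:E)%E.
  by rewrite lee_fin mulr_ge0// ltW// ker_gt0.
apply: (@le_trans _ _ (\int[leb]_y ((8 / k)%:E * \sum_(i : I) (m i * ker (m i * (y - r i)))%:E))%E).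
  apply: ge0_le_integral => //.
  - move=> y _; rewrite lee_fin; apply: mulr_ge0; last exact: ltW (ker_gt0 _).
    by rewrite divr_ge0 ?sqr_ge0 ?sqrtr_ge0.
  - apply/measurable_EFinP; apply: measurable_funM => //.
    apply: (@measurableT_comp _ _ _ _ _ _ ker); first exact: measurable_ker.
    by apply: measurable_funB => //; exact: mf.
  - by apply: emeasurable_funM => //; apply: emeasurable_sum.
  - by move=> y _; rewrite fE// sumEFin -EFinM lee_fin.
rewrite ge0_integralZl//.
- rewrite ge0_integral_sum//.
  apply: (@le_trans _ _ ((8 / k)%:E * (4 *+ #|I|)%:E)%E); last by rewrite -EFinM.
  apply: lee_wpmul2l; first by rewrite lee_fin divr_ge0// ltW.
  rewrite (eq_bigr (fun=> 4%:E)) => [|i _]; last first.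
    under eq_integral do rewrite EFinM.
    rewrite ge0_integralZl_EFin ?(ltW (m0 i))//.
    + rewrite integral_ker_affine ?gt_eqF// -EFinM (gtr0_norm (m0 i)).
      by rewrite mulrA divff ?mul1r// gt_eqF.
    + by move=> y _; rewrite lee_fin ltW// ker_gt0.
    + apply/measurable_EFinP; apply: (@measurableT_comp _ _ _ _ _ _ ker); first exact: measurable_ker.
      by apply: measurable_funM => //; apply: measurable_funB.
  by rewrite sumEFin sumr_const.
- by apply: emeasurable_sum.
- by move=> y _; apply: sume_ge0.
- by rewrite lee_fin divr_ge0 ?ltW.
Qed.

End PhaseIntegral.

(** * The cubic phase and its resonances *)

Section Cubic.
Context {R : realType}.
Implicit Types (x y z : R).

Lemma eq_le_normr (u v : R) : u = v -> `|u| <= `|v|.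
Proof. by move=> ->. Qed.

Section Factors.
Variables (a c : R).
Hypotheses (a0 : 0 < a) (c0 : 0 < c).
(** The phase a^2 y^3 + c^2 (xi - y)^3 is xi^3 times this cubic at y / xi. *)
Definition cubic x := a ^+ 2 * x ^+ 3 + c ^+ 2 * (1 - x) ^+ 3.
(** [linA] and [linB] are the linear factors of the derivative of [cubic], up to
    the factor 3; the zeros of these two functions are its critical points. *)
Definition linA x := (a + c) * x - c.
Definition linB x := (a - c) * x + c.

(** The mean value of the derivative 3 [linA] [linB] over the segment from z to y,
    written through the values of the two factors at the endpoints. *)
Lemma cubicB y z : cubic y - cubic z = (y - z) *
  (linA y * linB y + linA z * linB z + (linA y * linB z + linA z * linB y) / 2).
Proof. by rewrite /cubic /linA /linB; field. Qed.

(** The two critical points are distinct: the factors cannot be small together. *)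
Lemma linAB_large x : 2 * (a * c) <= (a + c) * (`|linA x| + `|linB x|).
Proof.
have -> : 2 * (a * c) = (a + c) * linB x - (a - c) * linA x.
  by rewrite /linA /linB; ring.
have h1 : (a + c) * linB x <= (a + c) * `|linB x|.
  by rewrite ler_wpM2l ?ler_norm// addr_ge0 ?ltW.
have h2 : - ((a - c) * linA x) <= (a + c) * `|linA x|.
  apply: (le_trans (ler_norm _)); rewrite normrN normrM ler_wpM2r//.
  by rewrite (le_trans (ler_normB _ _))// !gtr0_norm.
lra.
Qed.

Definition sgnset (s : bool) (l : R) := if s then 0 <= l else l <= 0.

(** When neither factor changes sign between y and z, the four products in
    [cubicB] have the same sign, so nothing cancels. *)
Lemma cubicB_ge sA sB y z : sgnset sA (linA y) -> sgnset sA (linA z) ->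
  sgnset sB (linB y) -> sgnset sB (linB z) ->
  `|y - z| * (`|linA y| * `|linB y| + `|linA z| * `|linB z|) <= `|cubic y - cubic z|.
Proof.
move=> Ay Az By Bz; rewrite cubicB normrM; apply: ler_wpM2l => //.
move: Ay Az By Bz.
set A1 := linA y; set A2 := linA z; set B1 := linB y; set B2 := linB z.
case: sA; case: sB => /= A10 A20 B10 B20.
- have h1 := mulr_ge0 A10 B20; have h2 := mulr_ge0 A20 B10.
  rewrite (ger0_norm A10) (ger0_norm A20) (ger0_norm B10) (ger0_norm B20).
  apply: le_trans (ler_norm _); lra.
- have h1 := mulr_ge0_le0 A10 B20; have h2 := mulr_ge0_le0 A20 B10.
  rewrite (ger0_norm A10) (ger0_norm A20) (ler0_norm B10) (ler0_norm B20).
  rewrite -[leRHS]normrN; apply: le_trans (ler_norm _); lra.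
- have h1 := mulr_le0_ge0 A10 B20; have h2 := mulr_le0_ge0 A20 B10.
  rewrite (ler0_norm A10) (ler0_norm A20) (ger0_norm B10) (ger0_norm B20).
  rewrite -[leRHS]normrN; apply: le_trans (ler_norm _); lra.
- have h1 := mulr_le0 A10 B20; have h2 := mulr_le0 A20 B10.
  rewrite (ler0_norm A10) (ler0_norm A20) (ler0_norm B10) (ler0_norm B20).
  apply: le_trans (ler_norm _); lra.
Qed.

Variables (d p0 : R).
Hypotheses (d0 : 0 < d) (dsmall : (a + c) * d <= a * c).
Hypothesis far : forall x, `|linA x| <= d \/ `|linB x| <= d -> d <= `|cubic x - p0|.

(** The index records the signs of the two factors and, in its last component,
    which of them is smaller than d, if any. *)
Definition piece (i : bool * bool * option bool) : set R := fun x =>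
  sgnset i.1.1 (linA x) /\ sgnset i.1.2 (linB x) /\
  match i.2 with
  | None => d <= `|linA x| /\ d <= `|linB x|
  | Some true => `|linA x| <= d
  | Some false => `|linB x| <= d
  end.

Lemma piece_cover x : exists i, piece i x.
Proof.
have s l : exists s, sgnset s l.
  by have [h|/ltW h] := leP 0 l; [exists true|exists false].
have [sA hA] := s (linA x); have [sB hB] := s (linB x).
have [lA|lA] := leP (`|linA x|) d; first by exists (sA, sB, Some true).
have [lB|lB] := leP (`|linB x|) d; first by exists (sA, sB, Some false).
by exists (sA, sB, None); do !split => //=; exact: ltW.
Qed.

(** The smallest of the separation constants produced by the different kinds of
    pieces in [pieceP]; when a = c the factor [linB] is constant. *)
Definition pk := Num.min (d ^+ 2) (Num.min (d * (a + c)) (Num.min d (if a == c then d else d * `|a - c|))).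

Lemma pk_gt0 : 0 < pk.
Proof.
rewrite !lt_min exprn_gt0// mulr_gt0 ?addr_gt0//= d0/=.
by case: ifPn => // ac; rewrite mulr_gt0// normr_gt0 subr_eq0.
Qed.

(** Where both factors exceed d the phase separates linearly.  Where one factor
    is below d, the other one is above d, and the small factor, an affine function
    of nonzero slope, separates y and z by itself: |y - z| is bounded by the sum
    of its absolute values at y and z.  This gives quadratic separation; the
    distance to p0 is the hypothesis on critical regions. *)
Lemma pieceP i : linear_piece pk cubic (piece i) \/ quadratic_piece pk p0 cubic (piece i).
Proof.
have k1 : pk <= d ^+ 2 by rewrite !ge_min lexx.
have k2 : pk <= d * (a + c) by rewrite !ge_min lexx orbT.
have k3 : pk <= d by rewrite !ge_min lexx !orbT.
have k4 : pk <= (if a == c then d else d * `|a - c|) by rewrite !ge_min lexx !orbT.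
have ac0 : 0 < a + c by rewrite addr_gt0.
have big l l' : l' <= d -> 2 * (a * c) <= (a + c) * (l + l') -> d <= l.
  move=> l'd h; rewrite -(ler_pM2l ac0).
  by have := dsmall; have := ler_wpM2l (ltW ac0) l'd; lra.
have quad (m e D P Q : R) : pk <= d * e -> 0 <= D -> e * D <= P + Q -> d * (P + Q) <= m -> pk * D ^+ 2 <= D * m.
  move=> ke D0 eD PQ; rewrite expr2 mulrCA; apply: ler_wpM2l => //.
  apply: le_trans PQ; apply: le_trans (ler_wpM2l (ltW d0) eD).
  by rewrite mulrA; apply: ler_wpM2r.
case: i => [[sA sB] [[]|]].
- right; split.
    move=> y z [/= Ay [By sy]] [Az [Bz sz]].
    apply: le_trans (cubicB_ge Ay Az By Bz).
    have By' : d <= `|linB y|.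
      by apply: (big _ _ sy); have := linAB_large y; rewrite [_ + `|linB y|]addrC.
    have Bz' : d <= `|linB z|.
      by apply: (big _ _ sz); have := linAB_large z; rewrite [_ + `|linB z|]addrC.
    rewrite -[(y - z) ^+ 2]real_normK ?num_real//.
    apply: (quad _ (a + c) _ `|linA y| `|linA z|) => //.
      apply: le_trans (ler_normB _ _).
      by rewrite -(gtr0_norm ac0) -normrM /linA; apply: eq_le_normr; ring.
    by rewrite mulrDr; apply: lerD; rewrite mulrC ler_wpM2l.
  by move=> y [/= _ [_ h]]; apply: le_trans k3 _; apply: far; left.
- right; split.
    move=> y z [/= Ay [By sy]] [Az [Bz sz]].
    apply: le_trans (cubicB_ge Ay Az By Bz).
    have Ay' : d <= `|linA y| by apply: (big _ _ sy); exact: linAB_large.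
    have Az' : d <= `|linA z| by apply: (big _ _ sz); exact: linAB_large.
    rewrite -[(y - z) ^+ 2]real_normK ?num_real//.
    move: k4; case: eqP => [ac _|_ k4].
      exfalso; move: sy dsmall; rewrite /linB ac subrr mul0r add0r gtr0_norm// => cd h.
      have := ler_wpM2l (ltW c0) cd; have := mulr_gt0 c0 c0; lra.
    apply: (quad _ `|a - c| _ `|linB y| `|linB z|) => //.
      apply: le_trans (ler_normB _ _).
      by rewrite -normrM /linB; apply: eq_le_normr; ring.
    by rewrite mulrDr; apply: lerD; rewrite ler_wpM2r.
  by move=> y [/= _ [_ h]]; apply: le_trans k3 _; apply: far; right.
- left=> y z [/= Ay [By [sy ty]]] [Az [Bz [sz tz]]].
  apply: le_trans (cubicB_ge Ay Az By Bz).
  rewrite mulrC; apply: ler_wpM2l => //; apply: le_trans k1 _.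
  rewrite expr2 -[leLHS]addr0; apply: lerD; last by rewrite mulr_ge0.
  by apply: ler_pM => //; exact: ltW.
Qed.
End Factors.

Local Notation leb := (@lebesgue_measure R).
Local Notation leb2 := (leb \x leb)%E.
Local Notation plane := (measurableTypeR R * measurableTypeR R)%type.

(** The bound left after the integration in the time frequency: al1 and al2 are
    the dispersions of the two factors, al0 that of the product. *)
Definition resonant_bound (al1 al2 al0 : R) := exists C : R, 0 < C /\ forall xi tau,
  (\int[leb]_y (xi ^+ 2 / Num.sqrt (bracket (tau - al0 * xi ^+ 3)) *
     ker (tau - (al1 * y ^+ 3 + al2 * (xi - y) ^+ 3)))%:E <= C%:E)%E.

Lemma resonant_boundP (a c d p0 : R) : 0 < a -> 0 < c -> 0 < d -> (a + c) * d <= a * c ->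
  (forall x, `|linA a c x| <= d \/ `|linB a c x| <= d -> d <= `|cubic a c x - p0|) ->
  resonant_bound (a ^+ 2) (c ^+ 2) p0.
Proof.
move=> a0 c0 d0 dsm far.
exists (8 / pk a c d * (4 *+ #|{: bool * bool * option bool}|)); split.
  by rewrite mulr_gt0 ?divr_gt0 ?pk_gt0// mulrn_wgt0// !card_prod card_option card_bool.
move=> xi tau.
apply: (integral_pieces_bound (J := piece a c d) (p := cubic a c)
  (f := fun xi y => a ^+ 2 * y ^+ 3 + c ^+ 2 * (xi - y) ^+ 3)) => //.
- exact: pk_gt0.
- exact: piece_cover.
- exact: pieceP.
- by move=> x y x0; rewrite /cubic; field.
- move=> x; apply: measurable_funD; apply: measurable_funM => //; apply: measurable_funX => //.
  exact: measurable_funB.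
Qed.

Variable al : R.
Hypotheses (al_gt0 : 0 < al) (al_lt1 : al < 1).

(** For equal dispersions the only critical point is 1/2, with critical value
    al / 4, and near it the cubic stays below 1. *)
Lemma resonant_vv : resonant_bound al al 1.
Proof.
pose a := Num.sqrt al.
have a0 : 0 < a by rewrite sqrtr_gt0.
have a2 : al = a ^+ 2 by rewrite sqr_sqrtr ?ltW.
have a1 : a < 1 by rewrite -sqrtr1 ltr_sqrt.
rewrite a2; apply: (@resonant_boundP a a (a / 2)) => //.
- by rewrite divr_gt0.
- by nra.
move=> x [|]; last first.
  by rewrite /linB subrr mul0r add0r gtr0_norm// => h; exfalso; lra.
move=> h; rewrite distrC; apply: le_trans (ler_norm _).
have h2 : linA a a x ^+ 2 <= a ^+ 2 / 4.
  rewrite -real_normK ?num_real// (_ : a ^+ 2 / 4 = (a / 2) ^+ 2); last by field.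
  by apply: lerXn2r => //; rewrite nnegrE ?divr_ge0// ltW.
have -> : cubic a a x = a ^+ 2 / 4 + 3 / 4 * linA a a x ^+ 2.
  by rewrite /cubic /linA; field.
nra.
Qed.

(** With c^2 = al one has cubic x - c^2 = x (A B - c^2 (2 - x)), where A, B are the
    two linear factors.  Where A or B is small, x stays away from 0 and the second
    term dominates the first: near A = 0 one has x <= 1, near B = 0 one has x < 0. *)
Lemma resonant_uv : resonant_bound 1 al al.
Proof.
pose c := Num.sqrt al.
have c0 : 0 < c by rewrite sqrtr_gt0.
have c2 : al = c ^+ 2 by rewrite sqr_sqrtr ?ltW.
have c1 : c < 1 by rewrite -sqrtr1 ltr_sqrt.
rewrite c2 -(expr1n R 2).
have c22 : c ^+ 2 <= 1 by rewrite expr_le1 ?ltW.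
have c3 : c ^+ 3 <= c ^+ 2 by rewrite exprS ler_piMl ?sqr_ge0 ?ltW.
have c2c : c ^+ 2 <= c by rewrite expr2 ler_piMl ?ltW.
have c30 : 0 < c ^+ 3 by rewrite exprn_gt0.
have c20 : 0 < c ^+ 2 by rewrite exprn_gt0.
apply: (@resonant_boundP 1 c (c ^+ 3 / 8)) => //.
- by rewrite divr_gt0.
- by nra.
move=> x; set A := linA 1 c x; set B := linB 1 c x.
have -> : cubic 1 c x - c ^+ 2 = x * (A * B - c ^+ 2 * (2 - x)).
  by rewrite /cubic /A /B /linA /linB; ring.
have EA : (1 + c) * x = A + c by rewrite /A /linA; ring.
have EB : (1 - c) * x = B - c by rewrite /B /linB; ring.
rewrite normrM; move=> [|]; rewrite ler_norml => /andP[h1 h2].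
- have x0 : c / 4 <= x.
    rewrite -(@ler_pM2l _ (1 + c)) ?EA; last by lra.
    nra.
  have x1 : x <= 1.
    rewrite -(@ler_pM2l _ (1 + c)) ?EA; last by lra.
    nra.
  have B1 : `|B| <= 1 by rewrite ler_norml; apply/andP; split; nra.
  have AB : A * B <= c ^+ 3 / 8.
    apply: (le_trans (ler_norm _)); rewrite normrM -[leRHS]mulr1.
    by apply: ler_pM => //; rewrite ler_norml h1 h2.
  rewrite (ger0_norm (x := x)); last by apply: le_trans x0; rewrite divr_ge0 ?ltW.
  apply: (@le_trans _ _ (c / 4 * (c ^+ 2 / 2))); first by lra.
  apply: ler_pM => //; try by rewrite ?divr_ge0 ?ltW.
  rewrite -normrN; apply: le_trans (ler_norm _); nra.
- have x0 : x <= - (c / 2).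
    have xn : (1 - c) * x <= - (c / 2) by rewrite EB; lra.
    have x_le0 : x <= 0.
      by rewrite -(@ler_pM2l _ (1 - c)) ?mulr0; lra.
    by apply: le_trans xn; nra.
  have A_le : `|A| <= 2 * (- x) + c.
    by rewrite ler_norml; apply/andP; split; rewrite /A /linA; nra.
  have AB : A * B <= (2 * (- x) + c) * (c ^+ 3 / 8).
    apply: (le_trans (ler_norm _)); rewrite normrM.
    by apply: ler_pM => //; rewrite ler_norml h1 h2.
  rewrite (ler0_norm (x := x)); last by apply: (le_trans x0); rewrite oppr_le0 divr_ge0 ?ltW.
  apply: (@le_trans _ _ (c / 2 * c ^+ 2)); first by lra.
  apply: ler_pM => //; try by rewrite ?divr_ge0 ?ltW.
    by lra.
  rewrite -normrN; apply: le_trans (ler_norm _).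
  have xc : (- x) * c ^+ 3 <= (- x) * c ^+ 2 by apply: ler_wpM2l => //; lra.
  have c4 : c * c ^+ 3 <= c ^+ 2 by apply: le_trans c3; rewrite ler_piMl ?ltW.
  have xp : 0 <= (- x) * c ^+ 2 by apply: mulr_ge0; [lra|exact: ltW].
  lra.
Qed.

(** The integral in the time frequency is a convolution of two kernels. *)
Lemma plane_resonant_bound (al1 al2 al0 : R) : resonant_bound al1 al2 al0 ->
  exists C : R, 0 < C /\ forall z : R * R,
  (\int[leb2]_w (z.1 ^+ 2 / Num.sqrt (bracket (z.2 - al0 * z.1 ^+ 3)) *
     (ker (w.2 - al1 * w.1 ^+ 3) * ker ((z.2 - w.2) - al2 * (z.1 - w.1) ^+ 3)))%:E <= C%:E)%E.
Proof.
move=> [C [C0 hC]]; exists (64 * C); split; first by rewrite mulr_gt0.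
move=> [xi tau] /=.
set q := xi ^+ 2 / _.
have q0 : 0 <= q by rewrite divr_ge0 ?sqr_ge0 ?sqrtr_ge0.
have {}hC := hC xi tau; rewrite -/q in hC; clearbody q.
have k0 t : 0 <= ker t by exact: ltW (ker_gt0 t).
have mcube (p : R) (u : R) : measurable_fun [set: R] (fun y : R => p * (u - y) ^+ 3).
  by apply: measurable_funM => //; apply: measurable_funX; apply: measurable_funB.
have mker d (T : measurableType d) (f : T -> R) : measurable_fun setT f -> measurable_fun setT (fun t => ker (f t)).
  by move=> mf; apply: (@measurableT_comp _ _ _ _ _ _ ker) => //; exact: measurable_ker.
have mjoint : measurable_fun [set: plane] (fun p : plane =>
    (q * (ker (p.2 - al1 * p.1 ^+ 3) * ker ((tau - p.2) - al2 * (xi - p.1) ^+ 3)))%:E).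
  apply/measurable_EFinP; apply: measurable_funM => //; apply: measurable_funM; apply: mker.
    by apply: measurable_funB => //; apply: measurable_funM => //; apply: measurable_funX.
  apply: measurable_funB; first by apply: measurable_funB.
  by apply: measurable_funM => //; apply: measurable_funX; apply: measurable_funB.
rewrite (@plane_integral12 R (fun y s => (q * (ker (s - al1 * y ^+ 3) * ker ((tau - s) - al2 * (xi - y) ^+ 3)))%:E)).
- apply: (@le_trans _ _ (\int[leb]_y (64%:E * (q * ker (tau - (al1 * y ^+ 3 + al2 * (xi - y) ^+ 3)))%:E))%E); last first.
    rewrite ge0_integralZl_EFin//.
    + by rewrite EFinM; apply: lee_wpmul2l.
    + by move=> y _; rewrite lee_fin !mulr_ge0// ?k0.
    + apply/measurable_EFinP; apply: measurable_funM => //; apply: mker.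
      apply: measurable_funB => //; apply: measurable_funD; last exact: mcube.
      by apply: measurable_funM => //; exact: measurable_funX.
  have mout : measurable_fun [set: R] (fun y => q * ker (tau - (al1 * y ^+ 3 + al2 * (xi - y) ^+ 3))).
    apply: measurable_funM => //; apply: mker.
    apply: measurable_funB => //; apply: measurable_funD; last exact: mcube.
    by apply: measurable_funM => //; exact: measurable_funX.
  apply: ge0_le_integral => //.
  + by move=> y _; apply: integral_ge0 => s _; rewrite lee_fin !mulr_ge0// ?k0.
  + apply: (@measurable_fun_fubini_tonelli_F _ _ _ _ R leb (fun p : plane =>
      (q * (ker (p.2 - al1 * p.1 ^+ 3) * ker ((tau - p.2) - al2 * (xi - p.1) ^+ 3)))%:E)) => //.
    by move=> p; rewrite lee_fin !mulr_ge0// ?k0.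
  + by apply: emeasurable_funM => //; exact/measurable_EFinP.
  + move=> y _; under eq_integral do rewrite EFinM.
    rewrite ge0_integralZl_EFin//.
    * rewrite [leRHS](_ : _ = q%:E * (64 * ker (tau - (al1 * y ^+ 3 + al2 * (xi - y) ^+ 3)))%:E)%E; last first.
        by rewrite -!EFinM mulrCA.
      apply: lee_wpmul2l; first by rewrite lee_fin.
      under eq_integral do rewrite (addrAC tau).
      apply: le_trans (integral_ker_conv _ _) _.
      by rewrite lee_fin (_ : tau - al2 * (xi - y) ^+ 3 - al1 * y ^+ 3 = tau - (al1 * y ^+ 3 + al2 * (xi - y) ^+ 3))//; ring.
    * by move=> s _; rewrite lee_fin !mulr_ge0// ?k0.
    * apply/measurable_EFinP; apply: measurable_funM; apply: mker; first by apply: measurable_funB.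
      by do 2 (apply: measurable_funB => //).
- exact: mjoint.
- by move=> y s; rewrite lee_fin !mulr_ge0// ?k0.
Qed.

End Cubic.

(** * Weighted estimates for convolutions *)

Section EReal.
Context {R : realType}.
Local Open Scope ereal_scope.

Lemma poweR2 (x : \bar R) : 0 <= x -> x `^ 2%R = x * x.
Proof.
case: x => [r||]//; last by rewrite poweRyr ?mulyy// pnatr_eq0.
by rewrite lee_fin => r0; rewrite poweR_EFin powR_mulrn// expr2.
Qed.

(** Comparing squares avoids square roots of extended reals. *)
Lemma lee_mul_self (x y : \bar R) : 0 <= y -> x * x <= y * y -> x <= y.
Proof.
case: y => [b||]; last 2 first.
- by move=> _ _; rewrite leey.
- by rewrite leeNy_eq.
case: x => [a||]; last 2 first.
- by move=> _; rewrite mulyy -EFinM leye_eq.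
- by move=> _ _; rewrite leNye.
rewrite !lee_fin => b0 ab; have [a0|/ltW a0] := leP 0%R a; last exact: le_trans b0.
by rewrite -(ler_pXn2r (ltn0Sn 1)) ?nnegrE// !expr2.
Qed.
End EReal.

Section L2.
Context d (T : measurableType d) (R : realType) (mu : {measure set T -> \bar R}).
Local Open Scope ereal_scope.

Lemma cauchy_schwarz (f g : T -> R) :
  measurable_fun setT f -> measurable_fun setT g ->
  (forall x, 0 <= f x)%R -> (forall x, 0 <= g x)%R ->
  (\int[mu]_x (f x * g x)%:E) * (\int[mu]_x (f x * g x)%:E) <=
  (\int[mu]_x (f x ^+ 2)%:E) * (\int[mu]_x (g x ^+ 2)%:E).
Proof.
move=> mf mg f0 g0.
have half2 : (2^-1 + 2^-1 = 1 :> R)%R by rewrite [RHS]splitr !mul1r.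
have h := hoelder mu mf mg (ltr0Sn _ 1) (ltr0Sn _ 1) half2.
have L2 (u : T -> R) : (forall x, 0 <= u x)%R ->
    'N[mu]_(2%:E) [EFin \o u] * 'N[mu]_(2%:E) [EFin \o u] = \int[mu]_x (u x ^+ 2)%:E.
  move=> u0; rewrite -poweR2 ?Lnorm_ge0// poweR_Lnorm ?pnatr_eq0//.
  apply: eq_integral => x _ /=.
  by rewrite powR_mulrn// ger0_norm.
have E1 : 'N[mu]_1 [EFin \o (f \* g)%R] = \int[mu]_x (f x * g x)%:E.
  by rewrite Lnorm1; apply: eq_integral => x _ /=; rewrite ger0_norm// mulr_ge0.
rewrite -E1 -!L2// muleACA.
by apply: lee_pmul; rewrite ?Lnorm_ge0.
Qed.

(** Both sides may be infinite. *)
Lemma L2norm_sq (f : T -> R) :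
  'N[mu]_(2%:E) [EFin \o f] * 'N[mu]_(2%:E) [EFin \o f] = \int[mu]_x (f x ^+ 2)%:E.
Proof.
rewrite -poweR2 ?Lnorm_ge0// poweR_Lnorm ?pnatr_eq0//.
apply: eq_integral => x _ /=.
by rewrite powR_mulrn// real_normK ?num_real.
Qed.
End L2.

Section PlaneConv.
Context {R : realType}.
Local Open Scope ereal_scope.
Local Notation leb := (@lebesgue_measure R).
Local Notation leb2 := (leb \x leb).
Local Notation plane := (measurableTypeR R * measurableTypeR R)%type.
Implicit Types (z w : plane) (f g : plane -> R).

(** Subtraction in the plane, by components, so that it is available on the
    measurable product type. *)
Definition psub (z w : R * R) : R * R := ((z.1 - w.1)%R, (z.2 - w.2)%R).

Lemma psub_refl (z w : R * R) : psub z w = affine2 (-1) z w.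
Proof. by rewrite /psub /affine2 !mulN1r ![(- _ + _)%R]addrC. Qed.
Lemma psub_transl (z w : R * R) : psub z w = affine2 1 (- w.1, - w.2)%R z.
Proof. by rewrite /psub /affine2 !mul1r. Qed.

Lemma measurable_psub : measurable_fun [set: plane * plane]
  (fun p : plane * plane => psub p.1 p.2 : plane).
Proof.
apply/measurable_fun_pair.
  apply: measurable_funB.
    exact: (measurableT_comp measurable_fst measurable_fst).
  exact: (measurableT_comp measurable_fst measurable_snd).
apply: measurable_funB.
  exact: (measurableT_comp measurable_snd measurable_fst).
exact: (measurableT_comp measurable_snd measurable_snd).
Qed.

Lemma measurable_psub1 z : measurable_fun [set: plane] (fun w => psub z w : plane).
Proof.
rewrite (_ : psub z = affine2 (-1) z); first exact: measurable_affine2.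
by apply/funext => w; rewrite psub_refl.
Qed.

Lemma measurable_psub2 w : measurable_fun [set: plane] (fun z => psub z w : plane).
Proof.
rewrite (_ : (fun z => psub z w) = affine2 1 (- w.1, - w.2)%R); first exact: measurable_affine2.
by apply/funext => z; rewrite psub_transl.
Qed.

Lemma ge0_integral_psub1 z (f : plane -> \bar R) :
  measurable_fun setT f -> (forall z, 0 <= f z) ->
  \int[leb2]_w f (psub z w) = \int[leb2]_w f w.
Proof.
move=> mf f0; under eq_integral do rewrite psub_refl.
by rewrite ge0_integral_affine2// ?normrN1 ?expr1n ?invr1 ?mul1e// oppr_eq0 oner_eq0.
Qed.

Lemma ge0_integral_psub2 w (f : plane -> \bar R) :
  measurable_fun setT f -> (forall z, 0 <= f z) ->
  \int[leb2]_z f (psub z w) = \int[leb2]_z f z.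
Proof.
move=> mf f0; under eq_integral do rewrite psub_transl.
by rewrite ge0_integral_affine2// ?normr1 ?expr1n ?invr1 ?mul1e// oner_eq0.
Qed.

Lemma convolution_tonelli f g : measurable_fun setT f -> measurable_fun setT g ->
  (forall z, 0 <= f z)%R -> (forall z, 0 <= g z)%R ->
  \int[leb2]_z \int[leb2]_w (f w * g (psub z w))%:E =
  (\int[leb2]_z (f z)%:E) * (\int[leb2]_z (g z)%:E).
Proof.
move=> mf mg f0 g0.
rewrite plane_tonelli; last 2 first.
- apply/measurable_EFinP; apply: measurable_funM.
    exact: (measurableT_comp mf measurable_snd).
  exact: (measurableT_comp mg measurable_psub).
- by move=> z w; rewrite lee_fin mulr_ge0.
transitivity (\int[leb2]_w ((f w)%:E * \int[leb2]_z (g z)%:E)).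
  apply: eq_integral => w _; under eq_integral do rewrite EFinM.
  rewrite ge0_integralZl_EFin//.
  - by congr (_ * _); rewrite (ge0_integral_psub2 w (f := fun z => (g z)%:E))//; exact/measurable_EFinP.
  - by move=> z _; rewrite lee_fin.
  - by apply/measurable_EFinP; exact: (measurableT_comp mg (measurable_psub2 w)).
rewrite ge0_integralZr//.
- exact/measurable_EFinP.
- by move=> z _; rewrite lee_fin.
- by apply: integral_ge0 => z _; rewrite lee_fin.
Qed.

(** Cauchy-Schwarz at fixed z, with the weights inserted, bounds q z times the
    square of the convolution by C times the convolution of (w1 f)^2 and
    (w2 g)^2, whose integral is the product of the two integrals. *)
Lemma weighted_convolution f g (w1 w2 q : plane -> R) (C : R) :
  measurable_fun setT f -> measurable_fun setT g ->
  measurable_fun setT w1 -> measurable_fun setT w2 -> measurable_fun setT q ->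
  (forall z, 0 <= f z)%R -> (forall z, 0 <= g z)%R ->
  (forall z, 0 < w1 z)%R -> (forall z, 0 < w2 z)%R -> (forall z, 0 <= q z)%R -> (0 <= C)%R ->
  (forall z, \int[leb2]_w (q z * ((w1 w)^-1 * (w2 (psub z w))^-1) ^+ 2)%:E <= C%:E) ->
  \int[leb2]_z ((q z)%:E * ((\int[leb2]_w (f w * g (psub z w))%:E) * (\int[leb2]_w (f w * g (psub z w))%:E))) <=
  C%:E * ((\int[leb2]_z ((w1 z * f z) ^+ 2)%:E) * (\int[leb2]_z ((w2 z * g z) ^+ 2)%:E)).
Proof.
move=> mf mg mw1 mw2 mq f0 g0 w10 w20 q0 C0 hC.
pose F z := ((w1 z * f z) ^+ 2)%R; pose G z := ((w2 z * g z) ^+ 2)%R.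
have mF : measurable_fun setT F by apply: measurable_funX; apply: measurable_funM.
have mG : measurable_fun setT G by apply: measurable_funX; apply: measurable_funM.
have F0 z : (0 <= F z)%R by exact: sqr_ge0.
have G0 z : (0 <= G z)%R by exact: sqr_ge0.
rewrite -(convolution_tonelli mF mG F0 G0).
have mfg : measurable_fun [set: plane * plane] (fun p => (f p.2 * g (psub p.1 p.2))%:E).
  apply/measurable_EFinP; apply: measurable_funM.
    exact: (measurableT_comp mf measurable_snd).
  exact: (measurableT_comp mg measurable_psub).
have mFG : measurable_fun [set: plane * plane] (fun p => (F p.2 * G (psub p.1 p.2))%:E).
  apply/measurable_EFinP; apply: measurable_funM.
    exact: (measurableT_comp mF measurable_snd).
  exact: (measurableT_comp mG measurable_psub).
have fg0 (x y : plane) : 0 <= (f y * g (psub x y))%:E by rewrite lee_fin mulr_ge0.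
have FG0 (x y : plane) : 0 <= (F y * G (psub x y))%:E by rewrite lee_fin mulr_ge0.
have mc := plane_measurable_integral mfg fg0.
have mC := plane_measurable_integral mFG FG0.
have C0' z : 0 <= \int[leb2]_w (F w * G (psub z w))%:E.
  by apply: integral_ge0 => w _; rewrite lee_fin mulr_ge0.
have c0' z : 0 <= \int[leb2]_w (f w * g (psub z w))%:E.
  by apply: integral_ge0 => w _; rewrite lee_fin mulr_ge0.
rewrite -ge0_integralZl_EFin//.
apply: ge0_le_integral => //.
- by move=> z _; rewrite !mule_ge0// lee_fin.
- by apply: emeasurable_funM; [exact/measurable_EFinP|exact: emeasurable_funM].
- by apply: emeasurable_funM.
move=> z _.
have mpsub : measurable_fun [set: plane] (fun w => psub z w : plane) := measurable_psub1 z.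
have := @cauchy_schwarz _ _ R leb2 (fun w => w1 w * f w * (w2 (psub z w) * g (psub z w)))%R
   (fun w => (w1 w)^-1 * (w2 (psub z w))^-1)%R.
have E w : (w1 w * f w * (w2 (psub z w) * g (psub z w)) * ((w1 w)^-1 * (w2 (psub z w))^-1) = f w * g (psub z w))%R.
  by field; rewrite !gt_eqF.
under eq_integral do rewrite E.
have minv (u : plane -> R) : measurable_fun [set: plane] u -> (forall z, 0 < u z)%R -> measurable_fun [set: plane] (fun z => (u z)^-1)%R.
  move=> mu u0; under eq_fun => t do rewrite -powR_inv1 ?ltW//.
  exact: (measurableT_comp (@measurable_powR R (-1)%R) mu).
have hm1 : measurable_fun setT (fun w => w1 w * f w * (w2 (psub z w) * g (psub z w)))%R.
  apply: measurable_funM; first exact: measurable_funM.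
  by apply: measurable_funM; [exact: (measurableT_comp mw2 mpsub)|exact: (measurableT_comp mg mpsub)].
have hm2 : measurable_fun setT (fun w => (w1 w)^-1 * (w2 (psub z w))^-1)%R.
  apply: measurable_funM; first exact: minv.
  exact: (measurableT_comp (minv _ mw2 w20) mpsub).
move=> /(_ hm1 hm2) h.
have {}h : \int[leb2]_w (f w * g (psub z w))%:E * \int[leb2]_w (f w * g (psub z w))%:E <=
    (\int[leb2]_w (F w * G (psub z w))%:E) * \int[leb2]_w (((w1 w)^-1 * (w2 (psub z w))^-1) ^+ 2)%:E.
  apply: (le_trans (h _ _)).
  - by move=> w; rewrite !mulr_ge0// ltW.
  - by move=> w; rewrite mulr_ge0// invr_ge0 ltW.
  - by under eq_integral do rewrite exprMn.
apply: (le_trans (lee_wpmul2l _ h)); first by rewrite lee_fin.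
rewrite muleCA [leRHS]muleC; apply: lee_wpmul2l => //.
rewrite -ge0_integralZl_EFin//; first exact: hC.
- by move=> w _; rewrite lee_fin sqr_ge0.
- by apply/measurable_EFinP; apply: measurable_funX.
Qed.
End PlaneConv.

(** * Continuity of translations in L^2 *)

Section Vanish.
Context {R : realType}.
Local Open Scope ereal_scope.
Implicit Types D : nat -> \bar R.

(** Convergence to 0 of nonnegative extended reals, in an upper-bound form that
    can be checked without proving the terms finite. *)
Definition vanish D := forall e : R, (0 < e)%R -> \forall n \near \oo, D n <= e%:E.

Lemma vanish_le D D' : (forall n, D n <= D' n) -> vanish D' -> vanish D.
Proof.
move=> DD' h e e0; have := h e e0; apply: filterS => n; exact: le_trans.
Qed.

(** The density argument: up to any error, D is bounded by something that
    vanishes. *)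
Lemma vanish_approx D : (forall e : R, (0 < e)%R ->
  exists2 D', vanish D' & forall n, D n <= D' n + e%:E) -> vanish D.
Proof.
move=> h e e0; have e20 : (0 < e / 2)%R by rewrite divr_gt0.
have [D' vD' DD'] := h _ e20; have := vD' _ e20; apply: filterS => n hn.
by apply: (le_trans (DD' n)); rewrite [X in _ <= X%:E]splitr EFinD; apply: leeD.
Qed.

Lemma vanishD D D' : vanish D -> vanish D' -> vanish (fun n => D n + D' n).
Proof.
move=> h h' e e0; have e20 : (0 < e / 2)%R by rewrite divr_gt0.
have H := h _ e20; have H' := h' _ e20.
near=> n; rewrite [X in _ <= X%:E]splitr EFinD; apply: leeD; near: n; [exact: H|exact: H'].
Unshelve. all: end_near. Qed.

Lemma vanishZ (c : R) D : (0 <= c)%R -> vanish D -> vanish (fun n => c%:E * D n).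
Proof.
move=> c0 h e e0; have c10 : (0 < c + 1)%R by rewrite ltr_wpDl.
have := h (e / (c + 1))%R (divr_gt0 e0 c10); apply: filterS => n hn.
apply: (le_trans (lee_wpmul2l _ hn)); first by rewrite lee_fin.
by rewrite -EFinM lee_fin mulrCA ler_piMr ?(ltW e0)// ler_pdivrMr// mul1r lerDl.
Qed.

Lemma vanish0 : vanish (fun=> 0).
Proof. by move=> e e0; apply: nearW => n; rewrite lee_fin ltW. Qed.

Lemma cvg_vanish D : D @ \oo --> 0 -> vanish D.
Proof.
move=> /fine_cvgP[fD /cvgrPdist_le cD] e e0.
apply: filterS2 fD (cD _ e0) => n fn; rewrite sub0r normrN => h.
by rewrite -(fineK fn) lee_fin; exact: le_trans (ler_norm _) h.
Qed.

Lemma vanish_sum (I : Type) (s : seq I) (D : I -> nat -> \bar R) :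
  (forall i, vanish (D i)) -> vanish (fun n => \sum_(i <- s) D i n).
Proof.
move=> h; elim: s => [|i s IH]; first by under eq_fun do rewrite big_nil; exact: vanish0.
by under eq_fun do rewrite big_cons; apply: vanishD.
Qed.
End Vanish.

Section DynkinTranslation.
Context d (T : measurableType d) (R : realType) (mu : {measure set T -> \bar R}).
Local Open Scope ereal_scope.
Variables (tau : nat -> T -> T) (B : R -> set T) (L : R).
Hypothesis mtau : forall n, measurable_fun setT (tau n).
Hypothesis ptau : forall n A, measurable A -> mu (tau n @^-1` A) = mu A.
Hypothesis mB : forall r, measurable (B r).
Hypothesis fB : forall r, mu (B r) < +oo.
Hypothesis tauB : forall n r x, B r x -> B (r + L) (tau n x).

(** The window B r makes the measures involved finite whatever A is, as the
    passage to countable unions requires. *)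
Definition shiftdist (n : nat) (r : R) (A : set T) : \bar R :=
  \int[mu]_(x in B r) (`|\1_A (tau n x) - \1_A x|%R)%:E.
Definition shiftcont (A : set T) := forall r, vanish (fun n => shiftdist n r A).

Let mind (A : set T) n : measurable A -> measurable_fun setT (fun x => \1_A (tau n x) : R).
Proof. by move=> mA; apply: (measurableT_comp _ (mtau n)); exact: measurable_indic. Qed.

Let mdist (A : set T) n D : measurable A -> measurable_fun D (fun x => (`|\1_A (tau n x) - \1_A x : R|%R)%:E).
Proof.
move=> mA; apply: measurable_funTS; apply/measurable_EFinP; apply: measurableT_comp => //.
by apply: measurable_funB; [exact: mind|exact: measurable_indic].
Qed.

Lemma shiftcontC A : shiftcont A -> shiftcont (~` A).
Proof.
move=> h r; apply: vanish_le (h r) => n; rewrite /shiftdist.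
rewrite le_eqVlt; apply/orP; left; apply/eqP; apply: eq_integral => x _; congr _%:E.
have E y : (\1_(~` A) y = 1 - \1_A y :> R)%R.
  by rewrite !indicE in_setC; case: (y \in A); rewrite ?subrr ?subr0.
by rewrite !E distrC; congr (`| _ |)%R; ring.
Qed.

(** The tail of a disjoint union has small measure in the window of radius r and,
    since the maps preserve the measure and enlarge windows by at most L, so has
    its preimage; the finitely many remaining sets are handled one by one. *)
Lemma shiftcont_bigcup (F : (set T)^nat) : (forall n, measurable (F n)) ->
  trivIset [set: nat] F -> (forall n, shiftcont (F n)) -> shiftcont (\bigcup_k F k).
Proof.
move=> mF tF hF r.
pose U := \bigcup_k F k.
have mU : measurable U by exact: bigcup_measurable.
pose Tl m := \bigcup_(k >= m) F k.
have mTl m : measurable (Tl m) by exact: bigcup_measurable.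
have small rho : vanish (fun m => mu (Tl m `&` B rho)).
  apply: cvg_vanish.
  have -> : 0 = mu (\bigcap_m (Tl m `&` B rho)).
    rewrite (_ : \bigcap_m _ = set0) ?measure0//; apply/seteqP; split => // x Tx.
    have [[k _ Fkx] _] := Tx 0%N I.
    have [[l kl Flx] _] := Tx k.+1 I.
    have /trivIsetP/(_ k l I I) := tF; rewrite neq_ltn kl => /(_ isT).
    by move=> /seteqP[/(_ x)] /(_ (conj Fkx Flx)).
  apply: nonincreasing_cvg_mu.
  - apply: (le_lt_trans _ (fB rho)); apply: le_measure; rewrite ?inE//; first exact: measurableI.
  - by move=> m; exact: measurableI.
  - by apply: bigcap_measurable => // m _; exact: measurableI.
  - move=> m p mp; apply/subsetPset => x [[k pk Fk] Bx]; split=> //; exists k => //=.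
    exact: leq_trans mp pk.
apply: vanish_approx => e e0.
have e20 : (0 < e / 2)%R by rewrite divr_gt0.
have [m [h1 h2]] : exists m, mu (Tl m `&` B (r + L)) <= (e / 2)%:E /\ mu (Tl m `&` B r) <= (e / 2)%:E.
  by near \oo => m; exists m; split; near: m; exact: small.
exists (fun n => \sum_(k <- iota 0 m) shiftdist n r (F k)).
  by apply: vanish_sum => k; exact: hF.
move=> n.
have mi (A : set T) : measurable A -> measurable_fun (B r) (fun x => (\1_A x : R)%:E).
  by move=> mA; apply: measurable_funTS; apply/measurable_EFinP; exact: measurable_indic.
have mt (A : set T) : measurable A -> measurable (tau n @^-1` A).
  by move=> mA; rewrite -[X in measurable X]setTI; exact: mtau.
have i1 (A : set T) x : A x -> \1_A x = 1%R :> R by move=> Ax; rewrite indicE mem_set.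
have i0 (A : set T) x : ~ A x -> \1_A x = 0%R :> R by move=> Ax; rewrite indicE memNset.
pose S x : \bar R := \sum_(k <- iota 0 m) (`|\1_(F k) (tau n x) - \1_(F k) x|%R)%:E.
have S0 x : 0 <= S x by apply: sume_ge0 => k _; rewrite lee_fin.
have mS : measurable_fun (B r) S by apply: emeasurable_sum => k; exact: mdist.
apply: (@le_trans _ _ (\int[mu]_(x in B r) (S x + ((\1_(tau n @^-1` Tl m) x : R)%:E + (\1_(Tl m) x : R)%:E)))).
  apply: ge0_le_integral => //.
  - exact: mdist.
  - by apply: emeasurable_funD => //; apply: emeasurable_funD; apply: mi => //; exact: mt.
  move=> x _.
  have key y z : U y -> ~ U z -> 1 <= \sum_(k <- iota 0 m) (`|\1_(F k) y - \1_(F k) z|%R)%:E + (\1_(Tl m) y : R)%:E.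
    move=> [k _ Fky] nUz; have [km|mk] := ltnP k m.
      rewrite (bigD1_seq k) ?mem_iota ?iota_uniq//= -addeA.
      rewrite (i1 _ _ Fky) (i0 (F k) z); last by move=> Fkz; apply: nUz; exists k.
      rewrite subr0 normr1 leeDl// adde_ge0 ?lee_fin//.
      by apply: sume_ge0 => j _; rewrite lee_fin.
    rewrite (i1 (Tl m) y); last by exists k.
    by rewrite leeDr// sume_ge0// => j _; rewrite lee_fin.
  have [Ut|nUt] := pselect (U (tau n x)); have [Ux|nUx] := pselect (U x).
  - rewrite (i1 U _ Ut) (i1 U _ Ux) subrr normr0 !adde_ge0// lee_fin//.
  - rewrite (i1 U _ Ut) (i0 U _ nUx) subr0 normr1.
    apply: (le_trans (key _ _ Ut nUx)); rewrite -/(S x); apply: leeD => //.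
    by rewrite leeDl// lee_fin.
  - rewrite (i0 U _ nUt) (i1 U _ Ux) sub0r normrN normr1.
    apply: (le_trans (key _ _ Ux nUt)); apply: leeD.
      by rewrite le_eqVlt; apply/orP; left; apply/eqP; apply: eq_bigr => k _; rewrite distrC.
    by rewrite leeDr// lee_fin.
  - rewrite (i0 U _ nUt) (i0 U _ nUx) subrr normr0 !adde_ge0// lee_fin//.
rewrite ge0_integralD//; last first.
  by apply: emeasurable_funD; apply: mi => //; exact: mt.
  by move=> x _; rewrite adde_ge0// lee_fin.
apply: leeD.
  by rewrite ge0_integral_sum// => k; exact: mdist.
rewrite ge0_integralD//; last 2 first.
- by apply: mi; exact: mt.
- exact: mi.
rewrite [leRHS](_ : _ = (e / 2)%:E + (e / 2)%:E); last by rewrite -EFinD -splitr.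
rewrite !integral_indic//; last exact: mt.
apply: leeD => //; apply: le_trans h1.
have mTB : measurable (Tl m `&` B (r + L)) by apply: measurableI; [exact: mTl|exact: mB].
rewrite -(ptau n mTB).
apply: le_measure; rewrite ?inE.
- by apply: measurableI; [exact: mt|exact: mB].
- exact: mt.
- by move=> x [Tx Bx]; split => //; exact: tauB.
Unshelve. all: end_near. Qed.

Lemma shiftcont_dynkin (G : set (set T)) : @measurable _ T = <<s G >> -> setI_closed G ->
  (forall A, G A -> shiftcont A) -> forall A, measurable A -> shiftcont A.
Proof.
move=> GE GI hG A mA.
apply: (dynkin_induction GE GI) => //.
- move=> r; apply: vanish_le vanish0 => n; rewrite /shiftdist integral0_eq// => x _.
  by rewrite !indicT subrr normr0.
- by move=> S mS; exact: shiftcontC.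
- exact: shiftcont_bigcup.
- by rewrite -GE.
Qed.
End DynkinTranslation.

Section TranslationContinuity.
Context {R : realType}.
Local Open Scope ereal_scope.
Local Notation leb := (@lebesgue_measure R).
Local Notation leb2 := (leb \x leb).
Local Notation line := (measurableTypeR R).
Local Notation plane := (measurableTypeR R * measurableTypeR R)%type.

Lemma integral_indicator d (T : measurableType d) (mu : {measure set T -> \bar R})
    (D : set T) (f : T -> R) : measurable D ->
  \int[mu]_(x in D) (f x)%:E = \int[mu]_x (f x * \1_D x)%:E.
Proof.
move=> mD; rewrite integral_mkcond; apply: eq_integral => x _.
by rewrite patchE indicE; case: (x \in D); rewrite ?mulr1 ?mulr0.
Qed.

Definition seg (r : R) : set line := `[(- r)%R, r]%classic.

Lemma measurable_seg r : measurable (seg r). Proof. exact: measurable_itv. Qed.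
Lemma seg_fin r : leb (seg r) < +oo.
Proof. by rewrite /seg lebesgue_measure_itv/=; case: ifP => _; rewrite -?EFinB ltry. Qed.

Section ShiftLine.
Variables (u : nat -> R) (L : R).
Hypothesis uL : forall n, (`|u n| <= L)%R.
Hypothesis u0 : u @ \oo --> (0 : R)%R.

Let tau n : line -> line := affine1 1 (- u n).

(** It is enough to treat intervals: only points within |u n| of an endpoint are
    moved across it. *)
Lemma shiftcont_line (A : set line) : measurable A -> shiftcont leb tau seg A.
Proof.
apply: (@shiftcont_dynkin _ _ _ leb tau seg L _ _ _ _ _ (@ocitv R)).
- by move=> n; exact: measurable_affine1.
- move=> n X mX; have := lebesgue_affine1 (- u n)%R (oner_neq0 R) mX.
  by rewrite normr1 invr1 mul1e.
- exact: measurable_seg.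
- exact: seg_fin.
- move=> n r x; rewrite /seg /= !in_itv/= /tau /affine1 mul1r => /andP[h1 h2].
  have := uL n; rewrite ler_norml => /andP[h3 h4]; apply/andP; split; lra.
- by [].
- exact: ocitvI.
move=> _ [[a b] _ <-] r.
pose D n : set line := `[(a - `|u n|)%R, (a + `|u n|)%R]%classic.
pose E n : set line := `[(b - `|u n|)%R, (b + `|u n|)%R]%classic.
have mD n : measurable (D n) by exact: measurable_itv.
have mE n : measurable (E n) by exact: measurable_itv.
have mI : measurable (`]a, b]%classic : set line) by exact: measurable_itv.
have lam (c : R) n : leb (`[(c - `|u n|)%R, (c + `|u n|)%R]%classic) <= (2 * `|u n|)%:E.
  rewrite lebesgue_measure_itv/=; case: ifP => _; last by rewrite lee_fin mulr_ge0.
  by rewrite -EFinB lee_fin; lra.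
apply: (@vanish_le _ _ (fun n => (4 * `|u n|)%:E)).
  move=> n; apply: (@le_trans _ _ (leb (D n) + leb (E n))); last first.
    rewrite (_ : 4 * _ = 2 * `|u n| + 2 * `|u n|)%R; last by ring.
    by rewrite EFinD; apply: leeD; exact: lam.
  rewrite /shiftdist integral_indicator; last exact: measurable_seg.
  rewrite -[D n]setIT -[E n]setIT -!integral_indic//.
  rewrite -ge0_integralD//; do ?by [apply/measurable_EFinP; exact: measurable_indic].
  apply: ge0_le_integral => //.
  - apply/measurable_EFinP; apply: measurable_funM; last first.
      by apply: measurable_indic; exact: measurable_seg.
    apply: measurableT_comp => //; apply: measurable_funB; last exact: measurable_indic.
    by apply: (measurableT_comp _ (measurable_affine1 1 (- u n)%R)); exact: measurable_indic.
  - by apply: emeasurable_funD; apply/measurable_EFinP; exact: measurable_indic.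
  move=> x _; rewrite -EFinD lee_fin.
  apply: (@le_trans _ _ (`|\1_(`]a, b]%classic : set line) (tau n x) - \1_(`]a, b]%classic : set line) x|)%R).
    by rewrite ler_piMr// indicE; case: (_ \in _).
  have le1 : (`|\1_(`]a, b]%classic : set line) (tau n x) - \1_(`]a, b]%classic : set line) x : R| <= 1)%R.
    by rewrite !indicE; case: (_ \in _); case: (_ \in _); rewrite ?subrr ?subr0 ?sub0r ?normrN ?normr1 ?normr0.
  have tE : tau n x = (x - u n)%R by rewrite /tau /affine1 mul1r.
  have [Dx|nDx] := pselect (D n x).
    by rewrite [\1_(D n) x]indicE mem_set//; apply: (le_trans le1); rewrite lerDl.
  have [Ex|nEx] := pselect (E n x).
    by rewrite [\1_(E n) x]indicE mem_set//; apply: (le_trans le1); rewrite lerDr.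
  have ux := ler_norm (u n); have ux' := ler_norm (- u n)%R; rewrite normrN in ux'.
  have pa : (a < tau n x)%R = (a < x)%R.
    rewrite tE; apply/idP/idP => h; apply: contra_notT nDx; rewrite -leNgt => h'.
      by rewrite /D /= in_itv/=; apply/andP; split; lra.
    by rewrite /D /= in_itv/=; apply/andP; split; lra.
  have qb : (tau n x <= b)%R = (x <= b)%R.
    rewrite tE; apply/idP/idP => h; apply: contra_notT nEx; rewrite -ltNge => h'.
      by rewrite /E /= in_itv/=; apply/andP; split; lra.
    by rewrite /E /= in_itv/=; apply/andP; split; lra.
  have -> : \1_(`]a, b]%classic : set line) (tau n x) = \1_(`]a, b]%classic : set line) x :> R.
    rewrite !indicE; congr (_%:R); congr nat_of_bool.
    by apply/idP/idP; rewrite !inE /= !in_itv/= pa qb.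
  by rewrite subrr normr0 addr_ge0.
move=> e e0; have e4 : (0 < e / 4)%R by rewrite divr_gt0.
move/cvgrPdist_le : u0 => /(_ _ e4); apply: filterS => n; rewrite sub0r normrN lee_fin => h.
by rewrite mulrC -ler_pdivlMr.
Qed.
End ShiftLine.

Lemma plane_tensor (f g : line -> R) : measurable_fun setT f -> measurable_fun setT g ->
  (forall x, 0 <= f x)%R -> (forall x, 0 <= g x)%R ->
  \int[leb2]_z (f z.1 * g z.2)%:E = (\int[leb]_x (f x)%:E) * (\int[leb]_x (g x)%:E).
Proof.
move=> mf mg f0 g0.
rewrite (@plane_integral12 R (fun x y => (f x * g y)%:E)).
- transitivity (\int[leb]_x ((f x)%:E * \int[leb]_y (g y)%:E)).
    apply: eq_integral => x _; under eq_integral do rewrite EFinM.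
    rewrite ge0_integralZl_EFin//; do ?[exact/measurable_EFinP|by move=> y _; rewrite lee_fin].
  rewrite ge0_integralZr//; do ?[exact/measurable_EFinP|by move=> y _; rewrite lee_fin].
  by apply: integral_ge0 => y _; rewrite lee_fin.
- apply/measurable_EFinP; apply: measurable_funM.
    exact: (measurableT_comp mf measurable_fst).
  exact: (measurableT_comp mg measurable_snd).
- by move=> x y; rewrite lee_fin mulr_ge0.
Qed.

Section ShiftPlane.
Variables (u : nat -> R * R) (L : R).
Hypothesis uL : forall n, (`|(u n).1| <= L)%R /\ (`|(u n).2| <= L)%R.
Hypothesis u10 : (fun n => (u n).1) @ \oo --> (0 : R)%R.
Hypothesis u20 : (fun n => (u n).2) @ \oo --> (0 : R)%R.

Definition box (r : R) : set plane := seg r `*` seg r.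
Lemma measurable_box r : measurable (box r).
Proof. by apply: measurableX; exact: measurable_seg. Qed.
Lemma box_fin r : leb2 (box r) < +oo.
Proof.
rewrite /box product_measure1E; [|exact: measurable_seg|exact: measurable_seg].
by apply: lte_mul_pinfty; [exact: measure_ge0| |exact: seg_fin]; rewrite ge0_fin_numE//; exact: seg_fin.
Qed.

Let tau n : plane -> plane := fun z => psub z (u n).

(** It is enough to treat rectangles, where the difference of indicator functions
    is telescoped in the two variables. *)
Lemma shiftcont_plane (A : set plane) : measurable A -> shiftcont leb2 tau box A.
Proof.
apply: (@shiftcont_dynkin _ _ _ leb2 tau box L _ _ _ _ _
  [set X `*` Y | X in (measurable : set (set line)) & Y in (measurable : set (set line))]).
- by move=> n; exact: measurable_psub2.
- move=> n X mX.
  rewrite (_ : tau n @^-1` X = affine2 1 (- (u n).1, - (u n).2)%R @^-1` X); last first.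
    by apply/seteqP; split => z; rewrite /tau /= psub_transl.
  by have := lebesgue_affine2 (- (u n).1, - (u n).2)%R (oner_neq0 R) mX; rewrite normr1 expr1n invr1 mul1e.
- exact: measurable_box.
- exact: box_fin.
- move=> n r z; rewrite /box /seg /= !in_itv/= => -[/andP[h1 h2] /andP[h3 h4]].
  have [] := uL n; rewrite !ler_norml => /andP[h5 h6] /andP[h7 h8]; split; apply/andP; split; lra.
- exact: measurable_prod_measurableType.
- move=> _ _ [X1 mX1 [Y1 mY1 <-]] [X2 mX2 [Y2 mY2 <-]].
  exists (X1 `&` X2); first exact: measurableI.
  by exists (Y1 `&` Y2); [exact: measurableI|rewrite setXI].
move=> _ [X mX [Y mY <-]] r.
have hX := @shiftcont_line (fun n => (u n).1) L (fun n => (uL n).1) u10 X mX r.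
have hY := @shiftcont_line (fun n => (u n).2) L (fun n => (uL n).2) u20 Y mY r.
have sr : leb (seg r) \is a fin_num by rewrite ge0_fin_numE//; exact: seg_fin.
pose c := fine (leb (seg r)).
have c0 : (0 <= c)%R by rewrite fine_ge0.
apply: vanish_le (vanishD (vanishZ c0 hX) (vanishZ c0 hY)) => n.
pose a (v : R) (Z : set line) (x : line) : R := (`|\1_Z (affine1 1 (- v) x) - \1_Z x| * \1_(seg r) x)%R.
pose sg (x : line) : R := \1_(seg r) x.
have sg0 x : (0 <= sg x)%R by rewrite /sg indicE.
have msg : measurable_fun [set: line] sg by apply: measurable_indic; exact: measurable_seg.
have a0 v Z x : (0 <= a v Z x)%R by rewrite mulr_ge0.
have ma v (Z : set line) : measurable Z -> measurable_fun [set: line] (a v Z).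
  move=> mZ; apply: measurable_funM => //; apply: measurableT_comp => //.
  apply: measurable_funB; last exact: measurable_indic.
  by apply: (measurableT_comp _ (measurable_affine1 1 (- v)%R)); exact: measurable_indic.
have isg : \int[leb]_x (sg x)%:E = c%:E.
  by rewrite /sg integral_indic ?setIT ?fineK//; exact: measurable_seg.
have EX : shiftdist leb (fun m => affine1 1 (- (u m).1)%R) seg n r X = \int[leb]_x (a (u n).1 X x)%:E.
  by rewrite /shiftdist integral_indicator//; exact: measurable_seg.
have EY : shiftdist leb (fun m => affine1 1 (- (u m).2)%R) seg n r Y = \int[leb]_x (a (u n).2 Y x)%:E.
  by rewrite /shiftdist integral_indicator//; exact: measurable_seg.
rewrite EX EY -isg [X in _ <= X + _]muleC -!plane_tensor//; try exact: ma.
have mt1 : measurable_fun [set: plane] (fun z : plane => (a (u n).1 X z.1 * sg z.2)%:E).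
  apply/measurable_EFinP; apply: measurable_funM.
    exact: (measurableT_comp (ma _ _ mX) measurable_fst).
  exact: (measurableT_comp msg measurable_snd).
have mt2 : measurable_fun [set: plane] (fun z : plane => (sg z.1 * a (u n).2 Y z.2)%:E).
  apply/measurable_EFinP; apply: measurable_funM.
    exact: (measurableT_comp msg measurable_fst).
  exact: (measurableT_comp (ma _ _ mY) measurable_snd).
have t10 (z : plane) : 0 <= (a (u n).1 X z.1 * sg z.2)%:E by rewrite lee_fin mulr_ge0.
have t20 (z : plane) : 0 <= (sg z.1 * a (u n).2 Y z.2)%:E by rewrite lee_fin mulr_ge0.
have mXY : measurable (X `*` Y) by exact: measurableX.
rewrite -ge0_integralD// /shiftdist integral_indicator; last exact: measurable_box.
apply: ge0_le_integral => //.
- apply/measurable_EFinP; apply: measurable_funM; last by apply: measurable_indic; exact: measurable_box.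
  apply: measurableT_comp => //; apply: measurable_funB; last exact: measurable_indic.
  by apply: (measurableT_comp _ (measurable_psub2 (u n))); exact: measurable_indic.
- exact: emeasurable_funD.
move=> z _; rewrite -EFinD lee_fin.
have iX (A1 A2 : set line) (w : plane) : \1_(A1 `*` A2) w = (\1_A1 w.1 * \1_A2 w.2)%R :> R.
  by rewrite !indicE in_setX; case: (_ \in _); case: (_ \in _); rewrite ?mulr1 ?mulr0.
rewrite /box !iX /a -/(sg z.1) -/(sg z.2) /tau /psub /affine1 /= !mul1r.
set p := \1_X (z.1 - _)%R; set p' := \1_X z.1; set q := \1_Y (z.2 - _)%R; set q' := \1_Y z.2.
rewrite [leRHS](_ : _ = (`|p - p'| + `|q - q'|) * (sg z.1 * sg z.2))%R; last by ring.
apply: ler_wpM2r; first by rewrite mulr_ge0.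
rewrite (_ : (p * q - p' * q' = (p - p') * q + p' * (q - q'))%R); last by ring.
apply: (le_trans (ler_normD _ _)); rewrite !normrM; apply: lerD.
  by rewrite ler_piMr// /q indicE; case: (_ \in _); rewrite ?normr1 ?normr0.
by rewrite ler_piMl// /p' indicE; case: (_ \in _); rewrite ?normr1 ?normr0.
Qed.
End ShiftPlane.
End TranslationContinuity.

Lemma le_integral_lincomb d (T : measurableType d) (R : realType) (mu : {measure set T -> \bar R})
    (f f1 f2 : T -> R) (c1 c2 : R) :
  measurable_fun setT f -> measurable_fun setT f1 -> measurable_fun setT f2 ->
  (0 <= c1)%R -> (0 <= c2)%R ->
  (forall x, 0 <= f x)%R -> (forall x, 0 <= f1 x)%R -> (forall x, 0 <= f2 x)%R ->
  (forall x, f x <= c1 * f1 x + c2 * f2 x)%R ->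
  (\int[mu]_x (f x)%:E <= c1%:E * (\int[mu]_x (f1 x)%:E) + c2%:E * (\int[mu]_x (f2 x)%:E))%E.
Proof.
move=> /measurable_EFinP mf /measurable_EFinP mf1 /measurable_EFinP mf2 c10 c20 f0 f10 f20 h.
rewrite -(ge0_integralZl_EFin mu measurableT (fun x _ => f10 x : (0 <= (f1 x)%:E)%E) mf1 c10).
rewrite -(ge0_integralZl_EFin mu measurableT (fun x _ => f20 x : (0 <= (f2 x)%:E)%E) mf2 c20).
have m1 : measurable_fun setT (fun x => (c1%:E * (f1 x)%:E)%E) by exact: emeasurable_funM.
have m2 : measurable_fun setT (fun x => (c2%:E * (f2 x)%:E)%E) by exact: emeasurable_funM.
have p1 x : (0 <= c1%:E * (f1 x)%:E)%E by rewrite mule_ge0// lee_fin.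
have p2 x : (0 <= c2%:E * (f2 x)%:E)%E by rewrite mule_ge0// lee_fin.
rewrite -(ge0_integralD mu measurableT (fun x _ => p1 x) m1 (fun x _ => p2 x) m2).
apply: ge0_le_integral => //; do ?[exact: emeasurable_funD]; do ?[by move=> x _; rewrite lee_fin].
Qed.

Section TranslationL2.
Context {R : realType}.
Local Open Scope ereal_scope.
Local Notation leb := (@lebesgue_measure R).
Local Notation leb2 := (leb \x leb).
Local Notation plane := (measurableTypeR R * measurableTypeR R)%type.
Variables (u : nat -> R * R) (L : R).
Hypothesis uL : forall n, (`|(u n).1| <= L)%R /\ (`|(u n).2| <= L)%R.
Hypothesis u10 : (fun n => (u n).1) @ \oo --> (0 : R)%R.
Hypothesis u20 : (fun n => (u n).2) @ \oo --> (0 : R)%R.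

Definition shiftL2 (h : plane -> R) n := \int[leb2]_x ((h (psub x (u n)) - h x) ^+ 2)%:E.

Let mshift (h : plane -> R) n : measurable_fun setT h ->
  measurable_fun setT (fun x => ((h (psub x (u n)) - h x) ^+ 2)%:E).
Proof.
move=> mh; apply/measurable_EFinP; apply: measurable_funX; apply: measurable_funB => //.
exact: (measurableT_comp mh (measurable_psub2 (u n))).
Qed.

(** A bounded function of bounded support: the square of the difference is at
    most its supremum times its absolute value, which is an L^1 quantity
    controlled by indicator functions. *)
Lemma shiftL2_combination (I : Type) (s : seq I) (c : I -> R) (A : I -> set plane) r :
  (forall i, measurable (A i)) -> (forall i, A i `<=` box r) ->
  vanish (shiftL2 (fun x => \sum_(i <- s) c i * \1_(A i) x)%R).
Proof.
move=> mA Ar.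
(* A bound for the simple function t. *)
pose M := (\sum_(i <- s) `|c i|)%R.
have M0 : (0 <= M)%R by exact: sumr_ge0.
pose t x := (\sum_(i <- s) c i * \1_(A i) x)%R.
have mt : measurable_fun setT t.
  by apply: measurable_sum => i; apply: measurable_funM => //; exact: measurable_indic.
have tM x : (`|t x| <= M)%R.
  apply: (le_trans (ler_norm_sum _ _ _)); apply: ler_sum => i _.
  by rewrite normrM ler_piMr// indicE; case: (_ \in _); rewrite ?normr1 ?normr0.
have L0 : (0 <= L)%R by apply: le_trans (uL 0%N).1.
have bLr : box r `<=` box (r + L).
  by move=> z; rewrite /box /seg /= !in_itv/= => -[/andP[h1 h2] /andP[h3 h4]]; split; apply/andP; split; lra.
have tout x : ~ box r x -> t x = 0%R.
  move=> nx; rewrite /t big1// => i _; rewrite indicE memNset ?mulr0// => Ax.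
  by apply: nx; exact: Ar Ax.
have v : vanish (fun n => (2 * M)%:E * \sum_(i <- s) (`|c i|%:E * shiftdist leb2 (fun n z => psub z (u n)) box n (r + L) (A i))).
  apply: vanishZ; first by rewrite mulr_ge0.
  apply: vanish_sum => i; apply: vanishZ => //.
  exact: (@shiftcont_plane R u L uL u10 u20 (A i) (mA i) (r + L)%R).
apply: vanish_le v => n.
have mB := measurable_box (R := R) (r + L)%R.
have md i : measurable_fun [set: plane] (fun x : plane => (`|\1_(A i) (psub x (u n)) - \1_(A i) x| * \1_(box (r + L)) x)%R : R).
  apply: measurable_funM; last exact: measurable_indic.
  apply: measurableT_comp => //; apply: measurable_funB; last exact: measurable_indic.
  by apply: (measurableT_comp _ (measurable_psub2 (u n))); exact: measurable_indic.
pose g i (x : plane) : R := (`|c i| * (`|\1_(A i) (psub x (u n)) - \1_(A i) x| * \1_(box (r + L)) x))%R.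
have g0 i x : (0 <= g i x)%R by rewrite !mulr_ge0.
have mg i : measurable_fun [set: plane] (fun x => (g i x)%:E).
  by apply/measurable_EFinP; apply: measurable_funM.
have mS : measurable_fun [set: plane] (fun x => \sum_(i <- s) (g i x)%:E).
  by apply: emeasurable_sum => i; exact: mg.
have S0 x : 0 <= \sum_(i <- s) (g i x)%:E by apply: sume_ge0 => i _; rewrite lee_fin.
have E : \sum_(i <- s) (`|c i|%:E * shiftdist leb2 (fun n z => psub z (u n)) box n (r + L) (A i)) =
   \int[leb2]_x (\sum_(i <- s) (g i x)%:E).
  rewrite ge0_integral_sum//; do ?[by move=> ? ? _; rewrite lee_fin].
  apply: eq_bigr => i _.
  have -> : shiftdist leb2 (fun n z => psub z (u n)) box n (r + L) (A i) =
      \int[leb2]_x (`|\1_(A i) (psub x (u n)) - \1_(A i) x| * \1_(box (r + L)) x)%:E.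
    by rewrite /shiftdist integral_indicator.
  rewrite -ge0_integralZl_EFin//; do ?[exact/measurable_EFinP].
rewrite E -ge0_integralZl_EFin//; last by rewrite mulr_ge0.
apply: ge0_le_integral => //.
- by move=> x _; rewrite lee_fin sqr_ge0.
- exact: mshift.
- exact: emeasurable_funM.
move=> x _; rewrite sumEFin -EFinM lee_fin -/(t x) -/(t (psub x (u n))).
have [bx|nbx] := pselect (box (r + L)%R x); last first.
  rewrite (tout x); last by move/bLr.
  rewrite tout ?subrr ?expr0n/= ?mulr_ge0 ?sumr_ge0//.
  move=> tx; apply: nbx; move: tx; rewrite /box /seg /psub /= !in_itv/= => -[/andP[h1 h2] /andP[h3 h4]].
  have [] := uL n; rewrite !ler_norml => /andP[h5 h6] /andP[h7 h8]; split; apply/andP; split; lra.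
have h1 : (`|t (psub x (u n)) - t x| <= \sum_(i <- s) g i x)%R.
  rewrite /t -sumrB; apply: (le_trans (ler_norm_sum _ _ _)); apply: ler_sum => i _.
  by rewrite -mulrBr normrM /g [\1_(box _) _]indicE mem_set// mulr1.
have h2 : (`|t (psub x (u n)) - t x| <= 2 * M)%R.
  apply: (le_trans (ler_normB _ _)); have := tM x; have := tM (psub x (u n)); lra.
rewrite -real_normK ?num_real// expr2.
by apply: ler_pM.
Qed.

Let msh (h : plane -> R) n : measurable_fun setT h ->
  measurable_fun setT (fun x => (h (psub x (u n)) - h x) ^+ 2)%R.
Proof. by move=> mh; apply/measurable_EFinP; exact: mshift. Qed.

Lemma shiftL2D (f g : plane -> R) : measurable_fun setT f -> measurable_fun setT g ->
  vanish (shiftL2 f) -> vanish (shiftL2 g) -> vanish (shiftL2 (fun x => f x + g x)%R).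
Proof.
move=> mf mg vf vg.
apply: vanish_le (vanishD (vanishZ (ler0n R 2) vf) (vanishZ (ler0n R 2) vg)) => n.
apply: le_integral_lincomb; do ?[exact: msh|by []|by move=> x; exact: sqr_ge0].
  by apply: (msh (h := fun x => f x + g x)%R); exact: measurable_funD.
move=> x; set a := f _; set b := f _; set c := g _; set e := g _.
have := sqr_ge0 ((a - b) - (c - e)); nra.
Qed.

(** Translations preserve the L^2 norm, so the error h - t contributes the same
    small amount before and after the shift. *)
Lemma shiftL2_approx (h : plane -> R) : measurable_fun setT h ->
  (forall e : R, (0 < e)%R -> exists t : plane -> R, [/\ measurable_fun setT t,
     vanish (shiftL2 t) & \int[leb2]_x ((h x - t x) ^+ 2)%:E <= e%:E]) ->
  vanish (shiftL2 h).
Proof.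
move=> mh happ; apply: vanish_approx => e e0.
have e8 : (0 < e / 8)%R by rewrite divr_gt0.
have [t [mt vt het]] := happ _ e8.
exists (fun n => 2%:E * shiftL2 t n); first exact: vanishZ.
pose k x := (h x - t x)%R.
have mk : measurable_fun setT k by exact: measurable_funB.
move=> n.
have mk2 : measurable_fun setT (fun x => k x ^+ 2)%R by exact: measurable_funX.
have msk : measurable_fun setT (fun x => k (psub x (u n)) ^+ 2)%R.
  by apply: measurable_funX; exact: (measurableT_comp mk (measurable_psub2 (u n))).
have Ek : \int[leb2]_x (k (psub x (u n)) ^+ 2)%:E = \int[leb2]_x (k x ^+ 2)%:E.
  apply: (ge0_integral_psub2 (u n) (f := fun z => (k z ^+ 2)%:E)); first exact/measurable_EFinP.
  by move=> z; rewrite lee_fin sqr_ge0.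
apply: (@le_trans _ _ (2%:E * shiftL2 t n + 2%:E * \int[leb2]_x ((k (psub x (u n)) - k x) ^+ 2)%:E)).
  apply: le_integral_lincomb; do ?[exact: msh|by []|by move=> x; exact: sqr_ge0].
  move=> x; rewrite /k; set a := h _; set b := h _; set c := t _; set e1 := t _.
  have := sqr_ge0 (2 * (c - e1) - (a - b)); nra.
apply: leeD => //.
rewrite (_ : e%:E = 2%:E * (e / 2)%:E); last by rewrite -EFinM; congr _%:E; field.
apply: lee_wpmul2l => //.
apply: (@le_trans _ _ (2%:E * \int[leb2]_x (k (psub x (u n)) ^+ 2)%:E + 2%:E * \int[leb2]_x (k x ^+ 2)%:E)).
  apply: le_integral_lincomb; do ?[exact: msh|by []|by move=> x; exact: sqr_ge0].
  by move=> x; have := sqr_ge0 (k (psub x (u n)) + k x); nra.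
rewrite Ek (_ : (e / 2)%:E = 2%:E * (e / 8)%:E + 2%:E * (e / 8)%:E); last first.
  by rewrite -!EFinM -EFinD; congr _%:E; field.
by apply: leeD; apply: lee_wpmul2l.
Qed.

Import HBNNSimple.

(** Approximation in L^2 by simple functions cut off to large squares. *)
Let shiftL2_ge0fun (h : plane -> R) : measurable_fun setT h -> (forall x, 0 <= h x)%R ->
  \int[leb2]_x (h x ^+ 2)%:E < +oo -> vanish (shiftL2 h).
Proof.
move=> mh h0 hfin; apply: shiftL2_approx => // e e0.
have mf : measurable_fun setT (EFin \o h) by exact/measurable_EFinP.
pose s := nnsfun_approx measurableT mf.
have cs x : (fun k => s k x) @ \oo --> h x.
  have := @cvg_nnsfun_approx _ _ _ _ measurableT _ mf (fun x _ => h0 x) x I.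
  by move/fine_cvg; exact.
have sh k x : (s k x <= h x)%R.
  have <- := cvg_lim (@Rhausdorff R) (cs x).
  apply: (nondecreasing_cvgn_le _ _ k) => [m n mn|]; last by apply/cvg_ex; exists (h x).
  by have /lefP := nd_nnsfun_approx measurableT mf mn; exact.
pose t k x := (s k x * \1_(box k%:R) x)%R.
have mt k : measurable_fun setT (t k).
  by apply: measurable_funM => //; apply: measurable_indic; exact: measurable_box.
have t0 k x : (0 <= t k x)%R by rewrite mulr_ge0.
have th k x : (t k x <= h x)%R.
  apply: le_trans (sh k x); rewrite ler_piMr// indicE; case: (_ \in _) => //.
have ct x : (fun k => t k x) @ \oo --> h x.
  rewrite -[h x]mulr1; apply: cvgM; first exact: cs.
  apply: cvg_near_cst; near=> k.
  rewrite indicE mem_set// /box /seg /= !in_itv/= -!ler_norml; split.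
    by near: k; apply: nbhs_infty_ger; exact: num_real.
  by near: k; apply: nbhs_infty_ger; exact: num_real.
have mh2 : measurable_fun setT (fun x => (h x ^+ 2)%:E) by apply/measurable_EFinP; exact: measurable_funX.
have [|||||_ _ lim] := @dominated_convergence _ _ _ leb2 setT measurableT
     (fun k x => ((h x - t k x) ^+ 2)%:E) (fun=> 0) (fun x => (h x ^+ 2)%:E).
- by move=> k; apply/measurable_EFinP; apply: measurable_funX; exact: measurable_funB.
- by [].
- apply: aeW => x _; apply: cvg_EFin; first exact: nearW.
  rewrite (_ : (0 : R) = (h x - h x) ^+ 2)%R; last by rewrite subrr expr0n.
  by apply: cvgM; apply: cvgB => //; exact: cvg_cst.
- apply/integrableP; split => //.
  by under eq_integral do rewrite gee0_abs ?lee_fin ?sqr_ge0//.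
- apply: aeW => x k _; rewrite /= lee_fin ger0_norm ?sqr_ge0//.
  by have := th k x; have := t0 k x; move=> a b; rewrite lerXn2r ?nnegrE//; lra.
rewrite integral0 in lim.
have [k hk] : exists k, \int[leb2]_x ((h x - t k x) ^+ 2)%:E <= e%:E.
  by near \oo => k; exists k; near: k; exact: (cvg_vanish lim).
exists (t k); split => //.
have fr : finite_set (range (s k)) by [].
rewrite (_ : t k = fun x => \sum_(y <- finmap.enum_fset (fset_set (range (s k)))) (y * \1_((s k @^-1` [set y]) `&` box k%:R) x))%R.
  apply: (@shiftL2_combination _ _ (fun y => y) (fun y => (s k @^-1` [set y]) `&` box k%:R) k%:R).
    by move=> y; apply: measurableI => //; exact: measurable_box.
  by move=> y; exact: subIsetr.
apply/funext => x; rewrite /t fimfunE fsbig_finite//= mulr_suml.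
by apply: eq_bigr => y _; rewrite indicI /= mulrA.
Unshelve. all: end_near. Qed.

Lemma translation_L2 (h : plane -> R) : measurable_fun setT h ->
  \int[leb2]_x (h x ^+ 2)%:E < +oo -> vanish (shiftL2 h).
Proof.
move=> mh hfin.
have mp : measurable_fun setT (h^\+)%R by exact: measurable_funrpos.
have mn : measurable_fun setT (h^\-)%R by exact: measurable_funrneg.
have fin (g : plane -> R) : measurable_fun setT g -> (forall x, 0 <= g x)%R ->
    (forall x, g x <= `|h x|)%R -> \int[leb2]_x (g x ^+ 2)%:E < +oo.
  move=> mg g0 gh; apply: le_lt_trans hfin; apply: ge0_le_integral => //.
  - by move=> x _; rewrite lee_fin sqr_ge0.
  - by apply/measurable_EFinP; exact: measurable_funX.
  - by apply/measurable_EFinP; exact: measurable_funX.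
  - by move=> x _; rewrite lee_fin -[leRHS]real_normK ?num_real// lerXn2r ?nnegrE.
have vp : vanish (shiftL2 (h^\+)%R).
  apply: shiftL2_ge0fun => //; do ?[by move=> x; exact: funrpos_ge0].
  apply: fin => //; do ?[by move=> x; exact: funrpos_ge0].
  by move=> x; rewrite /funrpos ge_max ler_norm normr_ge0.
have vn : vanish (shiftL2 (h^\-)%R).
  apply: shiftL2_ge0fun => //; do ?[by move=> x; exact: funrneg_ge0].
  apply: fin => //; do ?[by move=> x; exact: funrneg_ge0].
  by move=> x; rewrite /funrneg ge_max -normrN ler_norm normr_ge0.
have vnn : vanish (shiftL2 (fun x => - (h^\- x))%R).
  apply: vanish_le vn => n; rewrite le_eqVlt; apply/orP; left; apply/eqP.
  by apply: eq_integral => x _; rewrite -sqrrN opprB opprK addrC.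
rewrite (_ : h = fun x => h^\+ x + - h^\- x)%R; first by apply: shiftL2D => //; exact: measurableT_comp.
by apply/funext => x; rewrite /funrpos /funrneg; case: (leP (h x) 0%R); case: (leP (- h x)%R 0%R) => *; lra.
Qed.

End TranslationL2.

(** * Square-integrable complex functions *)

Section SquareIntegrable.
Context {R : realType}.
Local Open Scope complex_scope.
Local Notation normc := (@ComplexField.Normc.normc R).
Local Notation leb := (@lebesgue_measure R).
Local Notation leb2 := (leb \x leb)%E.
Local Notation plane := (measurableTypeR R * measurableTypeR R)%type.
Implicit Types f g h : plane -> R[i].

Definition sqint f : \bar R := (\int[leb2]_z (normc (f z) ^+ 2)%:E)%E.
Definition cL2 f := cmeas f /\ (sqint f < +oo)%E.

Lemma sqint_ge0 f : (0 <= sqint f)%E.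
Proof. by apply: integral_ge0 => z _; rewrite lee_fin sqr_ge0. Qed.

Lemma sqint_fin f : cL2 f -> sqint f \is a fin_num.
Proof. by move=> [_ h]; rewrite ge0_fin_numE// sqint_ge0. Qed.

Lemma measurable_normc2 f : cmeas f -> measurable_fun setT (fun z => normc (f z) ^+ 2).
Proof. by move=> mf; apply: measurable_funX; exact: measurable_normc. Qed.

Lemma normc2_ge0 f z : 0 <= normc (f z) ^+ 2. Proof. exact: sqr_ge0. Qed.

(** The elementary inequality a b <= a^2 + b^2 replaces Cauchy-Schwarz: only the
    finiteness of the integral is needed. *)
Lemma integral_normcM_le f g : cmeas f -> cmeas g ->
  (\int[leb2]_z (normc (f z * g z))%:E <= sqint f + sqint g)%E.
Proof.
move=> mf mg; rewrite -[sqint f]mul1e -[sqint g]mul1e.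
apply: le_integral_lincomb => //; do ?[by move=> x; exact: sqr_ge0].
- by apply: measurable_normc; exact: cmeasM.
- exact: measurable_normc2.
- exact: measurable_normc2.
- by move=> z; exact: normc_ge0.
- move=> z; rewrite normc_mul !mul1r.
  by have := sqr_ge0 (normc (f z) - normc (g z)); have := normc2_ge0 f z; have := normc2_ge0 g z; nra.
Qed.

Lemma cL2M_integrable f g : cL2 f -> cL2 g -> cintegrable (fun z => f z * g z).
Proof.
move=> [mf ff] [mg fg]; apply/cintegrableP; split; first exact: cmeasM.
apply: (le_lt_trans (integral_normcM_le mf mg)); exact: lte_add_pinfty.
Qed.

Lemma sqint_affine2 (a : R) (c : R * R) f : a != 0 -> cmeas f ->
  sqint (fun z => f (affine2 a c z)) = ((`|a| ^- 2)%:E * sqint f)%E.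
Proof.
move=> a0 mf; apply: (ge0_integral_affine2 c (f := fun z => (normc (f z) ^+ 2)%:E) a0).
  by apply/measurable_EFinP; exact: measurable_normc2.
by move=> z; rewrite lee_fin sqr_ge0.
Qed.

Lemma cL2_affine2 (a : R) (c : R * R) f : a != 0 -> cL2 f -> cL2 (fun z => f (affine2 a c z)).
Proof.
move=> a0 [mf ff]; split; first exact: cmeas_comp mf (measurable_affine2 a c).
by rewrite sqint_affine2// lte_mul_pinfty// lee_fin invr_ge0.
Qed.

Lemma cL2_psub1 x f : cL2 f -> cL2 (fun y => f (psub x y)).
Proof.
move=> h; under eq_fun do rewrite psub_refl.
by apply: cL2_affine2 => //; rewrite oppr_eq0 oner_eq0.
Qed.

Lemma sqint_psub2 w f : cmeas f -> sqint (fun y => f (psub y w)) = sqint f.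
Proof.
move=> mf; transitivity (sqint (fun y => f (affine2 1 (- w.1, - w.2) y))).
  by apply: eq_integral => y _; rewrite psub_transl.
by rewrite sqint_affine2 ?oner_eq0// normr1 expr1n invr1 mul1e.
Qed.

Lemma cL2_psub2 w f : cL2 f -> cL2 (fun y => f (psub y w)).
Proof.
move=> [mf ff]; split; first exact: cmeas_comp mf (measurable_psub2 w).
by rewrite sqint_psub2.
Qed.

Lemma cL2_le f g : cmeas f -> cL2 g -> (forall z, normc (f z) <= normc (g z)) -> cL2 f.
Proof.
move=> mf [mg fg] fgle; split=> //; apply: le_lt_trans fg.
apply: ge0_le_integral => //.
- by move=> z _; rewrite lee_fin sqr_ge0.
- by apply/measurable_EFinP; exact: measurable_normc2.
- by apply/measurable_EFinP; exact: measurable_normc2.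
- by move=> z _; rewrite lee_fin lerXn2r ?nnegrE ?normc_ge0.
Qed.

Lemma vanish_ccvg (z_ : nat -> R[i]) l (D : nat -> \bar R) :
  (forall n, ((normc (z_ n - l))%:E <= D n)%E) -> vanish D -> ccvg z_ l.
Proof.
move=> zD vD.
have aux (f : nat -> R) (r : R) : (forall n, `|f n - r| <= normc (z_ n - l)) ->
    (f n @[n --> \oo] --> r)%classic.
  move=> fr; apply/cvgrPdist_le => e e0; have := vD _ e0; apply: filterS => n h.
  by rewrite distrC -lee_fin (le_trans _ h)// (le_trans _ (zD n))// lee_fin.
split; apply: aux => n.
  by rewrite -Re_opp -Re_add ler_Re_normc.
by rewrite -Im_opp -Im_add ler_Im_normc.
Qed.

Section Shift.
Variables (u : nat -> R * R) (L : R).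
Hypothesis uL : forall n, (`|(u n).1| <= L)%R /\ (`|(u n).2| <= L)%R.
Hypothesis u10 : ((fun n => (u n).1) @ \oo --> (0 : R)%R)%classic.
Hypothesis u20 : ((fun n => (u n).2) @ \oo --> (0 : R)%R)%classic.

Lemma ctranslation_L2 h : cL2 h -> vanish (fun n => sqint (fun x => h (psub x (u n)) - h x)).
Proof.
move=> [[mr mi] fh].
have fin (k : plane -> R) : measurable_fun setT k -> (forall z, `|k z| <= normc (h z)) ->
    (\int[leb2]_x (k x ^+ 2)%:E < +oo)%E.
  move=> mk kh; apply: le_lt_trans fh; apply: ge0_le_integral => //.
  - by move=> x _; rewrite lee_fin sqr_ge0.
  - by apply/measurable_EFinP; exact: measurable_funX.
  - by apply/measurable_EFinP; exact: measurable_normc2.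
  - by move=> x _; rewrite lee_fin -[leLHS]real_normK ?num_real// lerXn2r ?nnegrE ?normc_ge0.
have vr := @translation_L2 R u L uL u10 u20 _ mr (fin _ mr (fun z => ler_Re_normc _)).
have vi := @translation_L2 R u L uL u10 u20 _ mi (fin _ mi (fun z => ler_Im_normc _)).
apply: vanish_le (vanishD (vanishZ ler01 vr) (vanishZ ler01 vi)) => n.
have mc : cmeas (fun x => h (psub x (u n)) - h x).
  apply: cmeasD; last exact: cmeasN.
  exact: (cmeas_comp (conj mr mi) (measurable_psub2 (u n))).
apply: le_integral_lincomb => //; do ?[by move=> x; exact: sqr_ge0].
- exact: measurable_normc2.
- by apply: measurable_funX; apply: measurable_funB => //; exact: (measurableT_comp mr (measurable_psub2 (u n))).
- by apply: measurable_funX; apply: measurable_funB => //; exact: (measurableT_comp mi (measurable_psub2 (u n))).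
- by move=> x; rewrite /= sqr_normcE Re_add Im_add Re_opp Im_opp !mul1r.
Qed.

Variable m : nat -> plane -> R.
Hypothesis mm : forall n, measurable_fun setT (m n).
Hypothesis m01 : forall n z, 0 <= m n z <= 1.
Hypothesis m1 : forall z, ((m n z) @[n --> \oo] --> (1 : R))%classic.

(** The product of f m_n and the shifted h differs from f h by terms in which one
    factor is bounded in L^2 and the other tends to 0 in L^2. *)
Lemma weak_shift f h : cL2 f -> cL2 h ->
  ccvg (fun n => cintegral (fun x => f x * (m n x)%:C * h (psub x (u n)))) (cintegral (fun x => f x * h x)).
Proof.
move=> Lf Lh; have [mf ff] := Lf; have [mh fh] := Lh.
have cm n : cmeas (fun x => (m n x)%:C) by exact: cmeas_real.
have Lfm n : cL2 (fun x => f x * (m n x)%:C).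
  apply: (cL2_le _ Lf) => [|z]; first exact: cmeasM.
  rewrite normc_mul normc_real ler_piMr ?normc_ge0//.
  by have /andP[a b] := m01 n z; rewrite ger0_norm.
have Lhu n := cL2_psub2 (u n) Lh.
have vt := ctranslation_L2 Lh.
(* The part of f removed by the cutoff tends to 0 in L^2. *)
pose d n x := f x * (1 - m n x)%:C.
have md n : cmeas (d n).
  by apply: cmeasM => //; apply: cmeas_real; apply: measurable_funB.
have vd : vanish (fun n => sqint (d n)).
  have [|||||_ _ lim] := @dominated_convergence _ _ _ leb2 setT measurableT
     (fun n x => (normc (d n x) ^+ 2)%:E) (fun=> 0%E) (fun x => (normc (f x) ^+ 2)%:E).
  - by move=> n; apply/measurable_EFinP; exact: measurable_normc2.
  - by [].
  - apply: aeW => x _; apply: cvg_EFin; first exact: nearW.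
    rewrite (_ : (0 : R) = (normc (f x) * `|1 - 1|) ^+ 2)%R; last by rewrite subrr normr0 mulr0 expr0n.
    under eq_fun do rewrite /d normc_mul normc_real.
    have h1 : ((normc (f x) * `|1 - m n x|) @[n --> \oo] --> normc (f x) * `|1 - 1|)%classic.
      by apply: cvgM; [exact: cvg_cst|apply: cvg_norm; apply: cvgB; [exact: cvg_cst|exact: m1]].
    exact: (cvgM h1 h1).
  - apply/integrableP; split; first by apply/measurable_EFinP; exact: measurable_normc2.
    by under eq_integral do rewrite gee0_abs ?lee_fin ?sqr_ge0//.
  - apply: aeW => x n _; rewrite /= lee_fin ger0_norm ?sqr_ge0// lerXn2r ?nnegrE ?normc_ge0//.
    rewrite /d normc_mul normc_real ler_piMr ?normc_ge0//.
    by have /andP[a b] := m01 n x; rewrite ler_norml; apply/andP; split; lra.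
  by rewrite integral0 in lim; exact: cvg_vanish lim.
pose D n : \bar R := (2%:E * \int[leb2]_x (normc (f x * (m n x)%:C * h (psub x (u n)) - f x * h x))%:E)%E.
have vD : vanish D.
  pose S := fine (sqint f + sqint h).
  have SE : (sqint f + sqint h)%E = S%:E by rewrite fineK// fin_numD !sqint_fin.
  have S0 : 0 <= S by rewrite fine_ge0// adde_ge0// sqint_ge0.
  apply: vanish_approx => e e0.
  (* The parameter of a b <= la b^2 + a^2 / la: the bounded factor gets the
     small weight la, the vanishing one the large weight 1 / la. *)
  pose la := e / (2 * (S + 1)).
  have la0 : 0 < la by rewrite divr_gt0// mulr_gt0// ltr_wpDl.
  pose B n : \bar R := (sqint (d n) + sqint (fun x => (h (psub x (u n)) - h x)%R))%E.
  exists (fun n => ((2 * la^-1)%:E * B n)%E).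
    by apply: vanishZ; [rewrite mulr_ge0// invr_ge0 ltW|exact: vanishD].
  move=> n.
  have mdh : cmeas (fun x => h (psub x (u n)) - h x).
    by apply: cmeasD; [case: (Lhu n)|exact: cmeasN].
  have mA : measurable_fun setT (fun x => normc (f x) ^+ 2 + normc (h (psub x (u n))) ^+ 2).
    apply: measurable_funD; first exact: measurable_normc2.
    by apply: (measurable_normc2 (f := fun x => h (psub x (u n)))); case: (Lhu n).
  have mB : measurable_fun setT (fun x => normc (d n x) ^+ 2 + normc (h (psub x (u n)) - h x) ^+ 2).
    apply: measurable_funD; first exact: measurable_normc2.
    exact: (measurable_normc2 (f := fun x => h (psub x (u n)) - h x)).
  have addE (p q : plane -> R[i]) : cmeas p -> cmeas q ->
      (\int[leb2]_x (normc (p x) ^+ 2 + normc (q x) ^+ 2)%:E = sqint p + sqint q)%E.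
    move=> mp mq; under eq_integral do rewrite EFinD.
    rewrite ge0_integralD//; do ?[by move=> x _; rewrite lee_fin sqr_ge0].
      by apply/measurable_EFinP; exact: measurable_normc2.
    by apply/measurable_EFinP; exact: measurable_normc2.
  have key : (\int[leb2]_x (normc (f x * (m n x)%:C * h (psub x (u n)) - f x * h x))%:E <=
     la%:E * (\int[leb2]_x (normc (f x) ^+ 2 + normc (h (psub x (u n))) ^+ 2)%:E) +
     la^-1%:E * (\int[leb2]_x (normc (d n x) ^+ 2 + normc (h (psub x (u n)) - h x) ^+ 2)%:E))%E.
    apply: le_integral_lincomb => //; do ?[by move=> x; rewrite ?addr_ge0// ?sqr_ge0// ?normc_ge0].
    - apply: measurable_normc; apply: cmeasD; first by apply: cmeasM; [apply: cmeasM|case: (Lhu n)].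
      by apply: cmeasN; exact: cmeasM.
    - exact: ltW.
    - by rewrite invr_ge0 ltW.
    move=> x; set hu := h (psub x (u n)).
    rewrite (_ : f x * (m n x)%:C * hu - f x * h x = - (d n x * hu) + f x * (hu - h x)); last first.
      by rewrite /d rmorphB rmorph1; ring.
    apply: (le_trans (normcD_le _ _)); rewrite normc_opp (normc_mul (d n x)) (normc_mul (f x) (hu - h x)).
    set a := normc (f x); set b := normc hu; set c := normc (d n x); set q := normc (hu - h x).
    have am (s t : R) : s * t <= la * t ^+ 2 + la^-1 * s ^+ 2.
      have h1 := sqr_ge0 (s - la * t).
      have h2 : 0 <= la^-1 * (s - la * t) ^+ 2 by rewrite mulr_ge0// invr_ge0 ltW.
      have h3 : la^-1 * (s - la * t) ^+ 2 = la^-1 * s ^+ 2 - 2 * (s * t) + la * t ^+ 2.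
        by field; rewrite gt_eqF.
      have h4 : 0 <= la * t ^+ 2 by rewrite mulr_ge0 ?sqr_ge0// ltW.
      have h5 : 0 <= la^-1 * s ^+ 2 by rewrite mulr_ge0 ?sqr_ge0// invr_ge0 ltW.
      lra.
    apply: (le_trans (lerD (am c b) _)); first by rewrite [a * q]mulrC; exact: am.
    by rewrite le_eqVlt; apply/orP; left; apply/eqP; rewrite /=; ring.
  rewrite /D; apply: (le_trans (lee_wpmul2l _ key)) => //.
  rewrite addE//; last by case: (Lhu n).
  rewrite addE// sqint_psub2// SE ge0_muleDr; last 2 first.
  - by apply: mule_ge0; rewrite lee_fin // ltW.
  - by apply: mule_ge0; [rewrite lee_fin invr_ge0 ltW|rewrite adde_ge0 ?sqint_ge0].
  rewrite addeC; apply: leeD; first by rewrite muleA -EFinM.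
  rewrite -!EFinM lee_fin /la.
  rewrite [leLHS](_ : _ = e * (S / (S + 1))); last by field; rewrite gt_eqF// ltr_wpDl.
  rewrite ler_piMr ?(ltW e0)// ler_pdivrMr ?mul1r ?lerDl//.
  by rewrite ltr_wpDl.
apply: (vanish_ccvg _ vD) => n.
rewrite -cintegralB; last 2 first.
- exact: cL2M_integrable.
- exact: cL2M_integrable.
apply: normc_cintegral_le.
rewrite (_ : (fun z => _) = (fun z => f z * (m n z)%:C * h (psub z (u n)) + (-1) * (f z * h z))).
  by apply: cintegrableD; [exact: cL2M_integrable|apply: cintegrableZ; exact: cL2M_integrable].
by apply/funext => z; rewrite mulN1r.
Qed.
End Shift.
End SquareIntegrable.

(** * Cutting off and mollifying a product *)

Section Mollify.
Context {R : realType}.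
Local Open Scope complex_scope.
Local Notation normc := (@ComplexField.Normc.normc R).
Local Notation leb := (@lebesgue_measure R).
Local Notation leb2 := (leb \x leb)%E.
Local Notation plane := (measurableTypeR R * measurableTypeR R)%type.
Implicit Types f g h : plane -> R[i].

Definition scl (n : nat) : R := n.+1%:R.
Definition cutoff n (z : R * R) : R := gau (4 * scl n ^+ 2)^-1 z.
(** A Gaussian of total mass 1 concentrating at the origin at the scale 1 / n. *)
Definition mollifier n (z : R * R) : R := scl n ^+ 2 / pi * gau (scl n ^+ 2) z.
Definition scaled n (w : R * R) : R * R := (w.1 / scl n, w.2 / scl n).
(** The bilinear form (f, h) -> int f h, with f cut off at the scale n and h
    mollified at the scale 1 / n. *)
Definition Phi n f h : R[i] := cintegral (fun x => f x * (cutoff n x)%:C *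
  cintegral (fun y => h y * (mollifier n (psub x y))%:C)).

Lemma scl_gt0 n : 0 < scl n. Proof. by rewrite ltr0n. Qed.
Lemma scl_neq0 n : scl n != 0. Proof. by rewrite gt_eqF// scl_gt0. Qed.

Lemma scaled_affine n w : scaled n w = affine2 (scl n)^-1 (0, 0) w.
Proof. by rewrite /scaled /affine2 !addr0 ![_^-1 * _]mulrC. Qed.

Lemma gau_le1 c (z : R * R) : 0 <= c -> gau c z <= 1.
Proof. by move=> c0; rewrite -expR0 ler_expR oppr_le0 mulr_ge0// addr_ge0// sqr_ge0. Qed.

Lemma cutoff01 n z : 0 <= cutoff n z <= 1.
Proof. by rewrite gau_ge0 gau_le1// invr_ge0 mulr_ge0// sqr_ge0. Qed.

Lemma cutoff_cvg z : (cutoff n z @[n --> \oo] --> (1 : R))%classic.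
Proof.
have h0 : ((fun n => (4 * scl n ^+ 2)^-1) @ \oo --> (0 : R))%classic.
  apply: cvg0_le (cvg_harmonic) => n; rewrite ger0_norm; last by rewrite invr_ge0 mulr_ge0// sqr_ge0.
  rewrite /harmonic lef_pV2 ?posrE ?mulr_gt0 ?exprn_gt0 ?scl_gt0//.
  have h : 1 <= scl n by rewrite ler1n.
  rewrite -/(scl n); nra.
have h1 : ((fun n => - ((4 * scl n ^+ 2)^-1 * (z.1 ^+ 2 + z.2 ^+ 2))) @ \oo --> (0 : R))%classic.
  rewrite -oppr0 -[X in - X](mul0r (z.1 ^+ 2 + z.2 ^+ 2)).
  by apply: cvgN; apply: cvgM => //; exact: cvg_cst.
rewrite -expR0; apply: continuous_cvg h1; exact: continuous_expR.
Qed.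

Lemma measurable_cutoff n : measurable_fun [set: plane] (cutoff n).
Proof. exact: measurable_gau. Qed.

Lemma scaled_cvg (w : R * R) : ((fun n => (scaled n w).1) @ \oo --> (0 : R))%classic /\
  ((fun n => (scaled n w).2) @ \oo --> (0 : R))%classic.
Proof.
have h (a : R) : ((fun n => a / scl n) @ \oo --> (0 : R))%classic.
  by rewrite -(mulr0 a); apply: cvgM; [exact: cvg_cst|exact: cvg_harmonic].
by split; exact: h.
Qed.

Lemma scaled_bound (w : R * R) n : `|(scaled n w).1| <= `|w.1| + `|w.2| /\ `|(scaled n w).2| <= `|w.1| + `|w.2|.
Proof.
have h (a : R) : `|a / scl n| <= `|a|.
  by rewrite normrM ler_piMr// ger0_norm ?invr_ge0 ?(ltW (scl_gt0 n))// invf_le1 ?scl_gt0// ler1n.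
by split; apply: (le_trans (h _)); rewrite ?lerDl ?lerDr.
Qed.

Definition kern (w : R * R) : R := pi^-1 * gau 1 w.
Lemma kern_ge0 w : 0 <= kern w. Proof. by rewrite mulr_ge0 ?invr_ge0 ?pi_ge0// gau_ge0. Qed.
Lemma measurable_kern : measurable_fun [set: plane] kern.
Proof. by apply: measurable_funM => //; exact: measurable_gau. Qed.
Lemma integral_kern : (\int[leb2]_w (kern w)%:E = 1)%E.
Proof.
under eq_integral do rewrite EFinM.
rewrite ge0_integralZl_EFin//; do ?[by apply/measurable_EFinP; exact: measurable_gau
  |by rewrite invr_ge0 pi_ge0|by move=> z _; rewrite lee_fin gau_ge0].
by rewrite integral_gau// -EFinM divr1 mulVf// gt_eqF// pi_gt0.
Qed.
Lemma integrable_kern : leb2.-integrable setT (EFin \o kern).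
Proof.
apply/integrableP; split; first by apply/measurable_EFinP; exact: measurable_kern.
under eq_integral do rewrite gee0_abs ?lee_fin ?kern_ge0//.
by rewrite integral_kern ltry.
Qed.

Lemma cL2_gau (c : R) : 0 < c -> cL2 (fun z : plane => (gau c z)%:C).
Proof.
move=> c0; split; first by apply: cmeas_real; exact: measurable_gau.
have /integrableP[_ h] := @integrable_gau R c c0; apply: le_lt_trans h.
apply: ge0_le_integral => //; do ?[by move=> z _; rewrite lee_fin sqr_ge0].
- apply/measurable_EFinP; apply: measurable_normc2; apply: cmeas_real; exact: measurable_gau.
- by apply/measurable_EFinP; apply: measurableT_comp => //; exact: measurable_gau.
move=> z _; rewrite abse_EFin lee_fin normc_real expr2 ger0_norm ?gau_ge0//.
by rewrite ler_piMr ?gau_ge0// gau_le1// ltW.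
Qed.

(** The substitution y = x - w / n moves the parameter from the mollifier to a
    translation of h, where [weak_shift] can be applied. *)
Lemma inner_rescale n h x : cL2 h ->
  cintegral (fun y => h y * (mollifier n (psub x y))%:C) =
  cintegral (fun w => h (psub x (scaled n w)) * (kern w)%:C).
Proof.
move=> Lh.
have s0 := scl_neq0 n.
have a0 : - (scl n)^-1 != 0 by rewrite oppr_eq0 invr_eq0.
have Lg : cL2 (fun y => (gau (scl n ^+ 2) (psub x y))%:C).
  by apply: (@cL2_psub1 R x (fun y => (gau (scl n ^+ 2) y)%:C)); apply: cL2_gau; rewrite exprn_gt0 ?scl_gt0.
have I := cL2M_integrable Lh Lg.
have := cintegral_affine2 x a0 I.
rewrite normrN normfV (ger0_norm (ltW (scl_gt0 n))) exprVn invrK => E.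
transitivity ((scl n ^+ 2 / pi)%:C * cintegral (fun y => h y * (gau (scl n ^+ 2) (psub x y))%:C)).
  rewrite -cintegralZ//; apply: eq_cintegral => y.
  by rewrite /mollifier rmorphM mulrCA.
transitivity ((pi^-1)%:C * ((scl n ^+ 2)%:C * cintegral (fun y => h y * (gau (scl n ^+ 2) (psub x y))%:C))).
  by rewrite mulrA -rmorphM [pi^-1 * _]mulrC.
have I' := cintegrable_affine2 x a0 I.
rewrite -E -cintegralZ//.
apply: eq_cintegral => w; rewrite /kern rmorphM mulrCA; congr (_ * _).
  by congr h; rewrite /affine2 /psub /scaled /= !mulNr ![- _ + _]addrC ![_ / scl n]mulrC.
congr (_ * _); congr (_%:C); rewrite /gau /psub /affine2 /=; congr (expR (- _)).
by field.
Qed.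

(** After rescaling and Fubini, Phi n f h is the average over w, for a fixed
    Gaussian, of the integrals of f (cut off) against h shifted by w / n.  Each of
    these tends to int f h, and they are bounded by the L^2 norms uniformly in w
    and n, so dominated convergence applies. *)
Lemma mollify_cvg f h : cL2 f -> cL2 h -> ccvg (fun n => Phi n f h) (cintegral (fun x => f x * h x)).
Proof.
move=> Lf Lh; have [mf ff] := Lf; have [mh fh] := Lh.
pose F n (x w : plane) := f x * (cutoff n x)%:C * (h (psub x (scaled n w)) * (kern w)%:C).
have msc n : measurable_fun [set: plane] (fun w => scaled n w : plane).
  by under eq_fun do rewrite scaled_affine; exact: measurable_affine2.
have mF n : cmeas (fun p : plane * plane => F n p.1 p.2).
  apply: cmeasM; apply: cmeasM.
  - exact: (cmeas_comp mf measurable_fst).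
  - apply: cmeas_real; exact: (measurableT_comp (measurable_cutoff n) measurable_fst).
  - apply: (cmeas_comp (u := h) (phi := fun p : plane * plane => psub p.1 (scaled n p.2) : plane) mh).
    apply: (measurableT_comp measurable_psub (g := fun p : plane * plane => (p.1, scaled n p.2 : plane))).
    apply/measurable_fun_pair; first exact: measurable_fst.
    exact: (measurableT_comp (msc n) measurable_snd).
  - apply: cmeas_real; exact: (measurableT_comp measurable_kern measurable_snd).
have int_kern : cintegrable (fun w => (kern w)%:C).
  apply/cintegrableP; split; first by apply: cmeas_real; exact: measurable_kern.
  under eq_integral do rewrite normc_real (ger0_norm (kern_ge0 _)).
  by rewrite integral_kern ltry.
have int_hk n x : cintegrable (fun w => h (psub x (scaled n w)) * (kern w)%:C).
  apply: cL2M_integrable.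
    under eq_fun do rewrite scaled_affine.
    by apply: (@cL2_affine2 R _ _ (fun y => h (psub x y))); [rewrite invr_eq0 scl_neq0|exact: cL2_psub1].
  apply: (@cL2_le R _ (fun w => (gau 1 w)%:C)); last 2 first.
  - exact: cL2_gau.
  - move=> w; rewrite !normc_real (ger0_norm (kern_ge0 _)) (ger0_norm (gau_ge0 _ _)).
    rewrite /kern ler_piMl ?gau_ge0// invf_le1 ?pi_gt0//.
    by have := pi_ge2 R; lra.
  by apply: cmeas_real; exact: measurable_kern.
pose S := fine (sqint f + sqint h).
have SE : (sqint f + sqint h)%E = S%:E by rewrite fineK// fin_numD !sqint_fin.
have S0 : 0 <= S by rewrite fine_ge0// adde_ge0// sqint_ge0.
have Lfm n : cL2 (fun x => f x * (cutoff n x)%:C).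
  apply: (cL2_le _ Lf) => [|z]; first by apply: cmeasM => //; apply: cmeas_real; exact: measurable_cutoff.
  rewrite normc_mul normc_real ler_piMr ?normc_ge0//.
  by have /andP[a b] := cutoff01 n z; rewrite ger0_norm.
have sqm n : (sqint (fun x => (f x * (cutoff n x)%:C)%R) <= sqint f)%E.
  apply: ge0_le_integral => //; do ?[by move=> z _; rewrite lee_fin sqr_ge0]; do ?[by apply/measurable_EFinP; apply: measurable_normc2; case: (Lfm n)]; do ?[by apply/measurable_EFinP; exact: measurable_normc2].
  move=> z _; rewrite lee_fin lerXn2r ?nnegrE ?normc_ge0// normc_mul normc_real ler_piMr ?normc_ge0//.
  by have /andP[a b] := cutoff01 n z; rewrite ger0_norm.
have inb n w : (\int[leb2]_x (normc (F n x w))%:E <= (kern w * S)%:E)%E.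
  have mfh : cmeas (fun x => f x * (cutoff n x)%:C * h (psub x (scaled n w))).
    by apply: cmeasM; [case: (Lfm n)|exact: cmeas_comp mh (measurable_psub2 _)].
  under eq_integral do rewrite /F mulrA [normc (_ * (kern w)%:C)]normc_mul normc_real (ger0_norm (kern_ge0 w)) mulrC EFinM.
  rewrite ge0_integralZl_EFin//; do ?[by apply/measurable_EFinP; exact: measurable_normc|exact: kern_ge0|by move=> z _; rewrite lee_fin normc_ge0].
  rewrite (EFinM (kern w) S); apply: lee_wpmul2l; first by rewrite lee_fin kern_ge0.
  apply: (le_trans (integral_normcM_le _ _)).
  - by case: (Lfm n).
  - exact: cmeas_comp mh (measurable_psub2 _).
  by rewrite sqint_psub2// -SE; apply: leeD.
have fF n : (\int[leb2]_x \int[leb2]_w (normc (F n x w))%:E < +oo)%E.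
  rewrite plane_tonelli; last 2 first.
  - by apply/measurable_EFinP; exact: measurable_normc.
  - by move=> x w; rewrite lee_fin normc_ge0.
  apply: (@le_lt_trans _ _ (\int[leb2]_w (kern w * S)%:E)%E).
    apply: ge0_le_integral => //; do ?[by move=> w _; apply: integral_ge0 => x _; rewrite lee_fin normc_ge0].
    - apply: (plane_measurable_integral (f := fun w x => (normc (F n x w))%:E)).
        apply/measurable_EFinP; apply: (measurable_normc (u := fun p : plane * plane => F n p.2 p.1)).
        have := @cmeas_comp R _ _ _ _ _ (fun p : plane * plane => (p.2, p.1)) (mF n) (@measurable_swap _ _ plane plane); exact.
      by move=> x w; rewrite lee_fin normc_ge0.
    - by apply/measurable_EFinP; apply: measurable_funM => //; exact: measurable_kern.
  under eq_integral do rewrite mulrC (EFinM S).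
  rewrite ge0_integralZl_EFin//; do ?[by apply/measurable_EFinP; exact: measurable_kern|by move=> w _; rewrite lee_fin kern_ge0].
  by rewrite integral_kern mule1 ltry.
have PhiE n : Phi n f h = cintegral (fun w => cintegral (fun x => F n x w)).
  rewrite -(cFubini (mF n) (fF n)); apply: eq_cintegral => x.
  by rewrite inner_rescale// -(cintegralZ _ (int_hk n x)).
have cE n w : cintegral (fun x => F n x w) =
    cintegral (fun x => f x * (cutoff n x)%:C * h (psub x (scaled n w))) * (kern w)%:C.
  rewrite mulrC -cintegralZ; last exact: cL2M_integrable (Lfm n) (cL2_psub2 _ Lh).
  by apply: eq_cintegral => x; rewrite /F [LHS]mulrA [LHS]mulrC.
have cl w : ccvg (fun n => cintegral (fun x => F n x w)) (cintegral (fun x => f x * h x) * (kern w)%:C).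
  under eq_fun do rewrite cE.
  apply: ccvgM; last exact: ccvg_cst.
  have [c1 c2] := scaled_cvg w.
  exact: (@weak_shift R (fun n => scaled n w) _ (scaled_bound w) c1 c2 cutoff measurable_cutoff cutoff01 cutoff_cvg f h Lf Lh).
have -> : cintegral (fun x => f x * h x) = cintegral (fun w : plane => cintegral (fun x => f x * h x) * (kern w)%:C).
  rewrite cintegralZ.
    by rewrite cintegral_real /Rintegral integral_kern mulr1.
  exact: int_kern.
rewrite (_ : (fun n => Phi n f h) = fun n => cintegral (fun w => cintegral (fun x => F n x w))); last exact/funext.
apply: (cintegral_dominated (G := fun w => 2 * S * kern w)) => //.
- move=> n; apply: (cmeas_cintegral (F := fun w x => F n x w)).
  have := @cmeas_comp R _ _ _ _ _ (fun p : plane * plane => (p.2, p.1)) (mF n) (@measurable_swap _ _ plane plane); exact.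
- apply: cmeasM; [exact: cmeas_cst|apply: cmeas_real; exact: measurable_kern].
- exact: integrable_scale integrable_kern.
move=> n w.
have iF : cintegrable (fun x => F n x w).
  apply/cintegrableP; split; first by apply: (cmeas_comp (mF n) (phi := fun x => (x, w))); exact: pair2_measurable.
  by apply: (le_lt_trans (inb n w)); rewrite ltry.
rewrite -lee_fin; apply: (le_trans (normc_cintegral_le iF)).
rewrite -mulrA (EFinM 2) [S * _]mulrC; apply: lee_wpmul2l => //; exact: inb.
Qed.
End Mollify.

(** * Gaussian wave packets are Schwartz functions *)

Section PolynomialTimesGaussian.
Context {R : realType}.
Implicit Types (p q P Q : {poly R}).

Lemma monomial_gauss_bound (c : R) (n : nat) : 0 < c ->
  exists M : R, forall s : R, `|s| ^+ n * expR (- (c * s ^+ 2)) <= M.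
Proof.
move=> c0; exists (1 + n`!%:R / c ^+ n) => s.
have f0 : 0 <= n`!%:R / c ^+ n :> R by rewrite divr_ge0// exprn_ge0// ltW.
have cs0 : 0 <= c * s ^+ 2 by rewrite mulr_ge0 ?sqr_ge0// ltW.
have e1 : expR (- (c * s ^+ 2)) <= 1 by rewrite -expR0 ler_expR oppr_le0.
have [s1|/ltW s1] := leP `|s| 1.
  apply: (@le_trans _ _ 1); last by rewrite lerDl.
  by rewrite -[leRHS]mul1r ler_pM ?expR_ge0 ?exprn_ge0 ?exprn_ile1.
apply: (@le_trans _ _ (n`!%:R / c ^+ n)); last by rewrite lerDr.
rewrite expRN -ler_pdivlMr ?invr_gt0 ?expR_gt0// invrK.
have e0 : 1 <= expR (c * s ^+ 2) by apply: le_trans (expR_ge1Dx _); rewrite lerDl.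
case: n f0 => [|n] f0; first by rewrite !expr0 fact0 invr1 mulr1 mul1r.
have h : (c * s ^+ 2) ^+ n.+1 / n.+1`!%:R <= expR (c * s ^+ 2).
  by apply: le_trans (expR_ge1Dxn n cs0); rewrite lerDr.
apply: le_trans (ler_wpM2l f0 h).
have -> : n.+1`!%:R / c ^+ n.+1 * ((c * s ^+ 2) ^+ n.+1 / n.+1`!%:R) = (s ^+ 2) ^+ n.+1.
  by rewrite exprMn; field; rewrite expf_neq0 ?gt_eqF// ltr0n fact_gt0.
rewrite -real_normK ?num_real// lerXn2r ?nnegrE ?exprn_ge0//.
by rewrite -[leLHS]mulr1 expr2 ler_wpM2l.
Qed.

(** For the induction on p the statement is strengthened by a factor |s|^n. *)
Lemma poly_gauss_bound (c : R) p : 0 < c ->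
  exists M : R, forall s : R, `|p.[s]| * expR (- (c * s ^+ 2)) <= M.
Proof.
move=> c0; suff /(_ 0%N)[M hM] : forall n, exists M : R,
    forall s : R, `|s| ^+ n * `|p.[s]| * expR (- (c * s ^+ 2)) <= M.
  by exists M => s; have := hM s; rewrite expr0 mul1r.
elim/poly_ind: p => [|p r IH] n.
  by exists 0 => s; rewrite horner0 normr0 mulr0 mul0r.
have [M hM] := IH n.+1; have [M' hM'] := monomial_gauss_bound n c0.
exists (M + `|r| * M') => s.
rewrite hornerD hornerMX hornerC.
have e0 := expR_ge0 (- (c * s ^+ 2)).
apply: (@le_trans _ _ (`|s| ^+ n * (`|p.[s]| * `|s| + `|r|) * expR (- (c * s ^+ 2)))).
  by rewrite ler_wpM2r// ler_wpM2l ?exprn_ge0// (le_trans (ler_normD _ _))// normrM.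
apply: (@le_trans _ _ (`|s| ^+ n.+1 * `|p.[s]| * expR (- (c * s ^+ 2)) + `|r| * (`|s| ^+ n * expR (- (c * s ^+ 2))))).
  by rewrite [`|s| ^+ n.+1]exprSr le_eqVlt; apply/orP; left; apply/eqP; ring.
by apply: lerD => //; rewrite ler_wpM2l.
Qed.

(** A class of functions closed under differentiation and containing the cosine
    and sine wave packets centered at a; PQ holds the amplitudes of the cosine and
    of the sine. *)
Definition wave (c a x : R) (PQ : {poly R} * {poly R}) (t : R) : R :=
  expR (- (c * (t - a) ^+ 2)) *
  (PQ.1.[t - a] * cos (x * (t - a)) + PQ.2.[t - a] * sin (x * (t - a))).

Definition wave_deriv (c x : R) (PQ : {poly R} * {poly R}) : {poly R} * {poly R} :=
  (PQ.1^`() - (2 * c) *: ('X * PQ.1) + x *: PQ.2,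
   PQ.2^`() - (2 * c) *: ('X * PQ.2) - x *: PQ.1).

Lemma is_derive_horner p (t : R) : is_derive t 1 (horner p) p^`().[t].
Proof.
apply: DeriveDef; first exact: derivable_horner.
by rewrite -derive1E derivE.
Qed.

Lemma is_derive_wave c a x PQ (t : R) :
  is_derive t 1 (wave c a x PQ) (wave c a x (wave_deriv c x PQ) t).
Proof.
have sh : is_derive t 1 (fun t => t - a) 1.
  have := is_deriveB (is_derive_id t 1) (is_derive_cst a t 1); by rewrite subr0.
have xl : is_derive (t - a) 1 (fun s => x * s) x.
  have := is_deriveM (is_derive_cst x (t - a) 1) (is_derive_id (t - a) 1).
  by rewrite scaler0 addr0 /GRing.scale/= mulr1.
have dc := is_derive1_comp (f := cos) (is_derive_cos _) xl.
have ds := is_derive1_comp (f := sin) (is_derive_sin _) xl.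
have dP := is_deriveM (is_derive_horner PQ.1 (t - a)) dc.
have dQ := is_deriveM (is_derive_horner PQ.2 (t - a)) ds.
have d0 := is_deriveM (is_derive_gauss c (t - a)) (is_deriveD dP dQ).
have d := is_derive1_comp (g := fun t => t - a) d0 sh.
apply: (is_derive_eq d).
rewrite /wave /wave_deriv /GRing.scale /= !(hornerD, hornerN, hornerZ, hornerM, hornerX).
rewrite (_ : (horner PQ.1 * _ + _) (t - a) =
  PQ.1.[t - a] * cos (x * (t - a)) + PQ.2.[t - a] * sin (x * (t - a)))//; ring.
Qed.

Lemma wave_decay c a x PQ k : 0 < c ->
  exists M : R, forall t : R, `|t| ^+ k * `|wave c a x PQ t| <= M.
Proof.
move=> c0.
have [M hM] := poly_gauss_bound (('X + a%:P) ^+ k * PQ.1) c0.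
have [N hN] := poly_gauss_bound (('X + a%:P) ^+ k * PQ.2) c0.
exists (M + N) => t; apply: le_trans (lerD (hM (t - a)) (hN (t - a))).
rewrite !(hornerM, horner_exp, hornerD, hornerX, hornerC) subrK !normrM !normrX (ger0_norm (expR_ge0 _)) -mulrDl -mulrDr.
rewrite [expR _ * _]mulrC mulrA ler_wpM2r ?expR_ge0// ler_wpM2l ?exprn_ge0//.
apply: (le_trans (ler_normD _ _)); rewrite !normrM; apply: lerD; rewrite ler_piMr//.
  by rewrite ler_norml cos_geN1 cos_le1.
by rewrite ler_norml sin_geN1 sin_le1.
Qed.
End PolynomialTimesGaussian.

Section GaussianTests.
Context {R : realType}.
Implicit Types (f g : R * R -> R) (z : R * R).

Definition line (i : bool) z (s : R) : R * R := if i then (z.1, s) else (s, z.2).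
Definition coord (i : bool) z : R := if i then z.2 else z.1.

(** A directional difference quotient along an axis is literally the difference
    quotient of the restriction to a line, so derivatives along axes are
    one-variable derivatives. *)
Lemma derive_quotient_line i f z (h : R) :
  h^-1 *: ((f \o shift z) (h *: axis i) - f z) =
  h^-1 *: ((f \o line i z \o shift (coord i z)) (h *: (1 : R)) - (f \o line i z) (coord i z)).
Proof.
have E : (h *: axis i + z)%R = line i z (h *: (1 : R) + coord i z)%R.
  case: i z => -[x y]; rewrite /axis /line /coord /=.
    by congr pair; rewrite /= /GRing.scale /= mulr0 add0r.
  by congr pair; rewrite /= /GRing.scale /= mulr0 add0r.
have E' : z = line i z (coord i z) by case: i {E} z => -[x y].
rewrite /=; congr (_ *: (_ - _)); first by rewrite E.
by rewrite -E'.
Qed.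

Lemma derivable_line i f z : derivable f z (axis i) <-> derivable (f \o line i z) (coord i z) 1.
Proof.
rewrite /derivable.
by have -> := funext (derive_quotient_line i f z).
Qed.

Lemma derive_line i f z : 'D_(axis i) f z = 'D_1 (f \o line i z) (coord i z).
Proof.
rewrite /derive.
by have -> := funext (derive_quotient_line i f z).
Qed.

Lemma is_derive_line i f z d :
  is_derive (coord i z) (1 : R) (f \o line i z) d -> is_derive z (axis i) f d.
Proof.
by move=> [h1 h2]; apply: DeriveDef; [apply/derivable_line|rewrite derive_line].
Qed.

Lemma real_schwartzD f g : real_schwartz f -> real_schwartz g ->
  real_schwartz (fun z => f z + g z).
Proof.
move=> Sf Sg.
have E w : iter_partial w (fun z => f z + g z) =
    fun z => iter_partial w f z + iter_partial w g z.
  elim: w => [//|i w IH]; rewrite /= -/(iter_partial w _) IH; apply/funext => z.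
  by rewrite (deriveD (f := iter_partial w f)); [| case: (Sf w) | case: (Sg w)].
move=> w; rewrite E; split.
  by move=> i z; apply: (derivableD (f := iter_partial w f)); [case: (Sf w)|case: (Sg w)].
move=> j k; have [M hM] := (Sf w).2 j k; have [N hN] := (Sg w).2 j k.
exists (M + N) => z; apply: le_trans (lerD (hM z) (hN z)).
by rewrite -mulrDr ler_wpM2l ?mulr_ge0 ?exprn_ge0// ler_normD.
Qed.

(** An iterated partial derivative of a product of one-variable functions only
    counts how many derivatives fall on each variable. *)
Lemma real_schwartz_tensor (u v : nat -> R -> R) :
  (forall m t, is_derive t (1 : R) (u m) (u m.+1 t)) ->
  (forall m t, is_derive t (1 : R) (v m) (v m.+1 t)) ->
  (forall m k, exists M : R, forall t, `|t| ^+ k * `|u m t| <= M) ->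
  (forall m k, exists M : R, forall t, `|t| ^+ k * `|v m t| <= M) ->
  real_schwartz (fun z => u 0 z.1 * v 0 z.2).
Proof.
move=> du dv bu bv.
have D m n i z : is_derive z (axis i) (fun z : R * R => u m z.1 * v n z.2)
    (u (m + ~~ i)%N z.1 * v (n + i)%N z.2).
  apply: is_derive_line; case: i => /=; rewrite ?addn0 ?addn1.
    have := is_deriveM (is_derive_cst (u m z.1) z.2 1) (dv n z.2).
    by move=> h; apply: (is_derive_eq h); rewrite /GRing.scale /= mulr0 addr0.
  have := is_deriveM (du m z.1) (is_derive_cst (v n z.2) z.1 1).
  by move=> h; apply: (is_derive_eq h); rewrite /GRing.scale /= mulr0 add0r mulrC.
have E w : iter_partial w (fun z => u 0 z.1 * v 0 z.2) =
    fun z => u (count negb w) z.1 * v (count id w) z.2.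
  elim: w => [//|i w IH]; rewrite /= -/(iter_partial w _) IH; apply/funext => z.
  by rewrite (@derive_val _ _ _ _ _ _ _ (D _ _ i z)) addnC [(_ + i)%N]addnC.
move=> w; rewrite E; split.
  by move=> i z; exact: (@ex_derive _ _ _ _ _ _ _ (D _ _ i z)).
move=> j k; have [M hM] := bu (count negb w) j; have [N hN] := bv (count id w) k.
exists (M * N) => z; rewrite normrM mulrACA.
by apply: ler_pM => //; rewrite mulr_ge0 ?exprn_ge0.
Qed.

Lemma real_schwartz_wave (c a1 a2 x1 x2 : R) PQ PQ' : 0 < c ->
  real_schwartz (fun z => wave c a1 x1 PQ z.1 * wave c a2 x2 PQ' z.2).
Proof.
move=> c0; apply: (real_schwartz_tensor
  (u := fun m => wave c a1 x1 (iter m (wave_deriv c x1) PQ))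
  (v := fun m => wave c a2 x2 (iter m (wave_deriv c x2) PQ'))).
- by move=> m t; exact: is_derive_wave.
- by move=> m t; exact: is_derive_wave.
- by move=> m k; exact: wave_decay.
by move=> m k; exact: wave_decay.
Qed.

(** The phase is normalized to vanish at the center a, so that translating the
    packet to the origin produces no extra constant. *)
Definition gabor (c : R) (a x : R * R) (z : R * R) : R[i] :=
  ((gau c (psub z a))%:C * cis (dot x (psub z a)))%C.

Lemma schwartz_gabor c a x : 0 < c -> schwartz (gabor c a x).
Proof.
move=> c0.
(* The amplitudes of the cosine, of the sine and of its opposite. *)
pose C1 := (1 : {poly R}, 0 : {poly R}); pose S1 := (0 : {poly R}, 1 : {poly R}).
pose N1 := (0 : {poly R}, -1 : {poly R}).
have wC b y t : wave c b y C1 t = expR (- (c * (t - b) ^+ 2)) * cos (y * (t - b)).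
  by rewrite /wave /= hornerC hornerC mul0r addr0 mul1r.
have wS b y t : wave c b y S1 t = expR (- (c * (t - b) ^+ 2)) * sin (y * (t - b)).
  by rewrite /wave /= hornerC hornerC mul0r add0r mul1r.
have wN b y t : wave c b y N1 t = - (expR (- (c * (t - b) ^+ 2)) * sin (y * (t - b))).
  by rewrite /wave /= hornerN hornerC hornerC mul0r add0r mulN1r mulrN.
split.
  have := real_schwartzD (real_schwartz_wave a.1 a.2 x.1 x.2 C1 C1 c0)
    (real_schwartz_wave a.1 a.2 x.1 x.2 N1 S1 c0).
  congr real_schwartz; apply/funext => z.
  rewrite !wC wN wS /repart /gabor Re_mul /= mul0r subr0 gau_split /dot /psub /= cosD; ring.
have := real_schwartzD (real_schwartz_wave a.1 a.2 x.1 x.2 S1 C1 c0)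
  (real_schwartz_wave a.1 a.2 x.1 x.2 C1 S1 c0).
congr real_schwartz; apply/funext => z.
rewrite !wC !wS /impart /gabor Im_mul /= mul0r addr0 gau_split /dot /psub /= sinD; ring.
Qed.
End GaussianTests.

(** * Parseval identity for a product *)

Section Parseval.
Context {R : realType}.
Local Open Scope complex_scope.
Local Notation normc := (@ComplexField.Normc.normc R).
Local Notation leb := (@lebesgue_measure R).
Local Notation leb2 := (leb \x leb)%E.
Local Notation plane := (measurableTypeR R * measurableTypeR R)%type.
Implicit Types (f g h u v : plane -> R[i]) (a x y : R * R).

(** This is what moves a Fourier transform from one factor of a pairing to the
    other. *)
Lemma cFubini_phase f h (k : plane -> plane -> R) : cintegrable f -> cintegrable h ->
  measurable_fun [set: plane * plane] (fun p : plane * plane => k p.1 p.2) ->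
  cintegral (fun a => f a * cintegral (fun y => h y * cis (k a y))) =
  cintegral (fun y => h y * cintegral (fun a => f a * cis (k a y))).
Proof.
move=> If Ih mk.
have [mf ff] := (cintegrableP f).1 If; have [mh fh] := (cintegrableP h).1 Ih.
pose F (a y : plane) := f a * (h y * cis (k a y)).
have mF : cmeas (fun p : plane * plane => F p.1 p.2).
  apply: cmeasM; first exact: (cmeas_comp mf measurable_fst).
  apply: cmeasM; first exact: (cmeas_comp mh measurable_snd).
  exact: cmeas_cis.
have nF a y : normc (F a y) = normc (f a) * normc (h y).
  by rewrite /F !normc_mul normc_cis mulr1.
have fF : (\int[leb2]_a \int[leb2]_y (normc (F a y))%:E < +oo)%E.
  have E a : (\int[leb2]_y (normc (F a y))%:E =
      (normc (f a))%:E * \int[leb2]_y (normc (h y))%:E)%E.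
    under eq_integral do rewrite nF EFinM.
    rewrite ge0_integralZl_EFin//; do ?[exact: normc_ge0
      |by apply/measurable_EFinP; exact: measurable_normc|by move=> z _; rewrite lee_fin normc_ge0].
  under eq_integral do rewrite E.
  rewrite ge0_integralZr//; do ?[by apply/measurable_EFinP; exact: measurable_normc
    |by move=> z _; rewrite lee_fin normc_ge0|by apply: integral_ge0 => z _; rewrite lee_fin normc_ge0].
  by apply: lte_mul_pinfty => //; [apply: integral_ge0 => z _; rewrite lee_fin normc_ge0
    |rewrite ge0_fin_numE//; apply: integral_ge0 => z _; rewrite lee_fin normc_ge0].
have ik a : cintegrable (fun y => h y * cis (k a y)).
  apply: (cintegrable_le _ Ih) => [|y]; last by rewrite normc_mul normc_cis mulr1.
  apply: cmeasM => //; apply: cmeas_cis.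
  exact: (measurableT_comp mk (pair1_measurable a)).
have ik' y : cintegrable (fun a => f a * cis (k a y)).
  apply: (cintegrable_le _ If) => [|a]; last by rewrite normc_mul normc_cis mulr1.
  apply: cmeasM => //; apply: cmeas_cis.
  exact: (measurableT_comp mk (pair2_measurable y)).
transitivity (cintegral (fun a => cintegral (F a))).
  by apply: eq_cintegral => a; rewrite -(cintegralZ _ (ik a)).
rewrite (cFubini mF fF); apply: eq_cintegral => y.
rewrite -(cintegralZ _ (ik' y)); apply: eq_cintegral => a.
by rewrite /F mulrCA.
Qed.

Lemma cintegrable_phase f h (k : plane -> plane -> R) : cintegrable f -> cintegrable h ->
  measurable_fun [set: plane * plane] (fun p : plane * plane => k p.1 p.2) ->
  cintegrable (fun y => h y * cintegral (fun a => f a * cis (k a y))).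
Proof.
move=> If Ih mk.
have [mf ff] := (cintegrableP f).1 If; have [mh _] := (cintegrableP h).1 Ih.
have i0 : (0 <= \int[leb2]_a (normc (f a))%:E)%E by apply: integral_ge0 => z _; rewrite lee_fin normc_ge0.
pose M := fine (\int[leb2]_a (normc (f a))%:E)%E.
have ME : (\int[leb2]_a (normc (f a))%:E)%E = M%:E by rewrite fineK// ge0_fin_numE.
have M0 : 0 <= M by rewrite fine_ge0.
have ik' y : cintegrable (fun a => f a * cis (k a y)).
  apply: (cintegrable_le _ If) => [|a]; last by rewrite normc_mul normc_cis mulr1.
  apply: cmeasM => //; apply: cmeas_cis.
  exact: (measurableT_comp mk (pair2_measurable y)).
apply: (cintegrable_le (v := fun y => (2 * M)%:C * h y)).
- apply: cmeasM => //; apply: (cmeas_cintegral (F := fun y a => f a * cis (k a y))).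
  apply: cmeasM; first exact: (cmeas_comp mf measurable_snd).
  apply: cmeas_cis; exact: (measurableT_comp mk (@measurable_swap _ _ plane plane)).
- exact: cintegrableZ.
move=> y; rewrite !normc_mul normc_real mulrC ger0_norm ?mulr_ge0// ler_wpM2r ?normc_ge0//.
rewrite -lee_fin; apply: (le_trans (normc_cintegral_le (ik' y))).
by under eq_integral do rewrite normc_mul normc_cis mulr1; rewrite ME.
Qed.

Lemma dotC x y : dot x y = dot y x.
Proof. by rewrite /dot ![x.1 * _]mulrC ![x.2 * _]mulrC. Qed.

(** Translating the packet to the origin leaves the transform of a Gaussian,
    evaluated at the frequency y - x. *)
Lemma fourier_gabor c a x y : 0 < c ->
  fourier_schwartz (gabor c a x) y =
  cis (- dot y a) * (pi / c * gau (4 * c)^-1 (psub x y))%:C.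
Proof.
move=> c0.
have I := cintegrable_gau_cis (psub x y) c0.
have := cintegral_affine2 (- a.1, - a.2) (oner_neq0 R) I.
rewrite normr1 expr1n invr1 mul1r (cintegral_gau_cis _ c0) => <-.
have I' := cintegrable_affine2 (- a.1, - a.2) (oner_neq0 R) I.
rewrite -(cintegralZ _ I'); apply: eq_cintegral => z.
rewrite -psub_transl /gabor -cisN -mulrA -cisD mulrCA -cisD.
congr (_ * cis _); rewrite /dot /psub /=; ring.
Qed.

Lemma gabor_pairing v g c a x : 0 < c -> represents g (distr_fourier (distr_of v)) ->
  cintegral (fun z => g z * gabor c a x z) =
  cintegral (fun y => v y * (cis (- dot y a) * (pi / c * gau (4 * c)^-1 (psub x y))%:C)).
Proof.
move=> c0 [_ /(_ _ (schwartz_gabor a x c0))[_ E]]; rewrite -[LHS]E.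
by apply: eq_cintegral => y; rewrite fourier_gabor.
Qed.

Lemma gauN c x y : gau c (psub x y) = gau c (psub y x) :> R.
Proof. by rewrite /gau /psub /=; congr (expR (- (_ * _))); ring. Qed.

Lemma cL2_phase f (k : plane -> R) : cL2 f -> measurable_fun [set: plane] k ->
  cL2 (fun y => f y * cis (k y)).
Proof.
move=> Lf mk; apply: (cL2_le _ Lf) => [|z]; last by rewrite normc_mul normc_cis mulr1.
by apply: cmeasM; [case: Lf|exact: cmeas_cis].
Qed.

Lemma cL2_scale (k : R) f : cL2 f -> cL2 (fun y => k%:C * f y).
Proof.
move=> [mf ff]; split; first by apply: cmeasM => //; exact: cmeas_cst.
rewrite /sqint; under eq_integral do rewrite normc_mul normc_real exprMn EFinM.
rewrite ge0_integralZl_EFin//; do ?[by rewrite sqr_ge0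
  |by apply/measurable_EFinP; exact: measurable_normc2|by move=> z _; rewrite lee_fin sqr_ge0].
by apply: lte_mul_pinfty => //; rewrite lee_fin sqr_ge0.
Qed.

Lemma cL2_gau_psub (k c : R) x : 0 < c -> cL2 (fun y : plane => (k * gau c (psub x y))%:C).
Proof.
move=> c0; under eq_fun do rewrite rmorphM.
by apply: cL2_scale; apply: (@cL2_psub1 R x (fun y => (gau c y)%:C)); exact: cL2_gau.
Qed.

Lemma measurable_dot_l x : measurable_fun [set: plane] (fun y : plane => - dot y x).
Proof. by apply: measurableT_comp => //; under eq_fun do rewrite dotC; exact: measurable_dot. Qed.

Lemma measurable_dot_swap :
  measurable_fun [set: plane * plane] (fun p : plane * plane => - dot p.2 p.1).
Proof.
apply: measurableT_comp => //; apply: measurable_funD; apply: measurable_funM.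
- exact: (measurableT_comp measurable_fst measurable_snd).
- exact: (measurableT_comp measurable_fst measurable_fst).
- exact: (measurableT_comp measurable_snd measurable_snd).
exact: (measurableT_comp measurable_snd measurable_fst).
Qed.

(** Mollifying g1 at a is pairing it with a packet of frequency 0, which by
    [gabor_pairing] is the transform at a of v1 cut off.  After exchanging the two
    integrals, the remaining one is the pairing of g2 with a packet centered at
    zeta, which is v2 mollified.  The cutoff of one side is thus the mollifier of
    the other, with exactly matching scales. *)
Lemma Phi_parseval n v1 g1 v2 g2 zeta :
  cL2 v1 -> cL2 g1 -> cL2 v2 -> cL2 g2 ->
  represents g1 (distr_fourier (distr_of v1)) ->
  represents g2 (distr_fourier (distr_of v2)) ->
  Phi n (fun a => g2 (psub zeta a)) g1 =
  ((2 * pi) ^+ 2)%:C * Phi n v1 (fun w => v2 w * cis (- dot w zeta)).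
Proof.
move=> L1 M1 L2 M2 r1 r2.
have s0 := @scl_gt0 R n; have sn0 := @scl_neq0 R n.
have c0 : 0 < scl n ^+ 2 :> R by rewrite exprn_gt0.
have d0 : 0 < (4 * scl n ^+ 2)^-1 :> R by rewrite invr_gt0 mulr_gt0.
have Lcut : cL2 (fun z : plane => (cutoff n z)%:C) by exact: cL2_gau.
(* The constants of the Gaussian transform, for the two scales that occur. *)
have id1 (N p G : R) : N != 0 -> p != 0 -> N ^+ 2 / p * (p / N ^+ 2 * G) = G.
  by move=> N0 p0; field; rewrite N0 p0.
have id2 (N p G : R) : N != 0 -> p != 0 ->
    p / (4 * N ^+ 2)^-1 * G = (2 * p) ^+ 2 * (N ^+ 2 / p * G).
  by move=> N0 p0; field; rewrite N0 p0.
have id3 (N : R) : N != 0 -> (4 * (4 * N ^+ 2)^-1)^-1 = N ^+ 2.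
  by move=> N0; field; rewrite N0.
have inner1 a : cintegral (fun y => g1 y * (mollifier n (psub a y))%:C) =
    cintegral (fun y => v1 y * (cutoff n y)%:C * cis (- dot y a)).
  transitivity ((scl n ^+ 2 / pi)%:C * cintegral (fun z => g1 z * gabor (scl n ^+ 2) a (0, 0) z)).
    rewrite -cintegralZ; last by case: r1 => _ /(_ _ (schwartz_gabor a (0, 0) c0))[].
    apply: eq_cintegral => y; rewrite /gabor /mollifier /dot /= !mul0r addr0 cis0 mulr1.
    by rewrite rmorphM /= gauN mulrCA.
  rewrite (gabor_pairing _ _ c0 r1) -cintegralZ.
    apply: eq_cintegral => y; rewrite mulrCA -[RHS]mulrA; congr (_ * _).
    rewrite mulrCA mulrC; congr (_ * _); rewrite -rmorphM /=; congr (_%:C).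
    rewrite id1 ?gt_eqF ?pi_gt0//.
    by rewrite /cutoff /gau /psub /= !sub0r !sqrrN.
  under eq_fun => y do rewrite mulrA.
  apply: cL2M_integrable (cL2_phase L1 (measurable_dot_l a)) (cL2_gau_psub _ _ _).
  by rewrite invr_gt0 mulr_gt0.
have inner2 y : cintegral (fun a => g2 (psub zeta a) * (cutoff n a)%:C * cis (- dot y a)) =
    ((2 * pi) ^+ 2)%:C * cintegral (fun w => v2 w * cis (- dot w zeta) * (mollifier n (psub y w))%:C).
  have Ig : cintegrable (fun z => g2 z * gabor (4 * scl n ^+ 2)^-1 zeta y z).
    by case: r2 => _ /(_ _ (schwartz_gabor zeta y d0))[].
  have n1 : (-1 : R) != 0 by rewrite oppr_eq0 oner_neq0.
  have E := cintegral_affine2 zeta n1 Ig.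
  transitivity (cintegral (fun z => g2 z * gabor (4 * scl n ^+ 2)^-1 zeta y z)).
    move: E; rewrite normrN1 expr1n invr1 mul1r => <-; apply: eq_cintegral => a.
    rewrite -psub_refl /gabor -mulrA; congr (_ * (_%:C * cis _)).
      by rewrite /cutoff /gau /psub /=; congr (expR (- (_ * _))); ring.
    by rewrite /dot /psub /=; ring.
  rewrite (gabor_pairing _ _ d0 r2) -cintegralZ.
    apply: eq_cintegral => w; rewrite -[v2 w * _ * _]mulrA [RHS]mulrCA; congr (_ * _).
    rewrite [RHS]mulrCA; congr (_ * _); rewrite -rmorphM /=; congr (_%:C).
    by rewrite id3// id2 ?gt_eqF ?pi_gt0.
  apply: cL2M_integrable (cL2_phase L2 (measurable_dot_l zeta)) (cL2_gau_psub _ _ _).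
  exact: c0.
have inner2' y : ((2 * pi) ^- 2)%:C * cintegral (fun a => g2 (psub zeta a) * (cutoff n a)%:C * cis (- dot y a)) =
    cintegral (fun w => v2 w * cis (- dot w zeta) * (mollifier n (psub y w))%:C).
  by rewrite inner2 mulrA -rmorphM /= mulVf ?mul1r// expf_neq0// mulf_neq0// gt_eqF// pi_gt0.
rewrite /Phi; under eq_cintegral do rewrite inner1.
rewrite (cFubini_phase (k := fun a y => - dot y a)); last first.
- exact: measurable_dot_swap.
- exact: cL2M_integrable.
- apply: cL2M_integrable => //; exact: cL2_psub1.
under eq_cintegral do rewrite inner2.
rewrite -cintegralZ; last first.
  under eq_fun do rewrite -inner2' mulrCA.
  apply: cintegrableZ.
  apply: (cintegrable_phase (k := fun a y => - dot y a)); last exact: measurable_dot_swap.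
    apply: cL2M_integrable => //; exact: cL2_psub1.
  exact: cL2M_integrable.
by apply: eq_cintegral => y; rewrite mulrCA.
Qed.

Lemma parseval v1 g1 v2 g2 zeta :
  cL2 v1 -> cL2 g1 -> cL2 v2 -> cL2 g2 ->
  represents g1 (distr_fourier (distr_of v1)) ->
  represents g2 (distr_fourier (distr_of v2)) ->
  cintegral (fun a => g2 (psub zeta a) * g1 a) =
  ((2 * pi) ^+ 2)%:C * cintegral (fun w => v1 w * (v2 w * cis (- dot w zeta))).
Proof.
move=> L1 M1 L2 M2 r1 r2.
apply: ccvg_unique (mollify_cvg (cL2_psub1 zeta M2) M1) _.
under eq_fun do rewrite (Phi_parseval _ _ L1 M1 L2 M2 r1 r2).
apply: ccvgM; first exact: ccvg_cst.
by apply: mollify_cvg => //; exact: cL2_phase (measurable_dot_l zeta).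
Qed.
End Parseval.

(** * Regularity and decay of Schwartz functions *)

Section SchwartzFunctions.
Context {R : realType}.
Local Open Scope complex_scope.
Local Notation normc := (@ComplexField.Normc.normc R).
Local Notation leb := (@lebesgue_measure R).
Local Notation leb2 := (leb \x leb)%E.
Local Notation plane := (measurableTypeR R * measurableTypeR R)%type.
Implicit Types (f : R * R -> R) (phi : R * R -> R[i]).

(** The set where f exceeds a is a countable union of boxes with rational centers
    and radii: those on which the value at the center exceeds a by more than the
    oscillation allowed by the Lipschitz constant. *)
Lemma lipschitz_measurable f (L : R) : 0 < L ->
  (forall z w, `|f z - f w| <= L * (`|z.1 - w.1| + `|z.2 - w.2|)) ->
  measurable_fun [set: plane] (f : plane -> R).
Proof.
move=> L0 fL _; apply: (measurability _ (RGenOInfty.measurableE R)) => //.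
move=> /= _ [_ [a ->] <-]; rewrite preimage_itvoy setTI.
pose B (q r e : rat) : set plane :=
  if (0 < ratr e :> R) && (a + L * (2 * ratr e) < f (ratr q, ratr r))
  then `](ratr q - ratr e), (ratr q + ratr e)[ `*` `](ratr r - ratr e), (ratr r + ratr e)[ else set0.
have mB q r e : measurable (B q r e).
  by rewrite /B; case: ifP => // _; apply: measurableX; exact: measurable_itv.
rewrite (_ : [set x | a < f x] = \bigcup_(q : rat) \bigcup_(r : rat) \bigcup_(e : rat) B q r e).
  by do 3! (apply: bigcupT_measurable_rat => ?).
rewrite predeqE => z; split => /= [az|[q _ [r _ [e _]]]].
  (* Twice the oscillation over a box of radius e must stay below f z - a. *)
  have e0 : 0 < (f z - a) / (4 * L) by rewrite divr_gt0 ?subr_gt0 ?mulr_gt0.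
  have [e] := rat_in_itvoo e0; rewrite in_itv /= => /andP[ep e1].
  have h (t : R) : t - ratr e < t + ratr e by rewrite ltrD2l; lra.
  have [q] := rat_in_itvoo (h z.1); rewrite in_itv /= => /andP[q1 q2].
  have [r] := rat_in_itvoo (h z.2); rewrite in_itv /= => /andP[r1 r2].
  exists q => //; exists r => //; exists e => //; rewrite /B ep /=.
  have a1 : `|z.1 - ratr q| <= ratr e by rewrite ler_norml; lra.
  have a2 : `|z.2 - ratr r| <= ratr e by rewrite ler_norml; lra.
  have := fL z (ratr q, ratr r); rewrite ler_norml /= => /andP[_ d].
  have d' : L * (`|z.1 - ratr q| + `|z.2 - ratr r|) <= L * (2 * ratr e) by rewrite ler_wpM2l ?(ltW L0)//; lra.
  move: e1; rewrite ltr_pdivlMr ?mulr_gt0// => e1.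
  rewrite ifT; last by nra.
  by split; rewrite /= in_itv /=; apply/andP; split; lra.
rewrite /B; case: ifP => // /andP[e0 h] [/= ]; rewrite !in_itv /= => /andP[h1 h2] /andP[h3 h4].
have := fL z (ratr q, ratr r); rewrite ler_norml /= => /andP[d _].
have a1 : `|z.1 - ratr q| <= ratr e by rewrite ler_norml; lra.
have a2 : `|z.2 - ratr r| <= ratr e by rewrite ler_norml; lra.
have d' : L * (`|z.1 - ratr q| + `|z.2 - ratr r|) <= L * (2 * ratr e) by rewrite ler_wpM2l ?(ltW L0)//; lra.
lra.
Qed.

Lemma bounded_derive_lipschitz (u : R -> R) (M : R) :
  (forall t, derivable u t 1) -> (forall t, `|'D_1 u t| <= M) ->
  forall s t, `|u s - u t| <= M * `|s - t|.
Proof.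
move=> du bu s t; wlog st : s t / t <= s.
  by move=> H; have [/H//|/ltW/H] := leP t s; rewrite distrC [`|t - s|]distrC.
have cu : continuous u.
  by move=> y; apply: differentiable_continuous; exact/derivable1_diffP.
have [|c _ ->] := @MVT_segment R u (fun y => 'D_1 u y) t s st (fun y _ => derivableP (du y)).
  exact: continuous_subspaceT.
by rewrite normrM ler_wpM2r.
Qed.

Lemma real_schwartz_measurable f : real_schwartz f -> measurable_fun [set: plane] (f : plane -> R).
Proof.
move=> Sf.
have B i : exists M : R, forall z, `|'D_(axis i) f z| <= M.
  have [M hM] := (Sf [:: i]).2 0%N 0%N; exists M => z.
  by have := hM z; rewrite !expr0 !mul1r.
have [M0 h0] := B false; have [M1 h1] := B true.
apply: (@lipschitz_measurable f (`|M0| + `|M1| + 1)).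
  by rewrite ltr_wpDl// addr_ge0.
move=> z w.
have d i y : derivable f y (axis i) by exact: (Sf [::]).1.
have l1 : `|f (z.1, z.2) - f (w.1, z.2)| <= M0 * `|z.1 - w.1|.
  apply: (@bounded_derive_lipschitz (f \o line false (w.1, z.2))) => t.
    exact: (derivable_line false f (t, z.2)).1 (d _ _).
  by have := h0 (t, z.2); rewrite derive_line.
have l2 : `|f (w.1, z.2) - f (w.1, w.2)| <= M1 * `|z.2 - w.2|.
  apply: (@bounded_derive_lipschitz (f \o line true (w.1, z.2))) => t.
    exact: (derivable_line true f (w.1, t)).1 (d _ _).
  by have := h1 (w.1, t); rewrite derive_line.
have E : f z - f w = (f (z.1, z.2) - f (w.1, z.2)) + (f (w.1, z.2) - f (w.1, w.2)).
  by rewrite subrKA; case: z {l1 l2} => ? ?; case: w => ? ?.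
rewrite E; apply: (le_trans (ler_normD _ _)); apply: (le_trans (lerD l1 l2)).
have := ler_norm M0; have := ler_norm M1; have := normr_ge0 M0; have := normr_ge0 M1.
have := normr_ge0 (z.1 - w.1); have := normr_ge0 (z.2 - w.2); nra.
Qed.

Lemma ker_ge t : (bracket t ^+ 2)^-1 <= ker t :> R.
Proof.
have b1 := bracket_ge1 t; have b0 := bracket_gt0 t.
rewrite /ker lef_pV2 ?posrE ?exprn_gt0 ?mulr_gt0 ?sqrt_bracket_gt0//.
rewrite expr2 ler_pM2l// -{2}[bracket t]sqr_sqrtr ?(ltW b0)// expr2 ler_peMr ?sqrtr_ge0//.
by rewrite -sqrtr1 ler_wsqrtr.
Qed.

(** The moments of order at most 2 in each variable, taken after absorbing |x|^p,
    bound (1 + |x|)^2 (1 + |t|)^2 times the function, and <t>^(-2) is at most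
    <t>^(-3/2). *)
Lemma schwartz_decay f p : real_schwartz f ->
  exists M : R, forall z, `|z.1| ^+ p * `|f z| <= M * (ker z.1 * ker z.2).
Proof.
move=> Sf.
have B j k : exists M : R, forall z, `|z.1| ^+ j * `|z.2| ^+ k * (`|z.1| ^+ p * `|f z|) <= M.
  have [M hM] := (Sf [::]).2 (j + p)%N k; exists M => z.
  by have := hM z; rewrite exprD /= => /(le_trans _); apply; rewrite le_eqVlt; apply/orP; left; apply/eqP; ring.
have [m00 h00] := B 0%N 0%N; have [m01 h01] := B 0%N 1%N; have [m02 h02] := B 0%N 2%N.
have [m10 h10] := B 1%N 0%N; have [m11 h11] := B 1%N 1%N; have [m12 h12] := B 1%N 2%N.
have [m20 h20] := B 2%N 0%N; have [m21 h21] := B 2%N 1%N; have [m22 h22] := B 2%N 2%N.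
(* The coefficients of (1 + x)^2 (1 + y)^2. *)
pose M := m00 + 2 * m01 + m02 + 2 * m10 + 4 * m11 + 2 * m12 + m20 + 2 * m21 + m22.
have key z : bracket z.1 ^+ 2 * bracket z.2 ^+ 2 * (`|z.1| ^+ p * `|f z|) <= M.
  have := h00 z; have := h01 z; have := h02 z; have := h10 z; have := h11 z.
  have := h12 z; have := h20 z; have := h21 z; have := h22 z.
  rewrite /M /bracket; move: (_ ^+ p * _) => G; move: `|z.1| `|z.2| => x y.
  by rewrite !expr0 !expr1; lra.
have M0 : 0 <= M by apply: le_trans (key (0, 0)); rewrite !mulr_ge0 ?exprn_ge0 ?(ltW (bracket_gt0 _)).
exists M => z.
have b1 := bracket_gt0 z.1; have b2 := bracket_gt0 z.2.
apply: (@le_trans _ _ (M * ((bracket z.1 ^+ 2)^-1 * (bracket z.2 ^+ 2)^-1))).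
  by rewrite -invfM ler_pdivlMr ?mulr_gt0 ?exprn_gt0// mulrC.
by rewrite ler_wpM2l// ler_pM ?ker_ge// invr_ge0 exprn_ge0// ltW.
Qed.

Lemma integrable_ker2 : leb2.-integrable setT (fun z : plane => (ker z.1 * ker z.2)%:E).
Proof.
have m1 : measurable_fun [set: plane] (fun z : plane => (ker z.1 * ker z.2)%:E).
  apply/measurable_EFinP; apply: measurable_funM.
    exact: (measurableT_comp measurable_ker measurable_fst).
  exact: (measurableT_comp measurable_ker measurable_snd).
have k0 (t : R) := ltW (ker_gt0 t).
have mk : measurable_fun [set: measurableTypeR R] (EFin \o (@ker R)).
  by apply/measurable_EFinP; exact: measurable_ker.
apply/integrableP; split => //.
under eq_integral do rewrite gee0_abs ?lee_fin ?mulr_ge0//.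
rewrite (plane_integral12 (f := fun x y => (ker x * ker y)%:E)) => [|//|x y]; last by rewrite lee_fin mulr_ge0.
under eq_integral => x _.
  under eq_integral => y _ do rewrite EFinM.
  rewrite ge0_integralZl_EFin ?integral_ker//; last by move=> y _; rewrite lee_fin.
  over.
by rewrite ge0_integralZr ?integral_ker ?ltry// => x _; rewrite lee_fin.
Qed.

Lemma schwartz_cintegrable p phi : schwartz phi -> cintegrable (fun z => (z.1 ^+ p)%:C * phi z).
Proof.
move=> [Sr Si].
have mp : measurable_fun [set: plane] (fun z : plane => z.1 ^+ p).
  by apply: measurable_funX; exact: measurable_fst.
have aux f : real_schwartz f -> leb2.-integrable setT (fun z : plane => (z.1 ^+ p * f z)%:E).
  move=> Sf; have [M hM] := schwartz_decay p Sf.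
  apply: (le_integrable _ _ _ (integrable_scale M integrable_ker2)) => //.
  - by apply/measurable_EFinP; apply: measurable_funM => //; exact: real_schwartz_measurable.
  - move=> z _; rewrite /= lee_fin normrM normrX; apply: le_trans (hM z) _; exact: ler_norm.
split.
  by apply: eq_integrable (aux _ Sr) => // z _; rewrite /repart /= Re_mul /= mul0r subr0.
by apply: eq_integrable (aux _ Si) => // z _; rewrite /impart /= Im_mul /= mul0r addr0.
Qed.

Lemma schwartz_cmeas phi : schwartz phi -> cmeas (phi : plane -> R[i]).
Proof. by move=> [Sr Si]; split; exact: real_schwartz_measurable. Qed.

(** Differentiation under the integral: |x| |phi| is integrable and dominates the
    derivative of the integrand. *)
Lemma cpartial_fourier phi y : schwartz phi ->
  cpartial_x (fourier_schwartz phi) y =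
  cintegral (fun z => phi z * (0 -i* z.1) * cis (- dot z y)).
Proof.
move=> Sphi; have mphi := schwartz_cmeas Sphi.
pose th (t : R) (z : R * R) := - (z.1 * t + z.2 * y.2).
have mth t : measurable_fun [set: plane] (th t : plane -> R).
  apply: measurableT_comp => //; apply: measurable_funD; apply: measurable_funM => //.
have E1 t : fourier_schwartz phi (t, y.2) = cintegral (fun z => phi z * cis (th t z)).
  by apply: eq_cintegral => z; rewrite cisN.
have I1 t : cintegrable (fun z => phi z * cis (th t z)).
  apply: (cintegrable_le _ (schwartz_cintegrable 0 Sphi)) => [|z].
    by apply: cmeasM => //; exact: cmeas_cis.
  by rewrite !normc_mul normc_cis expr0 normc_real normr1 mulr1 mul1r.
pose G (z : plane) := `|z.1| * normc (phi z).
have IG : leb2.-integrable setT (EFin \o G).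
  have /cintegrableP[m h] := schwartz_cintegrable 1 Sphi.
  have mG : measurable_fun setT G.
    apply: measurable_funM; last exact: measurable_normc.
    by apply: measurableT_comp => //; exact: measurable_fst.
  apply/integrableP; split; first by apply/measurable_EFinP.
  apply: le_lt_trans h; apply: ge0_le_integral => //; do ?[by move=> z _; rewrite lee_fin normc_ge0].
  - by apply/measurable_EFinP; apply: measurableT_comp.
  - by apply/measurable_EFinP; exact: measurable_normc.
  by move=> z _; rewrite /= lee_fin normc_mul normc_real expr1 ger0_norm// mulr_ge0// normc_ge0.
have dth (z : R * R) (t : R) : is_derive t 1 (fun t => th t z) (- z.1).
  have := is_deriveN (is_deriveD (is_deriveM (is_derive_cst z.1 t 1) (is_derive_id t 1)) (is_derive_cst (z.2 * y.2) t 1)).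
  by move=> h; apply: (is_derive_eq h); rewrite /GRing.scale /= mulr0 !addr0 mulr1.
have dcos (z : R * R) (t : R) : is_derive t 1 (fun t => cos (th t z)) (- sin (th t z) * - z.1).
  exact: (is_derive1_comp (f := cos) (is_derive_cos _) (dth z t)).
have dsin (z : R * R) (t : R) : is_derive t 1 (fun t => sin (th t z)) (cos (th t z) * - z.1).
  exact: (is_derive1_comp (f := sin) (is_derive_sin _) (dth z t)).
have dre (z : R * R) (t : R) : is_derive t 1 (fun t => complex.Re (phi z * cis (th t z)))
    (complex.Re (phi z * (0 -i* z.1) * cis (th t z))).
  under eq_fun do rewrite Re_mul.
  have h := is_deriveB (is_deriveM (is_derive_cst (complex.Re (phi z)) t 1) (dcos z t))
    (is_deriveM (is_derive_cst (complex.Im (phi z)) t 1) (dsin z t)).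
  apply: (is_derive_eq h).
  rewrite !(Re_mul, Im_mul) /GRing.scale /=; ring.
have dim (z : R * R) (t : R) : is_derive t 1 (fun t => complex.Im (phi z * cis (th t z)))
    (complex.Im (phi z * (0 -i* z.1) * cis (th t z))).
  under eq_fun do rewrite Im_mul.
  have h := is_deriveD (is_deriveM (is_derive_cst (complex.Re (phi z)) t 1) (dsin z t))
    (is_deriveM (is_derive_cst (complex.Im (phi z)) t 1) (dcos z t)).
  apply: (is_derive_eq h).
  rewrite !(Re_mul, Im_mul) /GRing.scale /=; ring.
have nb (z : R * R) (t : R) : normc (phi z * (0 -i* z.1) * cis (th t z)) <= G z.
  rewrite !normc_mul normc_cis mulr1 mulrC ler_wpM2r ?normc_ge0//.
  by rewrite /= expr0n add0r sqrrN sqrtr_sqr.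
apply: complex_eq.
  rewrite [LHS]derive_line.
  have D := is_derive_Rintegral y.1 (fun t => (I1 t).1) (fun t z => dre z t) IG
    (fun t z => le_trans (ler_Re_normc _) (nb z t)).
  rewrite (_ : _ \o _ = fun t => Rintegral leb2 setT (fun z => complex.Re (phi z * cis (th t z)))).
    exact: (@derive_val _ _ _ _ _ _ _ D).
  by apply/funext => t; rewrite /= /repart E1.
rewrite [LHS]derive_line.
have D := is_derive_Rintegral y.1 (fun t => (I1 t).2) (fun t z => dim z t) IG
  (fun t z => le_trans (ler_Im_normc _) (nb z t)).
rewrite (_ : _ \o _ = fun t => Rintegral leb2 setT (fun z => complex.Im (phi z * cis (th t z)))).
  exact: (@derive_val _ _ _ _ _ _ _ D).
by apply/funext => t; rewrite /= /impart E1.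
Qed.
End SchwartzFunctions.

(** * The transform of the derivative of a product *)

Section ProductTransform.
Context {R : realType}.
Local Open Scope complex_scope.
Local Notation normc := (@ComplexField.Normc.normc R).
Local Notation leb := (@lebesgue_measure R).
Local Notation leb2 := (leb \x leb)%E.
Local Notation plane := (measurableTypeR R * measurableTypeR R)%type.
Implicit Types (v g : plane -> R[i]).

(** The factor i xi is the symbol of the derivative, and (2 pi)^-2 the constant of
    Fourier inversion in the plane. *)
Definition product_transform g1 g2 (z : R * R) : R[i] :=
  (0 +i* (z.1 * (2 * pi) ^- 2)) * cintegral (fun a => g2 (psub z a) * g1 a).

Lemma cmeas_conv g1 g2 : cmeas g1 -> cmeas g2 ->
  cmeas (fun p : plane * plane => g2 (psub p.1 p.2) * g1 p.2).
Proof.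
move=> m1 m2; apply: cmeasM.
  exact: (cmeas_comp m2 measurable_psub).
exact: (cmeas_comp m1 measurable_snd).
Qed.

Lemma normc_imag (t : R) : normc (0 +i* t) = `|t|.
Proof. by rewrite /= expr0n add0r sqrtr_sqr. Qed.

Lemma cmeas_product_transform g1 g2 : cmeas g1 -> cmeas g2 ->
  cmeas (product_transform g1 g2 : plane -> R[i]).
Proof.
move=> m1 m2; apply: cmeasM.
  split; first exact: measurable_cst.
  by apply: measurable_funM => //; exact: measurable_fst.
exact: (cmeas_cintegral (F := fun z a => g2 (psub z a) * g1 a) (cmeas_conv m1 m2)).
Qed.

Lemma normc_conv_le g1 g2 z : cL2 g1 -> cL2 g2 ->
  ((normc (cintegral (fun a => g2 (psub z a) * g1 a)))%:E <=
   2%:E * \int[leb2]_a (normc (g1 a) * normc (g2 (psub z a)))%:E)%E.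
Proof.
move=> L1 L2; apply: (le_trans (normc_cintegral_le (cL2M_integrable (cL2_psub1 z L2) L1))).
by under eq_integral do rewrite normc_mul mulrC.
Qed.

Lemma cintegrable_product_transform g1 g2 phi : cL2 g1 -> cL2 g2 -> schwartz phi ->
  cintegrable (fun z => product_transform g1 g2 z * phi z).
Proof.
move=> L1 L2 Sphi; have [m1 f1] := L1; have [m2 f2] := L2.
pose S := fine (sqint g1 + sqint g2).
have SE : (sqint g1 + sqint g2)%E = S%:E by rewrite fineK// fin_numD !sqint_fin.
have S0 : 0 <= S by rewrite fine_ge0// adde_ge0// sqint_ge0.
have bound z : normc (cintegral (fun a => g2 (psub z a) * g1 a)) <= 2 * S.
  rewrite -lee_fin; apply: (le_trans (normc_conv_le z L1 L2)).
  rewrite EFinM lee_wpmul2l// -SE.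
  have [m2' _] := cL2_psub1 z L2.
  have := integral_normcM_le m1 m2'.
  under eq_integral do rewrite normc_mul.
  move=> /le_trans; apply; apply: leeD => //.
  rewrite /sqint (ge0_integral_psub1 z (f := fun a => (normc (g2 a) ^+ 2)%:E))//.
    by apply/measurable_EFinP; exact: measurable_normc2.
  by move=> a; rewrite lee_fin sqr_ge0.
apply: (cintegrable_le (v := fun z => ((2 * pi) ^- 2 * (2 * S))%:C * ((z.1 ^+ 1)%:C * phi z))).
- by apply: cmeasM; [exact: cmeas_product_transform|exact: schwartz_cmeas].
- exact: cintegrableZ (schwartz_cintegrable 1 Sphi).
move=> z; rewrite /product_transform !normc_mul normc_imag !normc_real expr1 normrM.
have p0 : 0 <= (2 * pi) ^- 2 :> R by rewrite invr_ge0 sqr_ge0.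
have p1 : 0 <= (2 * pi) ^- 2 * (2 * S) by rewrite !mulr_ge0.
rewrite [X in _ <= X]mulrA ler_wpM2r ?normc_ge0// (ger0_norm p0) (ger0_norm p1).
apply: (@le_trans _ _ (`|z.1| * (2 * pi) ^- 2 * (2 * S))).
  by apply: ler_wpM2l (bound z); rewrite mulr_ge0.
by rewrite le_eqVlt; apply/orP; left; apply/eqP; rewrite -mulrA mulrC.
Qed.

(** The pairing of d/dx (v1 v2) with the transform of phi is an integral of v1 v2
    against a transform; Fubini moves the transform to v1 v2, where [parseval]
    identifies it with the convolution. *)
Lemma represents_product_transform v1 v2 g1 g2 :
  cL2 v1 -> cL2 v2 -> cL2 g1 -> cL2 g2 ->
  represents g1 (distr_fourier (distr_of v1)) ->
  represents g2 (distr_fourier (distr_of v2)) ->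
  represents (product_transform g1 g2)
    (distr_fourier (distr_partial_x (distr_of (fun z => v1 z * v2 z)))).
Proof.
move=> L1 L2 M1 M2 r1 r2; split.
  by apply: cmeas_product_transform; [case: M1|case: M2].
move=> phi Sphi; split; first exact: cintegrable_product_transform.
have Iv : cintegrable (fun w => v1 w * v2 w) by exact: cL2M_integrable.
have Ip : cintegrable (fun z => phi z * (0 -i* z.1)).
  apply: (cintegrable_le _ (schwartz_cintegrable 1 Sphi)) => [|z].
    apply: cmeasM; first exact: schwartz_cmeas.
    split; first exact: measurable_cst.
    by apply: measurableT_comp => //; exact: measurable_fst.
  by rewrite !normc_mul normc_imag normrN normc_real expr1 mulrC.
have mk : measurable_fun [set: plane * plane] (fun p : plane * plane => - dot p.1 p.2).
  apply: measurableT_comp => //; apply: measurable_funD; apply: measurable_funM.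
  - exact: (measurableT_comp measurable_fst measurable_fst).
  - exact: (measurableT_comp measurable_fst measurable_snd).
  - exact: (measurableT_comp measurable_snd measurable_fst).
  exact: (measurableT_comp measurable_snd measurable_snd).
rewrite /distr_fourier /distr_partial_x /distr_of.
under eq_cintegral do rewrite cpartial_fourier//.
rewrite -(cFubini_phase Ip Iv mk).
rewrite -mulN1r -cintegralZ; last first.
  have mk' : measurable_fun [set: plane * plane] (fun p : plane * plane => - dot p.2 p.1).
    exact: measurable_dot_swap.
  exact: (cintegrable_phase Iv Ip mk').
apply: eq_cintegral => z.
rewrite /product_transform (parseval z L1 M1 L2 M2 r1 r2).
have -> : cintegral (fun w => v1 w * (v2 w * cis (- dot w z))) =
   cintegral (fun w => v1 w * v2 w * cis (- dot z w)).
  by apply: eq_cintegral => w; rewrite mulrA dotC.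
have p0 : (2 * pi : R) ^+ 2 != 0 by rewrite expf_neq0// mulf_neq0// gt_eqF// pi_gt0.
have E : - (0 -i* z.1) = (0 +i* (z.1 * (2 * pi) ^- 2)) * ((2 * pi) ^+ 2)%:C.
  apply: complex_eq; rewrite ?Re_mul ?Im_mul /= ?(mul0r, mulr0, subr0, oppr0, add0r)//.
  by rewrite opprK -mulrA mulVf ?mulr1.
by rewrite mulN1r -mulNr -mulrN E -[RHS]mulrC -!mulrA.
Qed.
End ProductTransform.

(** * The bilinear estimates *)

Section BilinearEstimate.
Context {R : realType}.
Local Open Scope complex_scope.
Local Notation normc := (@ComplexField.Normc.normc R).
Local Notation leb := (@lebesgue_measure R).
Local Notation leb2 := (leb \x leb)%E.
Local Notation plane := (measurableTypeR R * measurableTypeR R)%type.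
Implicit Types (v g : plane -> R[i]).

Lemma Xweight_gt0 al s b z : 0 < Xweight al s b z :> R.
Proof. by rewrite mulr_gt0// powR_gt0// bracket_gt0. Qed.

Lemma Xweight_ge1 al s b z : 0 <= s -> 0 <= b -> 1 <= Xweight al s b z :> R.
Proof.
have h (t r : R) : 0 <= r -> 1 <= bracket t `^ r.
  by move=> r0; rewrite -(powRr0 (bracket t)) ler_powR ?bracket_ge1.
by move=> s0 b0; rewrite -[leLHS]mul1r ler_pM ?h.
Qed.

Lemma measurable_Xweight al s b : measurable_fun [set: plane] (Xweight al s b : plane -> R).
Proof.
apply: measurable_funM.
  apply: (measurableT_comp (measurable_powR s)).
  exact: (measurableT_comp measurable_bracket measurable_fst).
apply: (measurableT_comp (measurable_powR b)).
apply: (measurableT_comp measurable_bracket).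
apply: measurable_funB; first exact: measurable_snd.
by apply: measurable_funM => //; apply: measurable_funX; exact: measurable_fst.
Qed.

Lemma measurable_inv_Xweight al s b :
  measurable_fun [set: plane] (fun z : plane => (Xweight al s b z)^-1 : R).
Proof.
under eq_fun => z do rewrite -powR_inv1 ?(ltW (Xweight_gt0 _ _ _ z))//.
exact: (measurableT_comp (@measurable_powR R (-1)) (measurable_Xweight al s b)).
Qed.

Lemma measurable_modulation (al : R) :
  measurable_fun [set: plane] (fun z : plane => ker (z.2 - al * z.1 ^+ 3)).
Proof.
apply: (measurableT_comp measurable_ker).
apply: measurable_funB; first exact: measurable_snd.
by apply: measurable_funM => //; apply: measurable_funX; exact: measurable_fst.
Qed.

Lemma powR34_sq (t : R) : 0 < t -> (t `^ (3 / 4)) ^+ 2 = t * Num.sqrt t.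
Proof.
move=> t0; rewrite expr2 -powRD; last by rewrite gt_eqF ?implybT.
rewrite (_ : 3 / 4 + 3 / 4 = 1 + 2^-1); last by field.
by rewrite powRD ?powRr1 ?powR12_sqrt ?ltW// gt_eqF ?implybT.
Qed.

Lemma powRm14_sq (t : R) : 0 < t -> (t `^ (3 / 4 - 1)) ^+ 2 = (Num.sqrt t)^-1.
Proof.
move=> t0; rewrite expr2 -powRD; last by rewrite (gt_eqF t0) implybT.
rewrite (_ : 3 / 4 - 1 + (3 / 4 - 1) = - 2^-1); last by field.
by rewrite powRN powR12_sqrt// ltW.
Qed.

(** The powers s >= 0 of the frequency weights contribute a factor at most 1,
    since <xi> <= <xi1> <xi - xi1>; the squares of the modulation weights are
    exactly the kernels. *)
Lemma Xweight_kernel (al0 al1 al2 s : R) (z w : R * R) : 0 <= s ->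
  z.1 ^+ 2 * Xweight al0 s (3 / 4 - 1) z ^+ 2 *
    ((Xweight al1 s (3 / 4) w)^-1 * (Xweight al2 s (3 / 4) (psub z w))^-1) ^+ 2 <=
  z.1 ^+ 2 / Num.sqrt (bracket (z.2 - al0 * z.1 ^+ 3)) *
     (ker (w.2 - al1 * w.1 ^+ 3) * ker ((z.2 - w.2) - al2 * (z.1 - w.1) ^+ 3)).
Proof.
move=> s0.
rewrite /Xweight /psub /=.
set t0 := bracket (z.2 - _); set t1 := bracket (w.2 - _); set t2 := bracket (_ - _ - _).
have t00 : 0 < t0 by exact: bracket_gt0.
have t10 : 0 < t1 by exact: bracket_gt0.
have t20 : 0 < t2 by exact: bracket_gt0.
rewrite /ker -/t1 -/t2 -!powR34_sq// -powRm14_sq//.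
clearbody t0 t1 t2.
have p1 : 0 < t1 `^ (3 / 4) by exact: powR_gt0.
have p2 : 0 < t2 `^ (3 / 4) by exact: powR_gt0.
move: (t0 `^ _) (t1 `^ _) (t2 `^ _) p1 p2 => a b c b0 c0.
have h : bracket z.1 `^ s <= bracket w.1 `^ s * bracket (z.1 - w.1) `^ s.
  rewrite -powRM; [|exact: ltW (bracket_gt0 _)|exact: ltW (bracket_gt0 _)].
  apply: ge0_ler_powR => //; rewrite ?nnegrE ?mulr_ge0 ?(ltW (bracket_gt0 _))//.
  by have := bracketD w.1 (z.1 - w.1); rewrite subrKC.
have q0 : 0 < bracket z.1 `^ s by rewrite powR_gt0// bracket_gt0.
have q1 : 0 < bracket w.1 `^ s by rewrite powR_gt0// bracket_gt0.
have q2 : 0 < bracket (z.1 - w.1) `^ s by rewrite powR_gt0// bracket_gt0.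
move: (bracket z.1 `^ s) (bracket w.1 `^ s) (bracket (z.1 - w.1) `^ s) q0 q1 q2 h => x y y' x0 y0 y0' h.
have -> : z.1 ^+ 2 * (x * a) ^+ 2 * ((y * b)^-1 * (y' * c)^-1) ^+ 2 =
  (x / (y * y')) ^+ 2 * (z.1 ^+ 2 * a ^+ 2 * ((b ^+ 2)^-1 * (c ^+ 2)^-1)).
  by field; rewrite !gt_eqF.
have r0 : 0 <= x / (y * y') by rewrite divr_ge0 ?mulr_ge0 ?ltW.
have r1 : x / (y * y') <= 1 by rewrite ler_pdivrMr ?mul1r ?mulr_gt0.
rewrite ler_piMl ?exprn_ile1//; apply: (mulr_ge0 (mulr_ge0 (sqr_ge0 _) (sqr_ge0 _))).
by apply: mulr_ge0; rewrite invr_ge0 sqr_ge0.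
Qed.

Lemma L2norm_ge0 (f : plane -> R) : (0 <= L2norm f)%E.
Proof. exact: Lnorm_ge0. Qed.

Lemma cL2_L2norm v : cmeas v -> (L2norm (modulus v) < +oo)%E -> cL2 v.
Proof.
move=> mv fv; split=> //.
have := L2norm_sq leb2 (modulus v); rewrite -/(L2norm (modulus v)) /sqint => <-.
by apply: lte_mul_pinfty => //; [exact: L2norm_ge0|rewrite ge0_fin_numE// L2norm_ge0].
Qed.

(** For s, b >= 0 the weight is at least 1. *)
Lemma cL2_weighted (al s b : R) g : 0 <= s -> 0 <= b -> cmeas g ->
  (L2norm (fun z => (Xweight al s b z * modulus g z)%R) < +oo)%E -> cL2 g.
Proof.
move=> s0 b0 mg fg.
have L : cL2 (fun z => (Xweight al s b z)%:C * g z).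
  apply: cL2_L2norm.
    by apply: cmeasM => //; apply: cmeas_real; exact: measurable_Xweight.
  rewrite (_ : modulus _ = fun z => Xweight al s b z * modulus g z)//.
  by apply/funext => z; rewrite /modulus normc_mul normc_real ger0_norm// ltW// Xweight_gt0.
apply: (cL2_le mg L) => z.
rewrite normc_mul normc_real ler_peMl ?normc_ge0// (le_trans _ (ler_norm _))//.
exact: Xweight_ge1.
Qed.

Lemma product_transform_bound (al0 al1 al2 s C : R) g1 g2 : 0 <= s -> 0 < C ->
  (forall z : R * R,
    (\int[leb2]_w (z.1 ^+ 2 / Num.sqrt (bracket (z.2 - al0 * z.1 ^+ 3)) *
     (ker (w.2 - al1 * w.1 ^+ 3) * ker ((z.2 - w.2) - al2 * (z.1 - w.1) ^+ 3)))%:E <= C%:E)%E) ->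
  cL2 g1 -> cL2 g2 ->
  (L2norm (fun z => (Xweight al0 s (3 / 4 - 1) z * modulus (product_transform g1 g2) z)%R) <=
   (1 + C)%:E * (L2norm (fun z => (Xweight al1 s (3 / 4) z * modulus g1 z)%R) *
                 L2norm (fun z => (Xweight al2 s (3 / 4) z * modulus g2 z)%R)))%E.
Proof.
move=> s0 C0 hC L1 L2; have [m1 _] := L1; have [m2 _] := L2.
set N1 := L2norm (fun z => Xweight al1 _ _ z * _); set N2 := L2norm (fun z => Xweight al2 _ _ z * _).
have N10 : (0 <= N1)%E by exact: L2norm_ge0.
have N20 : (0 <= N2)%E by exact: L2norm_ge0.
have C1 : 0 <= 1 + C by rewrite addr_ge0// ltW.
apply: lee_mul_self; first by rewrite mule_ge0 ?mule_ge0.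
have mn1 : measurable_fun setT (modulus g1) by exact: measurable_normc.
have mn2 : measurable_fun setT (modulus g2) by exact: measurable_normc.
pose q (z : plane) := z.1 ^+ 2 * Xweight al0 s (3 / 4 - 1) z ^+ 2.
have q0 z : 0 <= q z by rewrite mulr_ge0 ?sqr_ge0.
have mq : measurable_fun setT q.
  apply: measurable_funM; apply: measurable_funX; [exact: measurable_fst|exact: measurable_Xweight].
have W := @weighted_convolution R (modulus g1) (modulus g2) (Xweight al1 s (3 / 4))
  (Xweight al2 s (3 / 4)) q C mn1 mn2 (measurable_Xweight _ _ _) (measurable_Xweight _ _ _) mq
  (fun z => normc_ge0 _) (fun z => normc_ge0 _) (Xweight_gt0 _ _ _) (Xweight_gt0 _ _ _) q0 (ltW C0).
pose I (z : plane) := (\int[leb2]_w (modulus g1 w * modulus g2 (psub z w))%:E)%E.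
have I0 z : (0 <= I z)%E by apply: integral_ge0 => w _; rewrite lee_fin mulr_ge0 ?normc_ge0.
have mI : measurable_fun setT I.
  apply: (plane_measurable_integral (f := fun z w => (modulus g1 w * modulus g2 (psub z w))%:E)).
    apply/measurable_EFinP; apply: measurable_funM.
      exact: (measurableT_comp mn1 measurable_snd).
    exact: (measurableT_comp mn2 measurable_psub).
  by move=> x y; rewrite lee_fin mulr_ge0 ?normc_ge0.
rewrite {1}/L2norm L2norm_sq.
apply: (@le_trans _ _ (\int[leb2]_z ((q z)%:E * (I z * I z)))%E).
  apply: ge0_le_integral => //.
  - by move=> z _; rewrite lee_fin sqr_ge0.
  - apply/measurable_EFinP; apply: measurable_funX; apply: measurable_funM.
      exact: measurable_Xweight.
    by apply: measurable_normc; exact: cmeas_product_transform.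
  - apply: emeasurable_funM; first exact/measurable_EFinP.
    exact: emeasurable_funM.
  move=> z _.
  pose m := (2 * pi) ^- 2 * normc (cintegral (fun a => g2 (psub z a) * g1 a)).
  have p2 : 0 < (2 * pi) ^+ 2 :> R by rewrite exprn_gt0// mulr_gt0// pi_gt0.
  have m0 : 0 <= m by rewrite mulr_ge0 ?normc_ge0// invr_ge0 ltW.
  have mIz : (m%:E <= I z)%E.
    rewrite /m EFinM.
    apply: (@le_trans _ _ (((2 * pi) ^- 2)%:E * (2%:E * I z))%E).
      by apply: lee_wpmul2l; [rewrite lee_fin invr_ge0 ltW|exact: normc_conv_le].
    rewrite muleA -EFinM -[leRHS]mul1e; apply: lee_wpmul2r => //.
    rewrite lee_fin mulrC ler_pdivrMr// mul1r.
    by have := pi_ge2 R; nra.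
  have -> : (Xweight al0 s (3 / 4 - 1) z * modulus (product_transform g1 g2) z) ^+ 2 = q z * (m * m).
    rewrite /modulus /product_transform normc_mul normc_imag normrM /q /m.
    rewrite (ger0_norm (_ : 0 <= (2 * pi) ^- 2)); last by rewrite invr_ge0 ltW.
    rewrite -[z.1 ^+ 2]real_normK ?num_real//; ring.
  rewrite EFinM; apply: lee_wpmul2l; first by rewrite lee_fin.
  by rewrite EFinM; apply: lee_pmul.
apply: (le_trans (W _)) => [z|].
  apply: le_trans (hC z); apply: ge0_le_integral => //.
  - by move=> w _; rewrite lee_fin mulr_ge0 ?sqr_ge0.
  - apply/measurable_EFinP; apply: measurable_funM => //; apply: measurable_funX.
    apply: measurable_funM; first exact: measurable_inv_Xweight.
    exact: (measurableT_comp (measurable_inv_Xweight al2 s (3 / 4)) (measurable_psub1 z)).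
  - apply/measurable_EFinP; apply: measurable_funM => //; apply: measurable_funM.
      exact: measurable_modulation.
    exact: (measurableT_comp (measurable_modulation al2) (measurable_psub1 z)).
  by move=> w _; rewrite lee_fin; exact: Xweight_kernel.
rewrite -!L2norm_sq -/N1 -/N2.
have -> : (N1 * N1 * (N2 * N2) = N1 * N2 * (N1 * N2))%E by rewrite muleACA.
(* Since C <= (1 + C)^2, the constant 1 + C serves after taking square roots. *)
rewrite [leRHS]muleACA; apply: lee_wpmul2r; first by rewrite !mule_ge0.
by rewrite -EFinM lee_fin; nra.
Qed.

(** An estimate for all finite elements passes to the infima when these are
    finite. *)
Lemma ereal_inf_mul_le (A B : set (\bar R)) (X : \bar R) (C : R) : 0 < C ->
  (forall a, A a -> (0 <= a)%E) -> (forall b, B b -> (0 <= b)%E) ->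
  (ereal_inf A < +oo)%E -> (ereal_inf B < +oo)%E ->
  (forall a b, A a -> B b -> (a < +oo)%E -> (b < +oo)%E -> (X <= C%:E * (a * b))%E) ->
  (X <= C%:E * (ereal_inf A * ereal_inf B))%E.
Proof.
move=> C0 A0 B0 fA fB H.
have iA : (0 <= ereal_inf A)%E by apply: le_ereal_inf_tmp => a /A0.
have iB : (0 <= ereal_inf B)%E by apply: le_ereal_inf_tmp => a /B0.
have nA : ereal_inf A \is a fin_num by rewrite ge0_fin_numE.
have nB : ereal_inf B \is a fin_num by rewrite ge0_fin_numE.
pose x := fine (ereal_inf A); pose y := fine (ereal_inf B).
have xE : ereal_inf A = x%:E by rewrite fineK.
have yE : ereal_inf B = y%:E by rewrite fineK.
have x0 : 0 <= x by rewrite fine_ge0.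
have y0 : 0 <= y by rewrite fine_ge0.
rewrite xE yE; apply/lee_addgt0Pr => e e0.
(* With d <= 1, the product (x + d) (y + d) exceeds x y by at most
   d (x + y + 1). *)
pose d := Num.min 1 (e / (C * (x + y + 1))).
have D0 : 0 < C * (x + y + 1) by rewrite mulr_gt0// ltr_wpDl// addr_ge0.
have d0 : 0 < d by rewrite lt_min ltr01 divr_gt0.
have d1 : d <= 1 by rewrite ge_min lexx.
have de : d * (C * (x + y + 1)) <= e by rewrite -ler_pdivlMr// ge_min lexx orbT.
have [a Aa] := lb_ereal_inf_adherent d0 nA; rewrite xE -EFinD => ha.
have [b Bb] := lb_ereal_inf_adherent d0 nB; rewrite yE -EFinD => hb.
apply: (le_trans (H a b Aa Bb (lt_trans ha (ltry _)) (lt_trans hb (ltry _)))).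
apply: (@le_trans _ _ (C%:E * ((x + d)%:E * (y + d)%:E))%E).
  apply: lee_wpmul2l; first by rewrite lee_fin ltW.
  by apply: lee_pmul; [exact: A0|exact: B0|exact: ltW|exact: ltW].
rewrite -!EFinM -EFinD lee_fin.
apply: (@le_trans _ _ (C * (x * y) + d * (C * (x + y + d)))); first by rewrite le_eqVlt; apply/orP; left; apply/eqP; ring.
rewrite lerD2l; apply: le_trans de; rewrite ler_wpM2l ?(ltW d0)// ler_wpM2l ?(ltW C0)//.
by rewrite lerD2l.
Qed.

Lemma bilinear_estimate (al0 al1 al2 s : R) : 0 <= s -> resonant_bound al1 al2 al0 ->
  exists C : R, 0 < C /\ forall v1 v2,
    Xspace al1 s (3 / 4) v1 -> Xspace al2 s (3 / 4) v2 ->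
    (Xnorm al0 s (3 / 4 - 1) (distr_partial_x (distr_of (fun z => v1 z * v2 z)%R))
     <= C%:E * (Xnorm al1 s (3 / 4) (distr_of v1) * Xnorm al2 s (3 / 4) (distr_of v2)))%E.
Proof.
move=> s0 /plane_resonant_bound[C [C0 hC]].
exists (1 + C); split; first by rewrite addr_gt0.
move=> v1 v2 [mv1 fv1 fX1] [mv2 fv2 fX2].
have L1 := cL2_L2norm mv1 fv1; have L2 := cL2_L2norm mv2 fv2.
apply: ereal_inf_mul_le => //.
- by rewrite addr_gt0.
- by move=> _ [g _ <-]; exact: L2norm_ge0.
- by move=> _ [g _ <-]; exact: L2norm_ge0.
move=> _ _ [g1 r1 <-] [g2 r2 <-] f1 f2.
have b0 : 0 <= 3 / 4 :> R by rewrite divr_ge0.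
have M1 := cL2_weighted s0 b0 r1.1 f1; have M2 := cL2_weighted s0 b0 r2.1 f2.
apply: le_trans (product_transform_bound s0 C0 hC M1 M2).
apply: ereal_inf_lbound; exists (product_transform g1 g2) => //.
exact: represents_product_transform.
Qed.
End BilinearEstimate.

Theorem proposition5p3 (R : realType) (alpha : R) (alpha_gt0 : 0 < alpha)
    (alpha_lt1 : alpha < 1) (s : R) (s_ge0 : 0 <= s) :
  exists b : R, 2^-1 < b /\
    (exists C : R, 0 < C /\
       forall v1 v2 : R * R -> R[i],
         Xspace alpha s b v1 -> Xspace alpha s b v2 ->
         (Xnorm 1 s (b - 1) (distr_partial_x (distr_of (fun z => (v1 z * v2 z)%R)))
          <= C%:E * (Xnorm alpha s b (distr_of v1) *
                     Xnorm alpha s b (distr_of v2)))%E) /\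
    (exists C : R, 0 < C /\
       forall u v : R * R -> R[i],
         Xspace 1 s b u -> Xspace alpha s b v ->
         (Xnorm alpha s (b - 1) (distr_partial_x (distr_of (fun z => (u z * v z)%R)))
          <= C%:E * (Xnorm 1 s b (distr_of u) *
                     Xnorm alpha s b (distr_of v)))%E).
Proof.
exists (3 / 4); split; first by lra.
split; apply: bilinear_estimate => //; [exact: resonant_vv|exact: resonant_uv].
Qed.
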